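(* Let $T_k$ be an $L_2$-bounded Calderón–Zygmund operator on $(\mathbb{R}^d,dx)$ with scalar-valued kernel $k$, and assume that $$\sup_{Q \text{ dyadic}} \ \sum_{j \ge 1} \ \sup_{y \in Q} \Big( 2^{jd}\, \ell(Q)^d \int_{2^j \ell(Q) \le |x-c_Q| \le 2^{j+1} \ell(Q)} \big| k(x,y) - k(x,c_Q) \big|^2 \, dx \Big)^{\frac12} < \infty ,$$ where the first supremum runs over all dyadic cubes $Q$ of $\mathbb{R}^d$. Then there is a constant $C$, depending only on $d$, on the norm of $T_k$ on $L_2(\mathbb{R}^d)$ and on the value of the supremum above (and in particular independent of $m$), such that for every integer $m \ge 1$ and every integrable matrix-valued function $f: \mathbb{R}^d \to M_m$, $$\sup_{\lambda > 0} \ \lambda \int_{\mathbb{R}^d} \mathrm{tr} \big\{ |T_kf(x)| > \lambda \big\} \, dx \ \le \ C \int_{\mathbb{R}^d} \mathrm{tr} \big( |f(x)| \big) \, dx .$$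
   Context: A dyadic cube is a set $Q = 2^{-j}\big([k_1,k_1+1) \times \cdots \times [k_d,k_d+1)\big)$ with $j \in \mathbb{Z}$ and $(k_1,\dots,k_d) \in \mathbb{Z}^d$; $\ell(Q)=2^{-j}$ is its side length and $c_Q$ its center. $M_m$ is the algebra of complex $m \times m$ matrices with its usual (non-normalized) trace $\mathrm{tr}$. For $a \in M_m$, $|a| = (a^*a)^{1/2}$ and $\{|a|>\lambda\}$ denotes the spectral projection of $|a|$ associated with $(\lambda,\infty)$, so $\mathrm{tr}\{|a|>\lambda\}$ is the number of singular values of $a$ exceeding $\lambda$. An $L_2$-bounded Calderón–Zygmund operator $T_k$ with kernel $k: \mathbb{R}^{2d} \setminus \{(x,y): x=y\} \to \mathbb{C}$ is a bounded linear operator on $L_2(\mathbb{R}^d,dx)$ such that $T_k f(x) = \int_{\mathbb{R}^d} k(x,y) f(y)\,dy$ for $x \notin \mathrm{supp}(f)$ (for, say, compactly supported $f \in L_2$). It acts on $M_m$-valued functions entrywise: $T_k f = (T_k(f_{ij}))_{i,j}$. The weak type inequality is understood on the dense subspace of compactly supported functions in $L_1 \cap L_2$, and $T_k$ is then extended to $L_1$ by density. *)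

(* Defs.v *)
From HB Require Import structures.
From mathcomp Require Import all_boot all_order all_algebra.
From mathcomp Require Import all_classical all_reals all_analysis.
From mathcomp.real_closed Require Import complex.

Set Implicit Arguments.
Unset Strict Implicit.
Unset Printing Implicit Defensive.
Import Order.TTheory GRing.Theory Num.Theory.
Import numFieldTopology.Exports numFieldNormedType.Exports.

Local Open Scope classical_set_scope.
Local Open Scope ring_scope.
Local Open Scope sesquilinear_scope.

(* The space R^d is 'rV[R]_d with its library topology.  Its sigma-algebra is
   the product one, generated by the coordinates; it equals the Borel one. *)
Definition rV_display : measure_display. Proof. by constructor. Qed.

Section rV_measurable.
Context (R : realType) (d : nat).

Definition rV_measurable : set (set 'rV[R]_d) :=
  g_sigma_preimage
    (fun (i : 'I_d) (v : 'rV[R]_d) => v ord0 i : measurableTypeR R).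

Let rV_measurable0 : rV_measurable set0.
Proof. exact: sigma_algebra0. Qed.

Let rV_measurableC A : rV_measurable A -> rV_measurable (~` A).
Proof. exact: sigma_algebraC. Qed.

Let rV_measurable_bigcup (F : _^nat) :
  (forall i, rV_measurable (F i)) -> rV_measurable (\bigcup_i F i).
Proof. exact: sigma_algebra_bigcup. Qed.

HB.instance Definition _ := @isMeasurable.Build rV_display 'rV[R]_d
  rV_measurable rV_measurable0 rV_measurableC rV_measurable_bigcup.

Lemma measurable_coord (i : 'I_d) : measurable_fun [set: 'rV[R]_d]
  (fun v => v ord0 i : measurableTypeR R).
Proof.
move=> _ Y mY; rewrite setTI; apply: sub_sigma_algebra => /=.
rewrite -bigcup_seq/=; exists i => /=; first by rewrite mem_index_enum.
by exists Y => //; rewrite setTI.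
Qed.

End rV_measurable.

Section lebesgue_rV.
Context (R : realType).

Definition consrV (d : nat) (p : measurableTypeR R * 'rV[R]_d) : 'rV[R]_d.+1 :=
  row_mx (const_mx p.1 : 'rV[R]_1) p.2.

Lemma consrV0 d p : @consrV d p ord0 ord0 = p.1.
Proof.
by rewrite /consrV mxE; case: splitP => // j _; rewrite mxE.
Qed.

Lemma consrVS d p i : @consrV d p ord0 (lift ord0 i) = p.2 ord0 i.
Proof.
rewrite /consrV mxE; case: splitP => [[[]]//|j /=].
by rewrite /bump/= => -[]/val_inj ->.
Qed.

Lemma measurable_consrV d : measurable_fun setT (@consrV d).
Proof.
have mc i : measurable_fun setT
    (fun p => @consrV d p ord0 i : measurableTypeR R).
  case: (unliftP ord0 i) => [j|] ->.
    under eq_fun do rewrite consrVS.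
    exact: (measurableT_comp (measurable_coord j) measurable_snd).
  by under eq_fun do rewrite consrV0; exact: measurable_fst.
move=> _ Y; rewrite setTI.
move: Y; apply: smallest_sub => /=.
  split; rewrite /= ?preimage_set0//.
  - by move=> A mA; rewrite setTD preimage_setC; exact: measurableC.
  - by move=> F mF; rewrite preimage_bigcup; exact: bigcup_measurable.
rewrite -bigcup_seq/=; apply: bigcup_sub => i _ _ [A mA <-]/=.
by rewrite setTI -[X in measurable X]setTI; exact: (mc i).
Qed.

Section lebesgue_rVS.
Context (d : nat) (mu : {sigma_finite_measure set 'rV[R]_d -> \bar R}).
Local Open Scope ereal_scope.

Definition lebesgue_rVS : set 'rV[R]_d.+1 -> \bar R :=
  pushforward (lebesgue_measure \x mu) (@consrV d).

Let nu : {measure set _ -> \bar R} := (lebesgue_measure \x mu).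

Let lebesgue_rVS0 : lebesgue_rVS set0 = 0.
Proof. by rewrite /lebesgue_rVS /pushforward preimage_set0 (measure0 nu). Qed.

Let lebesgue_rVS_ge0 A : 0 <= lebesgue_rVS A.
Proof. exact: (measure_ge0 nu). Qed.

Let lebesgue_rVS_sigma_additive : semi_sigma_additive lebesgue_rVS.
Proof.
move=> F mF tF mUF; rewrite /lebesgue_rVS /pushforward preimage_bigcup.
apply: (@measure_semi_sigma_additive _ _ _ nu).
- by move=> n; rewrite -[X in measurable X]setTI; exact: measurable_consrV.
- apply/trivIsetP => /= i j _ _ ij; rewrite -preimage_setI.
  by move/trivIsetP : tF => /(_ _ _ _ _ ij) ->//; rewrite preimage_set0.
- by rewrite -preimage_bigcup -[X in measurable X]setTI;
    exact: measurable_consrV.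
Qed.

HB.instance Definition _ := isMeasure.Build _ _ _ lebesgue_rVS
  lebesgue_rVS0 lebesgue_rVS_ge0 lebesgue_rVS_sigma_additive.

Lemma measurable_tailrV : measurable_fun [set: 'rV[R]_d.+1]
  (fun v => \row_j v ord0 (lift ord0 j) : 'rV[R]_d).
Proof.
move=> _ Y; rewrite setTI; move: Y; apply: smallest_sub => /=.
  split; rewrite /= ?preimage_set0//.
  - by move=> A mA; rewrite setTD preimage_setC; exact: measurableC.
  - by move=> F mF; rewrite preimage_bigcup; exact: bigcup_measurable.
rewrite -bigcup_seq/=; apply: bigcup_sub => i _ _ [A mA <-]/=.
rewrite setTI (_ : _ @^-1` _ =
  (fun v : 'rV[R]_d.+1 => v ord0 (lift ord0 i)) @^-1` A).
  by rewrite -[X in measurable X]setTI; exact: (measurable_coord (lift ord0 i)).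
by apply/seteqP; split => v /=; rewrite mxE.
Qed.

Lemma lebesgue_rVSE (A : set R) (B : set 'rV[R]_d) :
  measurable (A : set (measurableTypeR R)) -> measurable B ->
  lebesgue_rVS [set v | A (v ord0 ord0) /\ B (\row_j v ord0 (lift ord0 j))] =
  lebesgue_measure A * mu B.
Proof.
move=> mA mB; rewrite -product_measure1E//.
rewrite /lebesgue_rVS /pushforward; congr (_ _).
apply/seteqP; split => -[x v] /=; rewrite consrV0 /=;
  (rewrite (_ : \row_j _ = v);
    [by []|by apply/rowP => j; rewrite mxE consrVS]).
Qed.

Let lebesgue_rVS_sigma_finite : sigma_finite setT lebesgue_rVS.
Proof.
have /sigma_finiteP[F [TF ndF Foo]] := sigma_finiteT (@lebesgue_measure R).
have /sigma_finiteP[G [TG ndG Goo]] := sigma_finiteT mu.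
exists (fun n => [set v : 'rV[R]_d.+1 |
    F n (v ord0 ord0) /\ G n (\row_j v ord0 (lift ord0 j))]).
  apply/seteqP; split => // v _.
  have [n _ Fn] : (\bigcup_k F k) (v ord0 ord0) by rewrite -TF.
  have [m _ Gm] : (\bigcup_k G k) (\row_j v ord0 (lift ord0 j)) by rewrite -TG.
  exists (maxn n m) => //; split.
  - by move: Fn; exact/subsetPset/ndF/leq_maxl.
  - by move: Gm; exact/subsetPset/ndG/leq_maxr.
move=> n; have [mF Fn] := Foo n; have [mG Gn] := Goo n; split.
  have mF' : measurable ((fun v : 'rV[R]_d.+1 => v ord0 ord0) @^-1` F n).
    by rewrite -[X in measurable X]setTI; exact: (measurable_coord ord0).
  have mG' : measurable
      ((fun v : 'rV[R]_d.+1 => \row_j v ord0 (lift ord0 j)) @^-1` G n).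
    by rewrite -[X in measurable X]setTI; exact: measurable_tailrV.
  exact: measurableI mF' mG'.
by rewrite lebesgue_rVSE// lte_mul_pinfty// ge0_fin_numE.
Qed.

HB.instance Definition _ := Measure_isSigmaFinite.Build _ _ _ lebesgue_rVS
  lebesgue_rVS_sigma_finite.

End lebesgue_rVS.

(* Lebesgue measure on R^d, by induction: R^0 carries the unit mass and
   R^(d+1) is identified with R * R^d. *)
Fixpoint lebesgue_rV (d : nat) : {sigma_finite_measure set 'rV[R]_d -> \bar R} :=
  match d with
  | 0 => (\d_ (0 : 'rV[R]_0))
  | d'.+1 => lebesgue_rVS (lebesgue_rV d')
  end.

Lemma lebesgue_rV_box d (A : 'I_d -> set R) :
  (forall i, measurable (A i : set (measurableTypeR R))) ->
  lebesgue_rV d [set v | forall i, A i (v ord0 i)] =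
  (\prod_i lebesgue_measure (A i))%E.
Proof.
elim: d A => [|d IH] A mA.
  rewrite big_ord0 /= diracE mem_set//.
  by case.
pose B := [set v : 'rV[R]_d | forall i, A (lift ord0 i) (v ord0 i)].
have mB : measurable B.
  rewrite (_ : B = \bigcap_(i in [set: 'I_d])
      ((fun v : 'rV[R]_d => v ord0 i) @^-1` A (lift ord0 i))); last first.
    by apply/seteqP; split => v /= vA => [i _|i]; exact: vA.
  apply: fin_bigcap_measurable => // i _; rewrite -[X in measurable X]setTI.
  exact: measurable_coord.
rewrite big_ord_recl -[X in (_ * X)%E]IH//.
rewrite -[RHS](lebesgue_rVSE (lebesgue_rV d) (mA ord0) mB) /=.
congr (lebesgue_rVS _ _); apply/seteqP; split => v /=.
  by move=> vA; split => // i; rewrite mxE.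
move=> [v0 vS] i; case: (unliftP ord0 i) => [j|] -> //.
by have := vS j; rewrite mxE.
Qed.
End lebesgue_rV.

Section functions.
Context (R : realType) (d : nat).
Local Notation E := 'rV[R]_d.
Local Notation C := R[i].
Local Notation mu := (lebesgue_rV R d).
Implicit Types (f g : E -> C) (x y : E).

(* The matrix norm of the library is the sup norm. *)
Definition enorm x : R := Num.sqrt (\sum_(i < d) x ord0 i ^+ 2).

(* The library norm of R[i] takes its values in R[i]. *)
Definition cabs (z : C) : R := complex.Re `|z|.

Definition cmeasurable f : Prop :=
  measurable_fun setT (fun x => complex.Re (f x)) /\
  measurable_fun setT (fun x => complex.Im (f x)).

Definition cintegral f : C :=
  Complex (\int[mu]_x complex.Re (f x))%R (\int[mu]_x complex.Im (f x))%R.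

Definition cLnorm (p : \bar R) f : \bar R :=
  ('N[mu]_p [EFin \o (cabs \o f)])%E.

Definition Lp (p : \bar R) f : Prop :=
  cmeasurable f /\ (cLnorm p f < +oo)%E.

Definition weak_L1norm f : \bar R :=
  ereal_sup [set (lam%:E * mu [set x | (lam < cabs (f x))%R])%E
            | lam in [set lam : R | 0 < lam]].

Definition supp f : set E := closure [set x | f x != 0].

Definition compact_L1L2 f : Prop :=
  [/\ Lp 1%:E f, Lp 2%:E f & compact (supp f)].

(* A dyadic cube is given by its generation j and its corner k. *)
Definition side (j : int) : R := 2 ^ (- j).

Definition dyadic_cube (j : int) (k : 'rV[int]_d) : set E :=
  [set x : E | forall i : 'I_d, side j * (k ord0 i)%:~R <= x ord0 i
                                           < side j * (k ord0 i + 1)%:~R].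

Definition cube_center (j : int) (k : 'rV[int]_d) : E :=
  \row_i (side j * ((k ord0 i)%:~R + 2^-1)).

Definition annulus (c : E) (r s : R) : set E :=
  [set x : E | r <= enorm (x - c) <= s].

Definition hormander (k : E -> E -> C) : \bar R :=
  ereal_sup [set
    (\sum_(1 <= n <oo) ereal_sup
      [set (((2 ^+ (n * d) * side Q.1 ^+ d)%R%:E *
             \int[mu]_(x in annulus (cube_center Q.1 Q.2)
                              (2 ^+ n * side Q.1) (2 ^+ n.+1 * side Q.1))
               ((cabs (k x y - k x (cube_center Q.1 Q.2))) ^+ 2)%:E) `^ 2^-1)%E
      | y in dyadic_cube Q.1 Q.2])%E
  | Q in [set: int * 'rV[int]_d]].

(* T acts on representatives of classes of functions that are equal almost
   everywhere; its values outside L2 are irrelevant, and so are those of k on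
   the diagonal. *)
Record CZ_operator (k : E -> E -> C) (T : (E -> C) -> (E -> C)) : Prop := {
  CZ_kernel_Re : measurable_fun [set xy : E * E | xy.1 != xy.2]
    (fun xy => complex.Re (k xy.1 xy.2));
  CZ_kernel_Im : measurable_fun [set xy : E * E | xy.1 != xy.2]
    (fun xy => complex.Im (k xy.1 xy.2));
  CZ_L2 : forall f, Lp 2%:E f -> Lp 2%:E (T f);
  CZ_ae : forall f g, Lp 2%:E f -> Lp 2%:E g ->
    {ae mu, forall x, f x = g x} -> {ae mu, forall x, T f x = T g x};
  CZ_linear : forall (a : C) f g, Lp 2%:E f -> Lp 2%:E g ->
    {ae mu, forall x, T (fun y => a * f y + g y) x = a * T f x + T g x};
  CZ_bounded : exists M : R, forall f, Lp 2%:E f ->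
    (cLnorm 2%:E (T f) <= M%:E * cLnorm 2%:E f)%E;
  CZ_kernel : forall f, Lp 2%:E f -> compact (supp f) ->
    {ae mu, forall x, ~ supp f x ->
      Lp 1%:E (fun y => k x y * f y) /\
      T f x = cintegral (fun y => k x y * f y)}
}.

Definition opnorm (T : (E -> C) -> (E -> C)) : R :=
  inf [set M : R | 0 <= M /\ forall f, Lp 2%:E f ->
    (cLnorm 2%:E (T f) <= M%:E * cLnorm 2%:E f)%E].

(* T1 is the extension of T by density, from the compactly supported functions
   of L1 and L2 to L1, with convergence of the images in weak L1; it is
   determined by T up to null sets. *)
Record L1_extension (T T1 : (E -> C) -> (E -> C)) : Prop := {
  L1_extension_measurable : forall f, Lp 1%:E f -> cmeasurable (T1 f);
  L1_extension_agree : forall f, compact_L1L2 f ->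
    {ae mu, forall x, T1 f x = T f x};
  L1_extension_cvg : forall (f : E -> C) (u : nat -> E -> C),
    Lp 1%:E f -> (forall n, compact_L1L2 (u n)) ->
    cLnorm 1%:E (fun x => u n x - f x) @[n --> \oo] --> 0%E ->
    weak_L1norm (fun x => T (u n) x - T1 f x) @[n --> \oo] --> 0%E
}.

Definition entrywise (T : (E -> C) -> (E -> C)) (m : nat)
    (f : E -> 'M[C]_m) : E -> 'M[C]_m :=
  fun x => \matrix_(i, j) T (fun y => f y i j) x.

End functions.

Section matrices.
Context (R : realType) (m : nat).
Local Notation C := R[i].
Implicit Types A : 'M[C]_m.

(* h(A), for A normal; h is applied to the eigenvalues in an orthonormal
   eigenbasis. *)
Definition funcalc (h : C -> C) A : 'M[C]_m :=
  invmx (spectralmx A) *m diag_mx (map_mx h (spectral_diag A)) *m spectralmx A.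

Definition mxabs A : 'M[C]_m := funcalc sqrtC (A ^t* *m A).

Definition spectral_proj (lam : R) A : 'M[C]_m :=
  funcalc (fun z => (lam%:C%C < z)%R%:R) A.

(* The traces below are real. *)
Definition Retr A : R := complex.Re (\tr A).

End matrices.

(* Main.v *)
(** It suffices to treat dyadic step functions: they are dense in L1, and T of
    such a function is a finite sum of the T 1_Q.  Splitting a matrix into four
    positive parts reduces the estimate at level lam to a positive step function f.
    Cuculescu's projections for the finite dyadic filtration give disjoint
    projections p_Q such that f = g + sum_t b_t, where
      b_t = p_t (f - E_(t+1) f) q_t + q_(t+1) (f - E_(t+1) f) p_t,
    lam sum_Q |Q| rank p_Q <= int tr f and int tr g^2 <= 2^d lam int tr f.
    The part T g is bounded in L2.  If x is near Q, then the block of T b_t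
    coming from Q has rank at most 2 rank p_Q at x, so only the measure of a
    dilation of Q matters.  If x is far from Q, then cancellation replaces k(x,y)
    by k(x,y) - k(x,c_Q); the Hilbert-Schmidt norm of the block is controlled by
    the L2 Hormander condition, and its trace norm by
      tr |M| <= (tau rank M + tau^-1 tr M^* M) / 2,
    with tau adapted to the annulus containing x. *)

Require Import Defs.
From HB Require Import structures.
From mathcomp Require Import all_boot all_order all_algebra.
From mathcomp Require Import all_classical all_reals all_analysis.
From mathcomp Require Import measurable_realfun.
From mathcomp.real_closed Require Import complex.
From mathcomp Require Import ring lra zify.

Set Implicit Arguments.
Unset Strict Implicit.
Unset Printing Implicit Defensive.
Import Order.TTheory GRing.Theory Num.Theory.
Import numFieldTopology.Exports numFieldNormedType.Exports.
Import HBNNSimple.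

Local Open Scope classical_set_scope.
Local Open Scope ring_scope.

(** * Complex numbers and matrices *)

(** The obstacle is that positivity does not localize: cutting [f] by projections leaves corners
    [p_t f q_(t+1)], and the trace norm of such a corner is not bounded by [tr (p_t f p_t)], so the
    scalar argument, which adds up L1 norms of the bad pieces, breaks down. What survives is a
    Hilbert-Schmidt bound: if the compressions [q f_i q] over the cells of a cube add up to at most
    [c], then the square norm of [sum_i psi_i p f_i q] is at most [c sum_i |psi_i|^2 tr (p f_i p)],
    which is again linear in [f]. This fixes the shape of [b_t], with [p_t] on one side of each term
    and on the other a projection under which the averages stay below [2^d lam]; it also explains
    why the kernel condition is in L2 and why ranks enter. No off-diagonal term appears in [g]
    because [p_t] commutes with [q_t (E_(t+1) f) q_t]. Near the cubes the rank is counted at each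
    point, which uses no part of the level [lam]. The matrix size enters only errors of
    approximation, which can be made arbitrarily small. *)

Section complex_real.
Context (R : realType).
Local Notation C := R[i].
Implicit Types (a b : C) (x y : R).

Lemma cReD a b : complex.Re (a + b) = complex.Re a + complex.Re b.
Proof. by case: a; case: b. Qed.
Lemma cImD a b : complex.Im (a + b) = complex.Im a + complex.Im b.
Proof. by case: a; case: b. Qed.
Lemma cReN a : complex.Re (- a) = - complex.Re a.
Proof. by case: a. Qed.
Lemma cImN a : complex.Im (- a) = - complex.Im a.
Proof. by case: a. Qed.
Lemma cReB a b : complex.Re (a - b) = complex.Re a - complex.Re b.
Proof. by rewrite cReD cReN. Qed.
Lemma cImB a b : complex.Im (a - b) = complex.Im a - complex.Im b.
Proof. by rewrite cImD cImN. Qed.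
Lemma cReM a b : complex.Re (a * b) =
  complex.Re a * complex.Re b - complex.Im a * complex.Im b.
Proof. by case: a; case: b. Qed.
Lemma cImM a b : complex.Im (a * b) =
  complex.Re a * complex.Im b + complex.Im a * complex.Re b.
Proof. by case: a; case: b. Qed.
Lemma cReZ x a : complex.Re (x%:C%C * a) = x * complex.Re a.
Proof. by rewrite cReM /= mul0r subr0. Qed.
Lemma cImZ x a : complex.Im (x%:C%C * a) = x * complex.Im a.
Proof. by rewrite cImM /= mul0r addr0. Qed.
Lemma cRe_conj a : complex.Re (a^*)%R = complex.Re a.
Proof. by case: a. Qed.
Lemma cIm_conj a : complex.Im (a^*)%R = - complex.Im a.
Proof. by case: a. Qed.
Lemma conj_real x : ((x%:C%C : C)^*)%R = x%:C%C.
Proof. by apply/eqP; rewrite eq_complex /= oppr0 !eqxx. Qed.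

Lemma cRe_sum I (r : seq I) (P : pred I) (F : I -> C) :
  complex.Re (\sum_(i <- r | P i) F i) = \sum_(i <- r | P i) complex.Re (F i).
Proof. exact: (big_morph _ cReD erefl). Qed.
Lemma complex_inj a b :
  complex.Re a = complex.Re b -> complex.Im a = complex.Im b -> a = b.
Proof. by case: a => ? ?; case: b => ? ? /= -> ->. Qed.

Lemma real_of_conj a : (a^*)%R = a -> a = (complex.Re a)%:C%C.
Proof.
move=> h; apply: complex_inj => //=.
by have := cIm_conj a; rewrite h; lra.
Qed.

Lemma cabsE a : cabs a = Num.sqrt (complex.Re a ^+ 2 + complex.Im a ^+ 2).
Proof. by case: a. Qed.
Lemma cabs_ge0 a : 0 <= cabs a.
Proof. by rewrite cabsE sqrtr_ge0. Qed.
Lemma cabs_sq a : cabs a ^+ 2 = complex.Re a ^+ 2 + complex.Im a ^+ 2.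
Proof. by rewrite cabsE sqr_sqrtr// addr_ge0 ?sqr_ge0. Qed.
Lemma norm_cabs a : `|a| = (cabs a)%:C%C.
Proof. by case: a. Qed.
Lemma cabsD a b : cabs (a + b) <= cabs a + cabs b.
Proof.
have := ler_normD a b; rewrite !norm_cabs -rmorphD /=.
by rewrite lecE /= eqxx.
Qed.
Lemma cabsM a b : cabs (a * b) = cabs a * cabs b.
Proof.
have := normrM a b; rewrite !norm_cabs -rmorphM /= => /(congr1 (@complex.Re R)).
by [].
Qed.
Lemma cabs0 : cabs (0 : C) = 0.
Proof. by rewrite cabsE /= expr0n /= addr0 sqrtr0. Qed.
Lemma cabsN a : cabs (- a) = cabs a.
Proof. by rewrite !cabsE cReN cImN !sqrrN. Qed.
Lemma cabsBC a b : cabs (a - b) = cabs (b - a).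
Proof. by rewrite -cabsN opprB. Qed.
Lemma cabs_real x : cabs (x%:C%C : C) = `|x|.
Proof. by rewrite cabsE /= expr0n /= addr0 sqrtr_sqr. Qed.
Lemma cabs_conj a : cabs (a^*)%R = cabs a.
Proof. by rewrite !cabsE cRe_conj cIm_conj sqrrN. Qed.
Lemma cabs_Re a : `|complex.Re a| <= cabs a.
Proof. by rewrite cabsE -sqrtr_sqr ler_wsqrtr// lerDl sqr_ge0. Qed.
Lemma cabs_Im a : `|complex.Im a| <= cabs a.
Proof. by rewrite cabsE -sqrtr_sqr ler_wsqrtr// lerDr sqr_ge0. Qed.
Lemma cabs_leReIm a : cabs a <= `|complex.Re a| + `|complex.Im a|.
Proof.
rewrite -(ler_pXn2r (ltn0Sn 1)) ?nnegrE ?cabs_ge0 ?addr_ge0//.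
rewrite cabs_sq sqrrD !real_normK ?num_real// -addrA [X in _ <= _ + X]addrC.
by rewrite lerD2l lerDl mulrn_wge0// mulr_ge0.
Qed.
Lemma cabs_eq0 a : (cabs a == 0) = (a == 0).
Proof.
rewrite -sqrf_eq0 cabs_sq paddr_eq0 ?sqr_ge0// !sqrf_eq0.
by rewrite eq_complex.
Qed.
End complex_real.

Section matrix_adjoint.
Local Open Scope sesquilinear_scope.
Context (R : realType).
Local Notation C := R[i].

Definition adj m n (A : 'M[C]_(m, n)) : 'M[C]_(n, m) := A ^t*.

Section adj.
Context (m n : nat).
Implicit Types (A B : 'M[C]_(m, n)).

Lemma adjE A i j : adj A i j = ((A j i)^*)%R.
Proof. by rewrite !mxE. Qed.
Lemma adjK A : adj (adj A) = A.
Proof. exact: trmxCK. Qed.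
Lemma adjM p A (B : 'M[C]_(n, p)) : adj (A *m B) = adj B *m adj A.
Proof. by rewrite /adj trmx_mul map_mxM. Qed.
Lemma adjD A B : adj (A + B) = adj A + adj B.
Proof. by rewrite /adj raddfD map_mxD. Qed.
Lemma adjN A : adj (- A) = - adj A.
Proof. by rewrite /adj raddfN map_mxN. Qed.
Lemma adjB A B : adj (A - B) = adj A - adj B.
Proof. by rewrite adjD adjN. Qed.
Lemma adj0 : adj (0 : 'M[C]_(m, n)) = 0.
Proof. by rewrite /adj trmx0 map_mx0. Qed.
Lemma adjZ (a : C) A : adj (a *: A) = ((a^*)%R : C) *: adj A.
Proof. by rewrite /adj linearZ/= map_mxZ. Qed.
Lemma adjZr (x : R) A : adj (x%:C%C *: A) = x%:C%C *: adj A.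
Proof. by rewrite adjZ conj_real. Qed.
Lemma adj_sum I (r : seq I) (P : pred I) (F : I -> 'M[C]_(m, n)) :
  adj (\sum_(i <- r | P i) F i) = \sum_(i <- r | P i) adj (F i).
Proof. exact: (big_morph _ adjD adj0). Qed.
End adj.

Lemma adj1 m : adj (1%:M : 'M[C]_m) = 1%:M.
Proof. by rewrite /adj trmx1 map_mx1. Qed.

Section Retr.
Context (m : nat).
Implicit Types A B : 'M[C]_m.
Lemma RetrD A B : Retr (A + B) = Retr A + Retr B.
Proof. by rewrite /Retr mxtraceD cReD. Qed.
Lemma RetrN A : Retr (- A) = - Retr A.
Proof. by rewrite /Retr raddfN cReN. Qed.
Lemma RetrB A B : Retr (A - B) = Retr A - Retr B.
Proof. by rewrite RetrD RetrN. Qed.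
Lemma Retr0 : Retr (0 : 'M[C]_m) = 0.
Proof. by rewrite /Retr raddf0. Qed.
Lemma RetrZ (x : R) A : Retr (x%:C%C *: A) = x * Retr A.
Proof. by rewrite /Retr mxtraceZ cReZ. Qed.
Lemma Retr_sum I (r : seq I) (P : pred I) (F : I -> 'M[C]_m) :
  Retr (\sum_(i <- r | P i) F i) = \sum_(i <- r | P i) Retr (F i).
Proof. exact: (big_morph _ RetrD Retr0). Qed.
Lemma Retr_adj A : Retr (adj A) = Retr A.
Proof.
rewrite /Retr /mxtrace !cRe_sum; apply: eq_bigr => i _.
by rewrite adjE cRe_conj.
Qed.
End Retr.

Lemma Retr_mulC m n (A : 'M[C]_(m, n)) (B : 'M[C]_(n, m)) :
  Retr (A *m B) = Retr (B *m A).
Proof. by rewrite /Retr mxtrace_mulC. Qed.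

(** The squared Hilbert-Schmidt norm; [ip] is the real part of the inner product that polarizes
    it. *)
Definition hs m n (A : 'M[C]_(m, n)) : R := Retr (A *m adj A).
Definition ip m n (A B : 'M[C]_(m, n)) : R := Retr (A *m adj B).

Lemma hsE m n (A : 'M[C]_(m, n)) :
  hs A = \sum_i \sum_j cabs (A i j) ^+ 2.
Proof.
rewrite /hs /Retr /mxtrace cRe_sum; apply: eq_bigr => i _.
rewrite mxE cRe_sum; apply: eq_bigr => j _.
by rewrite adjE cReM cRe_conj cIm_conj cabs_sq -!expr2 mulrN opprK.
Qed.

Lemma hs_ge0 m n (A : 'M[C]_(m, n)) : 0 <= hs A.
Proof.
by rewrite hsE; apply: sumr_ge0 => i _; apply: sumr_ge0 => j _; rewrite sqr_ge0.
Qed.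

Lemma hs_eq0 m n (A : 'M[C]_(m, n)) : hs A = 0 -> A = 0.
Proof.
rewrite hsE => /eqP; rewrite psumr_eq0 => [/allP h|i _]; last first.
  by apply: sumr_ge0 => j _; rewrite sqr_ge0.
apply/matrixP => i j; have := h i (mem_index_enum _); rewrite implyTb.
rewrite psumr_eq0 => [/allP /(_ j (mem_index_enum _))|? _]; last exact: sqr_ge0.
by rewrite implyTb sqrf_eq0 cabs_eq0 mxE => /eqP.
Qed.

Lemma hs_adj m n (A : 'M[C]_(m, n)) : hs (adj A) = hs A.
Proof. by rewrite /hs adjK Retr_mulC. Qed.

Lemma hsZ m n (x : R) (A : 'M[C]_(m, n)) : hs (x%:C%C *: A) = x ^+ 2 * hs A.
Proof. by rewrite /hs adjZr -scalemxAl -scalemxAr !RetrZ mulrA. Qed.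

Lemma hs0 m n : hs (0 : 'M[C]_(m, n)) = 0.
Proof. by rewrite /hs mul0mx Retr0. Qed.

Lemma hsD m n (A B : 'M[C]_(m, n)) : hs (A + B) = hs A + ip A B *+ 2 + hs B.
Proof.
rewrite /hs /ip adjD mulmxDl !mulmxDr !RetrD.
have -> : Retr (B *m adj A) = Retr (A *m adj B) by rewrite -Retr_adj adjM adjK.
by rewrite mulr2n !addrA.
Qed.

(** Expands [0 <= hs (t A - B)]. The free weight [t] is optimized in [ip_cs] and used for an
    absorption in [hs_sum_form]. *)
Lemma ip_young m n (A B : 'M[C]_(m, n)) (t : R) : 0 < t ->
  ip A B <= (t * hs A + t^-1 * hs B) / 2.
Proof.
move=> t0; have := hs_ge0 (t%:C%C *: A + (-1)%:C%C *: B).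
rewrite hsD !hsZ /ip adjZr -scalemxAl -scalemxAr !RetrZ -/(ip _ _) => h.
rewrite -(ler_pM2l t0) mulrA mulrDr !mulrA mulfV ?gt_eqF// mul1r.
by have aux (a b c : R) : 0 <= t * t * a + t * (-1 * c) *+ 2 + -1 * -1 * b ->
    t * c <= (t * t * a + b) / 2; [nra | exact: aux].
Qed.

Lemma ip_cs m n (A B : 'M[C]_(m, n)) :
  ip A B <= Num.sqrt (hs A) * Num.sqrt (hs B).
Proof.
have [A0|A0] := eqVneq (hs A) 0.
  by rewrite A0 sqrtr0 mul0r (hs_eq0 A0) /ip mul0mx Retr0.
have [B0|B0] := eqVneq (hs B) 0.
  by rewrite B0 sqrtr0 mulr0 (hs_eq0 B0) /ip adj0 mulmx0 Retr0.
have sA : 0 < Num.sqrt (hs A) by rewrite sqrtr_gt0 lt_neqAle eq_sym A0 hs_ge0.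
have sB : 0 < Num.sqrt (hs B) by rewrite sqrtr_gt0 lt_neqAle eq_sym B0 hs_ge0.
(* This weight balances the two terms. *)
have := ip_young A B (divr_gt0 sB sA).
rewrite -{2}(sqr_sqrtr (hs_ge0 A)) -{3}(sqr_sqrtr (hs_ge0 B)).
move: (Num.sqrt (hs A)) (Num.sqrt (hs B)) sA sB => a b a0 b0.
suff -> : (b / a * a ^+ 2 + (b / a)^-1 * b ^+ 2) / 2 = a * b by [].
by field; rewrite !gt_eqF.
Qed.

Lemma hs_triangle m n (A B : 'M[C]_(m, n)) :
  Num.sqrt (hs (A + B)) <= Num.sqrt (hs A) + Num.sqrt (hs B).
Proof.
rewrite -(ler_pXn2r (ltn0Sn 1)) ?nnegrE ?addr_ge0 ?sqrtr_ge0//.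
rewrite sqr_sqrtr ?hs_ge0// hsD.
have aux (a b c : R) : 0 <= a -> 0 <= b -> c <= Num.sqrt a * Num.sqrt b ->
    a + c *+ 2 + b <= (Num.sqrt a + Num.sqrt b) ^+ 2.
  by move=> a0 b0 ?; rewrite sqrrD !sqr_sqrtr// lerD2r lerD2l ler_pMn2r.
exact: aux (hs_ge0 A) (hs_ge0 B) (ip_cs A B).
Qed.

Definition dg m (b : 'I_m -> R) : 'M[C]_m := diag_mx (\row_i (b i)%:C%C).

Section dg.
Context (m : nat).
Implicit Types a b : 'I_m -> R.

Lemma dgM a b : dg a *m dg b = dg (fun i => a i * b i).
Proof.
rewrite /dg mulmx_diag; congr diag_mx; apply/rowP => i.
by rewrite !mxE -rmorphM.
Qed.
Lemma dgB a b : dg a - dg b = dg (fun i => a i - b i).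
Proof.
rewrite /dg -raddfB; congr diag_mx; apply/rowP => i.
by rewrite !mxE -rmorphB.
Qed.
Lemma dg_scalar x : dg (fun=> x : R) = ((x%:C%C : C)%:M : 'M[C]_m).
Proof.
by apply/matrixP => i j; rewrite !mxE.
Qed.
Lemma dg1 : dg (fun=> 1 : R) = (1%:M : 'M[C]_m).
Proof. exact: dg_scalar. Qed.
Lemma adj_dg a : adj (dg a) = dg a.
Proof.
rewrite /adj /dg tr_diag_mx map_diag_mx; congr diag_mx; apply/rowP => i.
by rewrite !mxE; exact: conj_real.
Qed.
Lemma Retr_dg a : Retr (dg a) = \sum_i a i.
Proof.
rewrite /Retr mxtrace_diag cRe_sum; apply: eq_bigr => i _.
by rewrite !mxE.
Qed.
Lemma Retr_dg_form n (v : 'M[C]_(n, m)) a :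
  Retr (v *m dg a *m adj v) = \sum_i a i * \sum_k cabs (v k i) ^+ 2.
Proof.
rewrite -mulmxA Retr_mulC -mulmxA /Retr /mxtrace cRe_sum.
apply: eq_bigr => i _; rewrite mul_diag_mx !mxE cReZ cRe_sum; congr (_ * _).
apply: eq_bigr => k _.
by rewrite adjE mulrC cReM cRe_conj cIm_conj cabs_sq -!expr2 mulrN opprK.
Qed.
End dg.

Definition uni m (P : 'M[C]_m) := P *m adj P = 1%:M /\ adj P *m P = 1%:M.

Lemma uni_mulK m n (P : 'M[C]_m) (A : 'M[C]_(m, n)) : uni P ->
  P *m (adj P *m A) = A.
Proof. by case=> h _; rewrite mulmxA h mul1mx. Qed.
Lemma uni_spectral m (A : 'M[C]_m) : uni (spectralmx A).
Proof.
split; first by apply/unitarymxP/spectral_unitarymx.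
have := spectral_unitarymx A; rewrite -trmxC_unitary => /unitarymxP.
by rewrite trmxCK.
Qed.

(** For Hermitian [A] the entries of [spectral_diag A] are real, so taking real parts loses
    nothing. *)
Definition sdiag m (A : 'M[C]_m) (i : 'I_m) : R :=
  complex.Re (spectral_diag A ord0 i).

Lemma funcalcE m (h : C -> C) (A : 'M[C]_m) (g : R -> R) : adj A = A ->
  (forall i, h ((sdiag A i)%:C%C) = (g (sdiag A i))%:C%C) ->
  funcalc h A = adj (spectralmx A) *m dg (g \o sdiag A) *m spectralmx A.
Proof.
move=> hA hg; rewrite /funcalc.
have -> : invmx (spectralmx A) = adj (spectralmx A).
  exact: invmx_unitary (spectral_unitarymx A).
congr (_ *m _ *m _); rewrite /dg; congr diag_mx; apply/rowP => i.
rewrite !mxE /= -hg /sdiag -real_of_conj//.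
have : A \is hermsymmx.
  by apply/is_hermitianmxP; rewrite expr0 scale1r; exact: esym hA.
move=> /hermitian_spectral_diag_real/mxOverP/(_ ord0 i).
by move/CrealP.
Qed.

Lemma spectralE m (A : 'M[C]_m) : adj A = A ->
  A = adj (spectralmx A) *m dg (sdiag A) *m spectralmx A.
Proof.
move=> hA; rewrite -(@funcalcE _ id _ id)//.
rewrite /funcalc; have /orthomx_spectralP {1}-> : A \is normalmx.
  by apply/normalmxP; rewrite -/(adj A) hA.
set D := spectral_diag A; set P := spectralmx A.
have -> : map_mx id D = D by apply/rowP => i; rewrite mxE.
by [].
Qed.

(** Symmetry is asked separately because the form tests only a real part, which does not force it.
    Vectors are rows, in keeping with [spectralmx], whose rows are eigenvectors. *)
Definition psd m (A : 'M[C]_m) :=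
  adj A = A /\ forall u : 'rV_m, 0 <= Retr (u *m A *m adj u).

Lemma psd_adj m (A : 'M[C]_m) : psd A -> adj A = A. Proof. by case. Qed.

Lemma psd_adjmul m n (S : 'M[C]_(n, m)) : psd (adj S *m S).
Proof.
split; first by rewrite adjM adjK.
move=> u; have := hs_ge0 (u *m adj S).
by rewrite /hs adjM adjK !mulmxA.
Qed.

Lemma psd_dg m n (P : 'M[C]_(n, m)) (a : 'I_n -> R) : (forall i, 0 <= a i) ->
  psd (adj P *m dg a *m P).
Proof.
move=> a0; split; first by rewrite !adjM adjK adj_dg mulmxA.
move=> u; rewrite [X in Retr X](_ : _ =
    (u *m adj P) *m dg a *m adj (u *m adj P)).
  rewrite Retr_dg_form; apply: sumr_ge0 => i _; apply: mulr_ge0 => //.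
  by apply: sumr_ge0 => k _; exact: sqr_ge0.
by rewrite adjM adjK !mulmxA.
Qed.

(** An eigenvalue is the value of the form at the corresponding row of [spectralmx A]. *)
Lemma sdiag_ge0 m (A : 'M[C]_m) i : psd A -> 0 <= sdiag A i.
Proof.
move=> [hA pA].
move: (uni_spectral A) (pA (row i (spectralmx A))) (spectralE hA).
move: (spectralmx A) (sdiag A) => P D uP + AE; rewrite AE {A hA pA AE}.
rewrite rowE -!mulmxA adjM !(uni_mulK _ uP) mulmxA Retr_dg_form.
rewrite (bigD1 i)//= [X in _ + X]big1 => [|j ji]; last first.
  by rewrite big_ord1 mxE eqxx (negbTE ji) /= cabs0 expr0n mulr0.
by rewrite big_ord1 mxE !eqxx /= cabs_real normr1 expr1n mulr1 addr0.
Qed.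

(** The square root in the eigenbasis. Through this factor, traces against a positive matrix become
    values of [hs] or [ip]. *)
Lemma psd_factor m (A : 'M[C]_m) : psd A -> exists S : 'M[C]_m, A = adj S *m S.
Proof.
move=> pA; exists (dg (fun i => Num.sqrt (sdiag A i)) *m spectralmx A).
rewrite {1}(spectralE pA.1) adjM adj_dg !mulmxA; congr (_ *m _).
rewrite -mulmxA dgM; congr (_ *m dg _); apply/funext => i.
by rewrite -expr2 sqr_sqrtr// sdiag_ge0.
Qed.

Lemma psdD m (A B : 'M[C]_m) : psd A -> psd B -> psd (A + B).
Proof.
move=> [hA pA] [hB pB]; split; first by rewrite adjD hA hB.
by move=> u; rewrite mulmxDr mulmxDl RetrD addr_ge0.
Qed.
Lemma psdZ m (A : 'M[C]_m) (x : R) : 0 <= x -> psd A -> psd (x%:C%C *: A).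
Proof.
move=> x0 [hA pA]; split; first by rewrite adjZr hA.
by move=> u; rewrite -scalemxAr -scalemxAl RetrZ mulr_ge0.
Qed.
Lemma psd0 m : psd (0 : 'M[C]_m).
Proof. by split=> [|u]; rewrite ?adj0// mulmx0 mul0mx Retr0. Qed.
Lemma psd_sum m I (r : seq I) (P : pred I) (F : I -> 'M[C]_m) :
  (forall i, P i -> psd (F i)) -> psd (\sum_(i <- r | P i) F i).
Proof.
by move=> h; elim/big_ind : _; [exact: psd0 | move=> ? ?; exact: psdD | exact: h].
Qed.
Lemma psd_conj m n (A : 'M[C]_m) (X : 'M[C]_(n, m)) : psd A ->
  psd (X *m A *m adj X).
Proof.
move=> /psd_factor[S ->].
rewrite [X in psd X](_ : _ = adj (S *m adj X) *m (S *m adj X)).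
  exact: psd_adjmul.
by rewrite adjM adjK !mulmxA.
Qed.
Lemma psd_scalar m (x : R) : 0 <= x -> psd ((x%:C%C : C)%:M : 'M[C]_m).
Proof.
move=> x0; have := @psd_dg m m 1%:M (fun=> x) (fun=> x0).
by rewrite adj1 mul1mx mulmx1 dg_scalar.
Qed.
Lemma psd_tr m n (A : 'M[C]_m) (X : 'M[C]_(n, m)) : psd A ->
  0 <= Retr (X *m A *m adj X).
Proof.
move=> /psd_factor[S ->]; have := hs_ge0 (X *m adj S).
by rewrite /hs adjM adjK !mulmxA.
Qed.
Lemma psd_tr_ge0 m (A : 'M[C]_m) : psd A -> 0 <= Retr A.
Proof. by move=> /(psd_tr 1%:M); rewrite adj1 mul1mx mulmx1. Qed.

Lemma psd_ler_tr m n (A : 'M[C]_m) (c : R) (X : 'M[C]_(n, m)) :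
  psd (c%:C%C%:M - A) -> Retr (X *m A *m adj X) <= c * hs X.
Proof.
move=> /(psd_tr X); rewrite mulmxBr mulmxBl RetrB subr_ge0 => /le_trans; apply.
by rewrite mul_mx_scalar -scalemxAl RetrZ.
Qed.

(** With [A = adj S *m S], [hs A] is the trace of [S *m A *m adj S], hence at most [c] times
    [hs S = Retr A]. *)
Lemma psd_hs m (A : 'M[C]_m) (c : R) : psd A -> psd (c%:C%C%:M - A) ->
  hs A <= c * Retr A.
Proof.
move=> pA pcA; have [S SA] := psd_factor pA.
have := psd_ler_tr S pcA; rewrite [hs S]Retr_mulC -SA => /(le_trans _); apply.
rewrite Retr_mulC mulmxA -SA.
by rewrite /hs pA.1.
Qed.

End matrix_adjoint.

(** * Singular values and the trace norm *)

Section singular_values.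
Context (R : realType).
Local Notation C := R[i].

Lemma sqrtC_real (x : R) : 0 <= x ->
  sqrtC (x%:C%C : C) = (Num.sqrt x)%:C%C.
Proof.
move=> x0; rewrite -{1}(sqr_sqrtr x0) rmorphXn /= sqrCK//.
by rewrite lecR sqrtr_ge0.
Qed.

Section mxabs.
Context (m : nat).
Implicit Types A B Z : 'M[C]_m.

Let sqrtE A i : sqrtC ((sdiag (adj A *m A) i)%:C%C : C) =
  (Num.sqrt (sdiag (adj A *m A) i))%:C%C.
Proof. by rewrite sqrtC_real// sdiag_ge0//; exact: psd_adjmul. Qed.

Lemma mxabsE A : mxabs A = adj (spectralmx (adj A *m A)) *m
  dg (Num.sqrt \o sdiag (adj A *m A)) *m spectralmx (adj A *m A).
Proof.
by rewrite -(funcalcE (psd_adj (psd_adjmul A)) (sqrtE A)).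
Qed.

Lemma mxabs_psd A : psd (mxabs A).
Proof. by rewrite mxabsE; apply: psd_dg => i; exact: sqrtr_ge0. Qed.

Lemma mxabs_sqr A : mxabs A *m mxabs A = adj A *m A.
Proof.
have pA := psd_adjmul A; rewrite [RHS](spectralE pA.1) mxabsE.
move: (uni_spectral (adj A *m A)) (fun i => sdiag_ge0 i pA) => uP s0.
rewrite -!mulmxA; congr (_ *m _); rewrite (uni_mulK _ uP) !mulmxA dgM.
by congr (dg _ *m _); apply/funext => i /=; rewrite -expr2 sqr_sqrtr.
Qed.

Definition sv A : 'I_m -> R := sdiag (mxabs A).
Definition svec A := spectralmx (mxabs A).
Definition nsv (lam : R) A : nat := #|[set i | (lam < sv A i)%R]%SET|.
Definition trn A : R := Retr (mxabs A).

Lemma sv_ge0 A i : 0 <= sv A i.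
Proof. exact/sdiag_ge0/mxabs_psd. Qed.
Lemma uni_svec A : uni (svec A). Proof. exact: uni_spectral. Qed.

Lemma adjmul_sv A :
  adj A *m A = adj (svec A) *m dg (fun i => sv A i ^+ 2) *m svec A.
Proof.
rewrite -mxabs_sqr /sv /svec.
move: (uni_spectral (mxabs A)) (spectralE (mxabs_psd A).1).
move: (spectralmx _) (sdiag _) => P s uP ->.
by rewrite -!mulmxA (uni_mulK _ uP) [dg s *m _]mulmxA dgM.
Qed.

Lemma trnE A : trn A = \sum_i sv A i.
Proof.
rewrite /trn [in LHS](spectralE (mxabs_psd A).1) -Retr_dg -/(svec A).
by rewrite Retr_mulC mulmxA (uni_svec A).1 mul1mx.
Qed.

Lemma trn_ge0 A : 0 <= trn A.
Proof. by rewrite trnE sumr_ge0// => i _; exact: sv_ge0. Qed.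

Lemma Retr_spectral_proj lam A :
  Retr (spectral_proj lam (mxabs A)) = (nsv lam A)%:R.
Proof.
rewrite /spectral_proj (@funcalcE _ _ _ _ (fun x => (lam < x)%R%:R)); first last.
- by move=> i; rewrite ltcR; case: (_ < _).
- exact: (mxabs_psd A).1.
rewrite -/(svec A) Retr_mulC mulmxA (uni_svec A).1 mul1mx Retr_dg.
rewrite /nsv -sum1_card natr_sum [RHS]big_mkcond /=; apply: eq_bigr => i _.
by rewrite inE /sv; case: (_ < _).
Qed.

Lemma hs_sv A : hs A = \sum_i sv A i ^+ 2.
Proof.
rewrite /hs Retr_mulC adjmul_sv -mulmxA Retr_mulC -mulmxA (uni_svec A).1.
by rewrite mulmx1 Retr_dg.
Qed.

(** [adj A *m A] is diagonal in the basis [svec A], in which [v] holds the coordinates of the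
    rows. *)
Lemma hs_mul_adj n A (v : 'M[C]_(n, m)) :
  hs (v *m svec A *m adj A) =
  \sum_i sv A i ^+ 2 * \sum_k cabs (v k i) ^+ 2.
Proof.
rewrite /hs 2!adjM adjK -Retr_dg_form; congr Retr.
rewrite -!mulmxA; congr (_ *m _).
rewrite [adj A *m (A *m _)]mulmxA adjmul_sv -!mulmxA.
by rewrite !(uni_mulK _ (uni_svec A)).
Qed.

Lemma hs_uni n A (v : 'M[C]_(n, m)) :
  hs (v *m svec A) = \sum_i \sum_k cabs (v k i) ^+ 2.
Proof.
rewrite /hs adjM -mulmxA (uni_mulK _ (uni_svec A)) -/(hs v) hsE.
by rewrite exchange_big.
Qed.

Lemma rank_dg (b : 'I_m -> R) : (#|[set i | (b i != 0)%R]%SET| <= \rank (dg b))%N.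
Proof.
set S := [set i | (b i != 0)%R]%SET; pose f := @enum_val _ (mem S).
pose X : 'M[C]_(#|S|, m) := \matrix_(i, j) (f i == j)%:R.
pose Y : 'M[C]_(m, #|S|) := X^T.
have h : X *m dg b *m (dg (fun i => (b i)^-1) *m Y) = 1%:M.
  rewrite mulmxA -[X *m _ *m _]mulmxA dgM; apply/matrixP => i j.
  rewrite mul_mx_diag !mxE (bigD1 (f i))//= big1 => [|k ki]; last first.
    by rewrite !mxE eq_sym (negbTE ki) !mul0r.
  rewrite !mxE eqxx mul1r addr0 mulfV; last first.
    by have := enum_valP i; rewrite inE.
  by rewrite mul1r; congr (_%:R); rewrite eq_sym (inj_eq enum_val_inj).
have := mxrankM_maxl (X *m dg b) (dg (fun i => (b i)^-1) *m Y).
rewrite h mxrank1 => /leq_trans; apply; exact: mxrankM_maxr.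
Qed.

(** The row space spanned by the singular vectors with index in [S]; rows outside [S] are zeroed
    rather than removed, so that the matrix stays square. *)
Definition svspace (S : {set 'I_m}) A : 'M[C]_m :=
  dg (fun i => (i \in S)%:R) *m svec A.

Lemma rank_svspace (S : {set 'I_m}) A : (#|S| <= \rank (svspace S A))%N.
Proof.
rewrite /svspace mxrankMfree; last first.
  rewrite -row_leq_rank mxrank_unitary//; exact: spectral_unitarymx.
apply: leq_trans (rank_dg _); apply/subset_leq_card/fintype.subsetP => i iS.
by rewrite inE iS oner_eq0.
Qed.

Lemma svspaceP (S : {set 'I_m}) A (u : 'rV_m) : (u <= svspace S A)%MS ->
  exists2 v : 'rV_m, u = v *m svec A & forall i, i \notin S -> v ord0 i = 0.
Proof.
case/submxP => w ->; rewrite /svspace mulmxA; eexists; first by [].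
by move=> i /negbTE iS; rewrite mul_mx_diag !mxE iS mulr0.
Qed.

(** Together with [hs_svspace_gt], the two halves of the min-max principle behind [nsv_add]. *)
Lemma hs_svspace_le A s (u : 'rV_m) : 0 <= s ->
  (u <= svspace [set i | (sv A i <= s)%R]%SET A)%MS ->
  hs (u *m adj A) <= s ^+ 2 * hs u.
Proof.
move=> s0 /svspaceP[v -> v0]; rewrite hs_mul_adj hs_uni mulr_sumr.
apply: ler_sum => i _; rewrite !big_ord1.
have [h|h] := leP (sv A i) s.
  by rewrite ler_wpM2r ?sqr_ge0// ler_pXn2r ?nnegrE ?sv_ge0.
by rewrite v0 ?inE -?ltNge// cabs0 expr0n /= !mulr0.
Qed.

Lemma hs_svspace_gt A s (u : 'rV_m) : 0 <= s ->
  (u <= svspace [set i | (s < sv A i)%R]%SET A)%MS ->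
  hs (u *m adj A) <= s ^+ 2 * hs u -> u = 0.
Proof.
move=> s0 /svspaceP[v -> v0]; rewrite hs_mul_adj hs_uni mulr_sumr => h.
suff -> : v = 0 by rewrite mul0mx.
have t0 i : i \in 'I_m ->
    0 <= (sv A i ^+ 2 - s ^+ 2) * \sum_(k < 1) cabs (v k i) ^+ 2.
  move=> _; rewrite big_ord1; have [iS|iS] := ltP s (sv A i).
    by rewrite mulr_ge0 ?sqr_ge0// subr_ge0 ler_pXn2r ?nnegrE ?sv_ge0// ltW.
  by rewrite v0 ?inE -?leNgt// cabs0 expr0n /= !mulr0.
have : \sum_i (sv A i ^+ 2 - s ^+ 2) * \sum_(k < 1) cabs (v k i) ^+ 2 = 0.
  apply: le_anti; rewrite sumr_ge0 ?andbT; last by move=> i _; exact: t0.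
  under eq_bigr do rewrite mulrBl.
  by rewrite sumrB subr_le0.
move=> /eqP; rewrite psumr_eq0//.
move=> /allP z; apply/rowP => i; rewrite mxE.
have [iS|iS] := ltP s (sv A i); last by rewrite v0 ?inE -?leNgt.
have := z i (mem_index_enum _); rewrite big_ord1 implyTb mulf_eq0.
rewrite subr_eq0 eqrXn2// ?sv_ge0// gt_eqF//=.
by rewrite sqrf_eq0 cabs_eq0 => /eqP.
Qed.

Lemma nsv_compl lam A :
  #|[set i | (sv A i <= lam)%R]%SET| = (m - nsv lam A)%N.
Proof.
have -> : [set i | (sv A i <= lam)%R]%SET = ~: [set i | (lam < sv A i)%R]%SET.
  by apply/setP => i; rewrite !inE -leNgt.
by rewrite cardsCs finset.setCK card_ord.
Qed.

(** Weyl's inequality by a dimension count. If it failed, the high singular space of [A + B] and the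
    low ones of [A] and [B] would share a nonzero row; [A + B] stretches it by more than [s + t],
    whereas [A] and [B] stretch it by at most [s] and [t]. *)
Lemma nsv_add s t A B : 0 <= s -> 0 <= t ->
  (nsv (s + t) (A + B) <= nsv s A + nsv t B)%N.
Proof.
move=> s0 t0; rewrite leqNgt; apply/negP => h.
pose U1 := svspace [set i | (s + t < sv (A + B) i)%R]%SET (A + B).
pose U2 := svspace [set i | (sv A i <= s)%R]%SET A.
pose U3 := svspace [set i | (sv B i <= t)%R]%SET B.
have r1 : (nsv (s + t) (A + B) <= \rank U1)%N by exact: rank_svspace.
have r2 : (m - nsv s A <= \rank U2)%N by rewrite -nsv_compl; exact: rank_svspace.
have r3 : (m - nsv t B <= \rank U3)%N by rewrite -nsv_compl; exact: rank_svspace.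
have c12 := mxrank_sum_cap U1 U2.
have c123 := mxrank_sum_cap (U1 :&: U2)%MS U3.
have m12 := rank_leq_col (U1 + U2)%MS.
have m123 := rank_leq_col ((U1 :&: U2) + U3)%MS.
have nA : (nsv s A <= m)%N by rewrite -[X in (_ <= X)%N]card_ord max_card.
have nB : (nsv t B <= m)%N by rewrite -[X in (_ <= X)%N]card_ord max_card.
(* Under [h] the three dimensions add up to more than [2 * m], so the two intersections inside
   dimension [m] leave a nonzero space. *)
have : (0 < \rank (U1 :&: U2 :&: U3)%MS)%N by lia.
rewrite lt0n mxrank_eq0 => /rowV0Pn[u]; rewrite !sub_capmx => /andP[/andP[u1 u2] u3].
apply/negP; rewrite negbK; apply/eqP.
apply: (hs_svspace_gt _ u1); first exact: addr_ge0.
have e2 := hs_svspace_le s0 u2; have e3 := hs_svspace_le t0 u3.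
rewrite adjD mulmxDr; have u0 := hs_ge0 u.
rewrite -(ler_sqrt _); last by rewrite mulr_ge0 ?sqr_ge0.
rewrite (le_trans (hs_triangle _ _))//.
rewrite (sqrtrM _ (sqr_ge0 (s + t))) sqrtr_sqr (ger0_norm (addr_ge0 s0 t0)) mulrDl.
apply: lerD.
  by rewrite -[X in X * _](ger0_norm s0) -sqrtr_sqr -sqrtrM ?sqr_ge0// ler_wsqrtr.
by rewrite -[X in X * _](ger0_norm t0) -sqrtr_sqr -sqrtrM ?sqr_ge0// ler_wsqrtr.
Qed.

(** The rank of [adj Z *m Z], at most that of [Z], is compared with the number of nonzero entries of
    its diagonal form. *)
Lemma nsv_rank lam Z : 0 <= lam -> (nsv lam Z <= \rank Z)%N.
Proof.
move=> l0; apply: leq_trans (mxrankM_maxr (adj Z) Z); rewrite adjmul_sv.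
rewrite mxrankMfree; last first.
  rewrite -row_leq_rank mxrank_unitary//; exact: spectral_unitarymx.
rewrite (_ : adj (svec Z) *m _ = adj (dg (fun i => sv Z i ^+ 2) *m svec Z)); last first.
  by rewrite adjM adj_dg.
rewrite mxrank_map mxrank_tr mxrankMfree; last first.
  rewrite -row_leq_rank mxrank_unitary//; exact: spectral_unitarymx.
apply: leq_trans (rank_dg _); apply/subset_leq_card/fintype.subsetP => i.
by rewrite !inE => /(le_lt_trans l0) h; rewrite sqrf_eq0 gt_eqF.
Qed.

Lemma nsv_hs lam A : 0 < lam -> lam ^+ 2 * (nsv lam A)%:R <= hs A.
Proof.
move=> l0; rewrite hs_sv /nsv -sum1_card natr_sum mulr_sumr big_mkcond /=.
apply: ler_sum => i _; rewrite inE; case: ifPn => [h|_]; last exact: sqr_ge0.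
by rewrite mulr1 ler_pXn2r ?nnegrE ?sv_ge0// ltW.
Qed.

Lemma nsv_trn lam A : 0 < lam -> lam * (nsv lam A)%:R <= trn A.
Proof.
move=> l0; rewrite trnE /nsv -sum1_card natr_sum mulr_sumr big_mkcond /=.
apply: ler_sum => i _; rewrite inE; case: ifPn => [h|_]; last exact: sv_ge0.
by rewrite mulr1 ltW.
Qed.

(** Sums [s <= (t + s^2 / t) / 2] over the nonzero singular values, of which there are at most
    [\rank A]. *)
Lemma trn_young t A : 0 < t -> trn A <= (t * (\rank A)%:R + t^-1 * hs A) / 2.
Proof.
move=> t0; rewrite trnE hs_sv.
have : t * (nsv 0 A)%:R <= t * (\rank A)%:R.
  by rewrite ler_pM2l// ler_nat nsv_rank.
suff : \sum_i sv A i <= (t * (nsv 0 A)%:R + t^-1 * \sum_i sv A i ^+ 2) / 2 by lra.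
rewrite /nsv -sum1_card natr_sum [t * _]mulr_sumr [X in (X + _) / 2]big_mkcond /=.
rewrite [t^-1 * _]mulr_sumr -big_split /= mulr_suml; apply: ler_sum => i _; rewrite inE; case: ifPn => [h|].
  rewrite -(ler_pM2l t0) mulrA mulrDr !mulrA mulfV ?gt_eqF// mul1r.
  by have := sqr_ge0 (t - sv A i); set x := sv A i; lra.
rewrite -leNgt => h; have -> : sv A i = 0 by apply/eqP; rewrite eq_le h sv_ge0.
by rewrite expr0n /= mulr0 addr0 mul0r.
Qed.

(** In the basis of right singular vectors, the i-th diagonal entry is the inner product of a row of
    norm at most 1 with a vector of norm [sv A i]. *)
Lemma trn_dual U A : psd (1%:M - U *m adj U) -> Retr (U *m A) <= trn A.
Proof.
move=> pU; rewrite trnE; set V := svec A; have uV : uni V := uni_svec A.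
have -> : Retr (U *m A) = Retr (V *m U *m (A *m adj V)).
  by rewrite mulmxA [RHS]Retr_mulC !mulmxA uV.2 mul1mx.
rewrite {1}/Retr /mxtrace cRe_sum; apply: ler_sum => i _.
set x : 'rV[C]_m := row i (V *m U); set y : 'rV[C]_m := adj (col i (A *m adj V)).
have -> : complex.Re ((V *m U *m (A *m adj V)) i i) = ip x y.
  rewrite /ip /Retr adjK trace_mx11 !mxE; congr complex.Re.
  by apply: eq_bigr => k _; rewrite !mxE.
apply: le_trans (ip_cs _ _) _.
have -> : hs y = sv A i ^+ 2.
  have -> : y = delta_mx 0 i *m V *m adj A.
    have dE : adj (delta_mx i 0 : 'cV[C]_m) = delta_mx 0 i.
      by rewrite /adj trmx_delta map_delta_mx.
    by rewrite /y colE !adjM adjK dE mulmxA.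
  rewrite hs_mul_adj (bigD1 i)//= [X in _ + X]big1 => [|j ji].
    by rewrite big_ord1 mxE !eqxx /= cabs_real normr1 expr1n mulr1 addr0.
  by rewrite big_ord1 mxE (negbTE ji) andbF cabs0 expr0n mulr0.
rewrite sqrtr_sqr ger0_norm ?sv_ge0// ler_piMl ?sv_ge0//.
rewrite -[leRHS]sqrtr1 ler_wsqrtr//.
have := psd_tr (delta_mx 0 i *m V : 'rV_m) pU.
rewrite mulmxBr mulmx1 mulmxBl RetrB subr_ge0 => h.
have <- : Retr (delta_mx 0 i *m V *m (U *m adj U) *m
    adj (delta_mx 0 i *m V : 'rV[C]_m)) = hs x.
  by rewrite /hs /x rowE !adjM !mulmxA.
apply: (le_trans h); rewrite -/(hs _) hs_uni (bigD1 i)//= [X in _ + X]big1 => [|j ji].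
  by rewrite big_ord1 mxE !eqxx /= cabs_real normr1 expr1n addr0.
by rewrite big_ord1 mxE (negbTE ji) andbF cabs0 expr0n.
Qed.

Lemma trn_attained A :
  exists2 U, psd (1%:M - U *m adj U) & Retr (U *m A) = trn A.
Proof.
set V := svec A; have uV : uni V := uni_svec A.
pose s := sv A; pose j := fun i => (s i)^-1.
(* [U] is the adjoint of the partial isometry in the polar decomposition of [A]; the convention that
   0 has inverse 0 makes [j] vanish where [s] does. *)
exists (adj V *m dg j *m V *m adj A).
  rewrite [X in psd X](_ : _ = adj V *m dg (fun i => 1 - (s i != 0)%:R) *m V).
    by apply: psd_dg => i; rewrite subr_ge0; case: (s i != 0).
  rewrite -dgB dg1 mulmxBr mulmx1 mulmxBl uV.2; congr (_ - _).
  rewrite !adjM !adjK adj_dg -!mulmxA [adj A *m (A *m _)]mulmxA adjmul_sv -/V.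
  rewrite -!mulmxA !(uni_mulK _ uV); congr (_ *m _); rewrite !mulmxA !dgM.
  congr (dg _ *m _); apply/funext => i; rewrite /j -/(s i).
  have [->|si] := eqVneq (s i) 0; first by rewrite invr0 !mul0r.
  by rewrite expr2 mulrA mulVf// mul1r mulfV.
rewrite trnE -!mulmxA adjmul_sv -/V -!mulmxA !(uni_mulK _ uV).
rewrite Retr_mulC -!mulmxA uV.1 mulmx1 dgM Retr_dg; apply: eq_bigr => i _.
rewrite /j -/(s i); have [->|si] := eqVneq (s i) 0; first by rewrite invr0 !mul0r.
by rewrite expr2 mulrA mulVf// mul1r.
Qed.

(** By [trn_dual] and [trn_attained] the trace norm is a supremum of additive functionals. *)
Lemma trnD A B : trn (A + B) <= trn A + trn B.
Proof.
have [U pU <-] := trn_attained (A + B).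
by rewrite mulmxDr RetrD lerD// trn_dual.
Qed.

Lemma trn0 : trn 0 = 0.
Proof.
apply: le_anti; rewrite trn_ge0 andbT.
by have := trn_young 0 (@ltr01 R); rewrite mxrank0 hs0 !mulr0 addr0 mul0r.
Qed.

Lemma trn_sum I (r : seq I) (P : pred I) (F : I -> 'M[C]_m) :
  trn (\sum_(i <- r | P i) F i) <= \sum_(i <- r | P i) trn (F i).
Proof.
elim/big_ind2 : _ => [|x a y b h1 h2|//]; first by rewrite trn0.
by rewrite (le_trans (trnD _ _))// lerD.
Qed.

(** Each entry gives a matrix of rank at most 1, for which [trn_young] with the weight [cabs a] is
    sharp. The loss in [m] is harmless: the bound is applied only to 1 by 1 matrices and to errors
    of approximation. *)
Lemma trn_entries A : trn A <= \sum_i \sum_j cabs (A i j).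
Proof.
rewrite {1}(matrix_sum_delta A) (le_trans (trn_sum _ _ _))//.
apply: ler_sum => i _; rewrite (le_trans (trn_sum _ _ _))//.
apply: ler_sum => j _; set a := A i j.
have [->|a0] := eqVneq a 0; first by rewrite scale0r trn0 cabs0.
have t0 : 0 < cabs a by rewrite lt_neqAle eq_sym cabs_eq0 a0 cabs_ge0.
apply: le_trans (trn_young _ t0) _.
have -> : hs (a *: delta_mx i j) = cabs a ^+ 2.
  rewrite hsE (bigD1 i)//= [X in _ + X]big1 => [|k ki]; last first.
    by rewrite big1// => l _; rewrite !mxE (negbTE ki) mulr0 cabs0 expr0n.
  rewrite (bigD1 j)//= big1 => [|k ki]; last first.
    by rewrite !mxE (negbTE ki) andbF mulr0 cabs0 expr0n.
  by rewrite !mxE !eqxx mulr1 !addr0.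
have h : (\rank (a *: delta_mx i j : 'M[C]_m) <= 1)%N.
  by rewrite mxrank_scale_nz// mxrank_delta.
have : cabs a * (\rank (a *: delta_mx i j : 'M[C]_m))%:R <= cabs a * 1.
  by rewrite ler_pM2l// -[1]/(1%:R) ler_nat.
by rewrite expr2 mulrA mulVf ?gt_eqF// mul1r; lra.
Qed.

(** [U] is the sign of [h] with the value 1 at 0, so that it is unitary even when [h] is
    singular. *)
Lemma herm_sign h : adj h = h -> exists U : 'M[C]_m,
  [/\ adj U = U, U *m U = 1%:M & U *m h =
    adj (spectralmx h) *m dg (fun i => `|sdiag h i|) *m spectralmx h].
Proof.
move=> hh; set P := spectralmx h; have uP : uni P := uni_spectral h.
pose sg := fun i => if 0 <= sdiag h i then 1 else -1 : R.
pose U := adj P *m dg sg *m P; exists U; split.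
- by rewrite /U !adjM adjK adj_dg mulmxA.
- rewrite /U -!mulmxA (uni_mulK _ uP) [dg _ *m (dg _ *m _)]mulmxA dgM.
  rewrite (_ : (fun _ => _) = fun=> 1) ?dg1 ?mul1mx ?uP.2//.
  by apply/funext => i; rewrite /sg; case: ifP => _; ring.
rewrite [X in U *m X](spectralE hh) /U -/P -!mulmxA (uni_mulK _ uP).
rewrite [dg _ *m (dg _ *m _)]mulmxA dgM; congr (_ *m (dg _ *m _)).
apply/funext => i; rewrite /sg; case: ifPn => [h0|]; first by rewrite mul1r ger0_norm.
by rewrite -ltNge => h0; rewrite mulN1r ltr0_norm.
Qed.

(** If [U] is the sign of the Hermitian part [h], then [trn h = Retr (U *m h)]. As [U] is
    self-adjoint, this equals [Retr (U *m A)], which duality bounds. *)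
Lemma trn_herm A : trn (2^-1%:C%C *: (A + adj A)) <= trn A.
Proof.
set h := _ *: _; have hh : adj h = h.
  by rewrite /h adjZr adjD adjK addrC.
have [U [aU UU e]] := herm_sign hh.
have pU : psd (1%:M - U *m adj U) by rewrite aU UU subrr; exact: psd0.
have -> : trn h = Retr (U *m h).
  apply: le_anti; rewrite trn_dual// andbT.
  have [W pW <-] := trn_attained h.
  (* A contraction does no better than the sign: [U *m h] is positive, hence factors, and Young's
     inequality compares [W *m U] with the identity. *)
  have -> : W *m h = W *m U *m (U *m h) by rewrite mulmxA -(mulmxA W) UU mulmx1.
  rewrite e; set G := adj _ *m _ *m _.
  have pG : psd G by apply: psd_dg => i; exact: normr_ge0.
  have [S GS] := psd_factor pG.
  have -> : Retr (W *m U *m G) = ip (S *m (W *m U)) S.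
    by rewrite GS mulmxA Retr_mulC mulmxA.
  apply: le_trans (ip_young _ _ (@ltr01 R)) _; rewrite invr1 !mul1r.
  have hsS : hs S = Retr G by rewrite /hs Retr_mulC GS.
  suff : hs (S *m (W *m U)) <= hs S by rewrite hsS; lra.
  have -> : hs (S *m (W *m U)) = Retr (S *m (W *m adj W) *m adj S).
    move: (U) aU UU => Z aZ ZZ.
    by rewrite /hs !adjM aZ !mulmxA -(mulmxA _ Z Z) ZZ mulmx1.
  by have := psd_tr S pW; rewrite mulmxBr mulmxBl mulmx1 RetrB subr_ge0.
rewrite /h -scalemxAr RetrZ mulmxDr RetrD.
have -> : Retr (U *m adj A) = Retr (U *m A).
  by rewrite -Retr_adj adjM adjK aU Retr_mulC.
by have := trn_dual A pU; lra.
Qed.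

Lemma mxabsZ (a : C) A : cabs a = 1 -> mxabs (a *: A) = mxabs A.
Proof.
move=> a1; rewrite /mxabs; congr (funcalc _ _).
rewrite -/(adj _) -/(adj _) adjZ -scalemxAl -scalemxAr scalerA.
suff -> : ((a^*)%R : C) * a = 1 by rewrite scale1r.
by apply: complex_inj; rewrite ?cReM ?cImM cRe_conj cIm_conj /=;
  have := cabs_sq a; rewrite a1; lra.
Qed.

Lemma nsvZ lam (a : C) A : cabs a = 1 -> nsv lam (a *: A) = nsv lam A.
Proof. by move=> a1; rewrite /nsv /sv mxabsZ. Qed.

Lemma trnZ (a : C) A : cabs a = 1 -> trn (a *: A) = trn A.
Proof. by move=> a1; rewrite /trn mxabsZ. Qed.

(** The positive and negative parts; their traces are bounded by the pairing of [A] with its sign,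
    to which duality applies. *)
Lemma herm_split A : adj A = A -> exists F G : 'M[C]_m,
  [/\ psd F, psd G, A = F - G & Retr F + Retr G <= trn A].
Proof.
move=> hA; set P := spectralmx A; have uP : uni P := uni_spectral A.
pose s := sdiag A.
pose F := adj P *m dg (fun i => if 0 <= s i then s i else 0) *m P.
pose G := adj P *m dg (fun i => if 0 <= s i then 0 else - s i) *m P.
have FE : A = F - G.
  rewrite {1}(spectralE hA) -mulmxBl -mulmxBr dgB; congr (_ *m dg _ *m _).
  by apply/funext => i; rewrite -/(s i); case: ifP; rewrite ?subr0// sub0r opprK.
exists F, G; split => //.
- by apply: psd_dg => i; case: ifP.
- by apply: psd_dg => i; case: ifPn => //; rewrite -ltNge oppr_ge0 => /ltW.
have [U [aU UU e]] := herm_sign hA.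
have pU : psd (1%:M - U *m adj U) by rewrite aU UU subrr; exact: psd0.
apply: le_trans (trn_dual A pU); rewrite e.
have tr (Z : 'I_m -> R) : Retr (adj P *m dg Z *m P) = \sum_i Z i.
  by rewrite Retr_mulC mulmxA uP.1 mul1mx Retr_dg.
rewrite /F /G !tr -big_split /=; apply: ler_sum => i _; rewrite -/(s i).
case: ifPn => [h|]; first by rewrite addr0 ler_norm.
by rewrite -ltNge => /ltW h; rewrite add0r ler0_norm.
Qed.

End mxabs.
End singular_values.

(** * Cuculescu's projections *)

Section cut.
Context (R : realType) (m : nat).
Local Notation C := R[i].
Implicit Types q F B X : 'M[C]_m.

(** The difference is the compression of [c - X] by [q] plus [c] times the complementary projection
    [1 - q]. *)
Lemma psd_le_proj (c : R) X q : 0 <= c -> psd (c%:C%C%:M - X) ->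
  adj q = q -> q *m q = q -> psd (c%:C%C%:M - q *m X *m q).
Proof.
move=> c0 pX hq qq.
have -> : c%:C%C%:M - q *m X *m q =
    q *m (c%:C%C%:M - X) *m adj q + c%:C%C *: ((1%:M - q) *m adj (1%:M - q)).
  rewrite adjB adj1 hq mulmxBr mulmxBl mul_mx_scalar -scalemxAl qq.
  rewrite mulmxBr !mulmxBl !mul1mx !mulmx1 qq subrr subr0 scalerBr scalemx1.
  by rewrite [RHS]addrC addrA subrK.
apply: psdD; first exact: psd_conj.
apply: (psdZ c0).
have := psd_adjmul (adj (1%:M - q)); rewrite adjK.
by [].
Qed.

Lemma psd_ler_trans (c c' : R) X : c <= c' -> psd (c%:C%C%:M - X) ->
  psd (c'%:C%C%:M - X).
Proof.
move=> cc' pX; have -> : c'%:C%C%:M - X = (c' - c)%:C%C%:M + (c%:C%C%:M - X).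
  by rewrite addrA -raddfD /= -rmorphD subrK.
by apply: psdD pX; apply: psd_scalar; rewrite subr_ge0.
Qed.

Definition cut (lam : R) B : 'M[C]_m :=
  adj (spectralmx B) *m dg (fun i => (lam < sdiag B i)%R%:R) *m spectralmx B.

Lemma adj_cut lam B : adj (cut lam B) = cut lam B.
Proof. by rewrite /cut !adjM adjK adj_dg mulmxA. Qed.

Lemma cut_idem lam B : cut lam B *m cut lam B = cut lam B.
Proof.
rewrite /cut; move: (uni_spectral B); set P := spectralmx B => uP.
rewrite -!mulmxA (uni_mulK _ uP) [dg _ *m (dg _ *m _)]mulmxA dgM.
by congr (_ *m (dg _ *m _)); apply/funext => i; case: (_ < _); rewrite ?mulr1 ?mulr0.
Qed.

(** The diagonal projection factors through a space whose dimension is its trace. *)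
Lemma rank_cut lam B : ((\rank (cut lam B))%:R <= Retr (cut lam B)).
Proof.
rewrite /cut Retr_mulC mulmxA (uni_spectral B).1 mul1mx Retr_dg.
set S := [set i | (lam < sdiag B i)%R]%SET.
have -> : \sum_i (lam < sdiag B i)%R%:R = (#|S|)%:R :> R.
  rewrite -sum1_card natr_sum [RHS]big_mkcond /=; apply: eq_bigr => i _.
  by rewrite inE; case: (_ < _).
rewrite ler_nat; apply: leq_trans (mxrankM_maxl _ _) _.
apply: leq_trans (mxrankM_maxr _ _) _.
pose f := @enum_val _ (mem S).
pose X : 'M[C]_(#|S|, m) := \matrix_(i, j) (f i == j)%:R.
have -> : dg (fun i => (lam < sdiag B i)%R%:R) = X^T *m X.
  apply/matrixP => i j; rewrite !mxE.
  have [iS|iS] := boolP (i \in S); last first.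
    rewrite big1 => [|k _]; first by move: iS; rewrite inE => /negbTE ->; rewrite mul0rn.
    rewrite !mxE; case: eqP => [fk|]; last by rewrite mul0r.
    by move: iS; rewrite -fk (enum_valP k).
  rewrite (bigD1 (enum_rank_in iS i))//= big1 => [|k ki].
    by rewrite !mxE /f enum_rankK_in// eqxx mul1r addr0; move: iS; rewrite inE => ->.
  rewrite !mxE; case: eqP => [fk|]; last by rewrite mul0r.
  by move: ki; rewrite -(enum_valK_in iS k) -/(f k) fk eqxx.
exact: leq_trans (mxrankM_maxl _ _) (rank_leq_col _).
Qed.

Section cut_compression.
Context (lam : R) (q F P : 'M[C]_m) (b : 'I_m -> R).
Hypotheses (lam0 : 0 < lam) (hq : adj q = q) (qq : q *m q = q) (uP : uni P).
Hypothesis BE : q *m F *m q = adj P *m dg b *m P.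
Let p := adj P *m dg (fun i => (lam < b i)%R%:R) *m P.

Let dgP (f g : 'I_m -> R) : adj P *m dg f *m P *m (adj P *m dg g *m P) =
  adj P *m dg (fun i => f i * g i) *m P.
Proof. by rewrite !mulmxA -!mulmxA (uni_mulK _ uP) [dg _ *m (dg _ *m _)]mulmxA dgM. Qed.

Let hp : adj p = p. Proof. by rewrite /p !adjM adjK adj_dg mulmxA. Qed.

Let pp : p *m p = p.
Proof.
rewrite dgP; congr (_ *m dg _ *m _); apply/funext => i.
by case: (_ < _); rewrite ?mulr1 ?mulr0.
Qed.

(** As [lam > 0], the spectral cut-off vanishes at 0, so [p] is a multiple of [q *m F *m q] and lies
    under [q]. *)
Let cut_mulr : p *m q = p.
Proof.
have -> : p = adj P *m dg (fun i => (lam < b i)%R%:R * (b i)^-1) *m P *m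
    (q *m F *m q).
  rewrite BE dgP; congr (_ *m dg _ *m _); apply/funext => i.
  have [h|_] := ltP lam (b i); last by rewrite !mul0r.
  by rewrite mul1r mulVf// gt_eqF// (lt_trans lam0).
by rewrite -!mulmxA qq.
Qed.

Let cut_mull : q *m p = p.
Proof. by rewrite -[in RHS]hp -[in RHS]cut_mulr adjM hp hq. Qed.

(** [p] commutes with [q *m F *m q], so [F] has no corner between [p] and [q - p]. This keeps the
    good part block diagonal. *)
Let cut_offdiag : p *m F *m (q - p) = 0.
Proof.
have -> : q - p = q *m (1%:M - p) by rewrite mulmxBr mulmx1 cut_mull.
have -> : p *m F *m (q *m (1%:M - p)) = p *m (q *m F *m q) *m (1%:M - p).
  by rewrite !mulmxA cut_mulr.
rewrite BE.
have -> : p *m (adj P *m dg b *m P) = (adj P *m dg b *m P) *m p.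
  rewrite dgP [RHS]dgP; congr (_ *m dg _ *m _).
  by apply/funext => i; rewrite mulrC.
have p1 : p *m (1%:M - p) = 0 by rewrite mulmxBr mulmx1 pp subrr.
exact: etrans (etrans (esym (mulmxA _ _ _)) (congr1 (mulmx _) p1)) (mulmx0 _ _).
Qed.

Let cut_trace : lam * Retr p <= Retr (p *m F).
Proof.
have -> : Retr (p *m F) = Retr (p *m (q *m F *m q)).
  by rewrite !mulmxA cut_mulr [RHS]Retr_mulC mulmxA cut_mull.
rewrite BE dgP !(Retr_mulC _ P) !mulmxA uP.1 !mul1mx !Retr_dg mulr_sumr.
apply: ler_sum => i _; case: ltP => [h|_]; last by rewrite mulr0 mul0r.
by rewrite mulr1 mul1r ltW.
Qed.

Let cut_le : psd (lam%:C%C%:M - (q - p) *m F *m (q - p)).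
Proof.
have e : q - p = q *m (1%:M - p) by rewrite mulmxBr mulmx1 cut_mull.
have e' : q - p = (1%:M - p) *m q by rewrite mulmxBl mul1mx cut_mulr.
have lE (c : 'I_m -> R) : adj P *m dg (fun=> 1) *m P = 1%:M.
  by rewrite dg1 mulmx1 uP.2.
have -> : (q - p) *m F *m (q - p) = adj P *m
    dg (fun i => (1 - (lam < b i)%R%:R) * b i * (1 - (lam < b i)%R%:R)) *m P.
  rewrite {1}e' e !mulmxA -[_ *m q *m F]mulmxA -[_ *m (q *m F) *m q]mulmxA BE.
  have -> : 1%:M - p = adj P *m dg (fun i => 1 - (lam < b i)%R%:R) *m P.
    rewrite -(lE b) -mulmxBl -mulmxBr dgB; reflexivity.
  rewrite dgP dgP; reflexivity.
have -> : lam%:C%C%:M = adj P *m dg (fun=> lam) *m P.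
  by rewrite dg_scalar mul_mx_scalar -scalemxAl uP.2 scalemx1.
rewrite -mulmxBl -mulmxBr dgB; apply: psd_dg => i.
by case: ltP => h; rewrite ?subrr ?mul0r ?subr0 ?mul1r ?mulr1 ?subr_ge0// ltW.
Qed.

Lemma cut_compressionP : [/\ p *m q = p, q *m p = p, p *m F *m (q - p) = 0,
  lam * Retr p <= Retr (p *m F) & psd (lam%:C%C%:M - (q - p) *m F *m (q - p))].
Proof. by split. Qed.

End cut_compression.

Lemma cutP lam q F (p := cut lam (q *m F *m q)) : 0 < lam ->
  adj q = q -> q *m q = q -> psd F ->
  [/\ p *m q = p, q *m p = p, p *m F *m (q - p) = 0,
    lam * Retr p <= Retr (p *m F) & psd (lam%:C%C%:M - (q - p) *m F *m (q - p))].
Proof.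
move=> l0 hq qq pF; apply: cut_compressionP => //; first exact: uni_spectral.
by apply: spectralE; rewrite !adjM hq (psd_adj pF) mulmxA.
Qed.

(** An operator form of Cauchy-Schwarz. One factor [M] in [hs M] is expanded, and Young's inequality
    with weight [c] splits each term into a wanted one and [Retr (M *m (q *m G i *m q) *m adj M)];
    the latter add up to at most [c * hs M]. *)
Lemma hs_sum_form I (r : seq I) (P : pred I) (psi : I -> C)
    (G : I -> 'M[C]_m) (xi q : 'M[C]_m) (c : R) :
  (forall i, P i -> psd (G i)) -> adj q = q -> adj xi = xi -> 0 < c ->
  psd (c%:C%C%:M - \sum_(i <- r | P i) q *m G i *m q) ->
  hs (\sum_(i <- r | P i) psi i *: (xi *m G i *m q)) <=
  c * \sum_(i <- r | P i) cabs (psi i) ^+ 2 * Retr (xi *m G i *m xi).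
Proof.
move=> pG hq hxi c0 pc; set M := \sum_(i <- r | P i) _.
have hM : hs M = \sum_(i <- r | P i) Retr (psi i *: (xi *m G i *m q *m adj M)).
  rewrite -Retr_sum {1}/hs {1}/M mulmx_suml; congr Retr.
  by apply: eq_bigr => i _; rewrite -scalemxAl.
have step i : P i -> Retr (psi i *: (xi *m G i *m q *m adj M)) <=
    (c * (cabs (psi i) ^+ 2 * Retr (xi *m G i *m xi)) +
     c^-1 * Retr (M *m (q *m G i *m q) *m adj M)) / 2.
  move=> Pi; have [S GS] := psd_factor (pG i Pi).
  have -> : Retr (psi i *: (xi *m G i *m q *m adj M)) =
      ip (psi i *: (xi *m adj S)) (M *m q *m adj S).
    by rewrite /ip GS !adjM adjK hq -scalemxAl !mulmxA.
  apply: le_trans (ip_young _ _ c0) _.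
  have -> : hs (psi i *: (xi *m adj S)) =
      cabs (psi i) ^+ 2 * Retr (xi *m G i *m xi).
    rewrite GS {1}/hs adjZ -scalemxAl -scalemxAr scalerA.
    have -> : psi i * ((psi i)^*)%R = (cabs (psi i) ^+ 2)%:C%C.
      rewrite cabs_sq; apply: complex_inj; rewrite ?cReM ?cImM cRe_conj cIm_conj /=; ring.
    by rewrite RetrZ adjM adjK hxi !mulmxA.
  have -> // : hs (M *m q *m adj S) = Retr (M *m (q *m G i *m q) *m adj M).
  by rewrite /hs GS !adjM adjK hq !mulmxA.
have : hs M <= (c * \sum_(i <- r | P i) cabs (psi i) ^+ 2 * Retr (xi *m G i *m xi)
    + c^-1 * Retr (M *m (\sum_(i <- r | P i) q *m G i *m q) *m adj M)) / 2.
  rewrite {1}hM; apply: le_trans (ler_sum _ step) _.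
  rewrite -mulr_suml big_split /= -!mulr_sumr -Retr_sum.
  by rewrite mulmx_sumr mulmx_suml.
have := psd_ler_tr M pc; set X := Retr _ => XM.
(* So the second half of the bound is at most [hs M / 2] and is absorbed by the left-hand side. *)
have : c^-1 * X <= hs M.
  by rewrite -(ler_pM2l c0) mulrA mulfV ?gt_eqF// mul1r.
set Y := c * _; lra.
Qed.

End cut.

Section cuculescu.
Context (R : realType) (m : nat) (I : finType).
Local Notation C := R[i].
Variables (anc : nat -> I -> I) (N : nat -> nat) (D : nat).
Hypothesis anc_nested : forall t i j,
  anc t.+1 i = anc t.+1 j -> anc t i = anc t j.
Hypothesis N_gt0 : forall t, (0 < N t)%N.
Hypothesis card_anc : forall t i, #|[pred j | anc t j == anc t i]| = N t.
Hypothesis N_le : forall t, (N t <= D * N t.+1)%N.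
Variables (T : nat) (F : I -> 'M[C]_m) (lam : R).
Hypothesis anc_fin : injective (anc T).
Hypothesis lam0 : 0 < lam.
Hypothesis psdF : forall i, psd (F i).

Definition avg (t : nat) (i : I) : 'M[C]_m :=
  ((N t)%:R^-1)%:C%C *: \sum_(j | anc t j == anc t i) F j.

Lemma avgE t i :
  avg t i = ((N t)%:R^-1)%:C%C *: \sum_(j | anc t j == anc t i) F j.
Proof. by []. Qed.

Hypothesis avg0_le : forall i, psd (lam%:C%C%:M - avg 0 i).

(* [anc t i] represents the atom of [i] at level t of the filtration, which has
   [N t] elements; since the averages at level 0 are at most lam, nothing is
   cut at level 0.  [pproj t] is cut when passing from level t to level t.+1. *)
Fixpoint qproj (t : nat) (i : I) : 'M[C]_m :=
  if t is t'.+1 then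
    qproj t' i - cut lam (qproj t' i *m avg t i *m qproj t' i)
  else 1%:M.

Definition pproj (t : nat) (i : I) : 'M[C]_m :=
  cut lam (qproj t i *m avg t.+1 i *m qproj t i).

Let invN_ge0 t : 0 <= ((N t)%:R^-1 : R). Proof. by rewrite invr_ge0. Qed.

Lemma psd_avg t i : psd (avg t i).
Proof. by apply: (psdZ (invN_ge0 t)); apply: psd_sum. Qed.

Lemma avg_eq t i j : anc t i = anc t j -> avg t i = avg t j.
Proof. by rewrite /avg => ->. Qed.

(** Adaptedness: [qproj t] depends only on the atom of level [t], and [pproj t] only on that of
    level [t.+1]. *)
Lemma qproj_eq t i j : anc t i = anc t j -> qproj t i = qproj t j.
Proof.
elim: t i j => [//|t IH] i j h /=.
by rewrite (IH _ _ (anc_nested h)) (avg_eq h).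
Qed.

Lemma pproj_eq t i j : anc t.+1 i = anc t.+1 j -> pproj t i = pproj t j.
Proof.
by move=> h; rewrite /pproj (qproj_eq (anc_nested h)) (avg_eq h).
Qed.

Lemma qprojS t i : qproj t.+1 i = qproj t i - pproj t i. Proof. by []. Qed.

Lemma adj_pproj t i : adj (pproj t i) = pproj t i.
Proof. exact: adj_cut. Qed.

Lemma pproj_idem t i : pproj t i *m pproj t i = pproj t i.
Proof. exact: cut_idem. Qed.

Lemma qproj_proj t i :
  adj (qproj t i) = qproj t i /\ qproj t i *m qproj t i = qproj t i.
Proof.
elim: t => [|t [hq qq]]; first by rewrite /= adj1 mulmx1.
have [pq qp _ _ _] := cutP lam0 hq qq (psd_avg t.+1 i).
rewrite qprojS adjB hq adj_pproj; split => //.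
rewrite mulmxBr !mulmxBl qq /pproj pq qp cut_idem.
by rewrite subrr subr0.
Qed.

Lemma qprojP t i (p := pproj t i) (q := qproj t i) (a := avg t.+1 i) :
  [/\ p *m q = p, q *m p = p, p *m a *m (q - p) = 0,
    lam * Retr p <= Retr (p *m a) &
    psd (lam%:C%C%:M - (q - p) *m a *m (q - p))].
Proof.
by have [hq qq] := qproj_proj t i; exact: cutP lam0 hq qq (psd_avg t.+1 i).
Qed.

Lemma qproj_avg_le t i :
  psd (lam%:C%C%:M - qproj t i *m avg t i *m qproj t i).
Proof.
case: t => [|t]; first by rewrite /= mul1mx mulmx1.
by have [_ _ _ _] := qprojP t i; rewrite -qprojS.
Qed.

(** By positivity the sum over the smaller atom is at most the sum over the larger one, and the
    sizes differ by a factor of at most [D]. *)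
Lemma avgS_le t i : psd (D%:R%:C%C *: avg t i - avg t.+1 i).
Proof.
have NR u : (N u)%:R != 0 :> R by rewrite pnatr_eq0 -lt0n.
have -> : D%:R%:C%C *: avg t i =
    ((D * N t.+1)%:R / (N t)%:R - 1)%:C%C *:
      (((N t.+1)%:R^-1)%:C%C *: \sum_(j | anc t j == anc t i) F j)
    + ((N t.+1)%:R^-1)%:C%C *: \sum_(j | anc t j == anc t i) F j.
  rewrite /avg !scalerA -scalerDl -!rmorphM -rmorphD; congr (_%:C%C *: _).
  by rewrite natrM; field; rewrite !NR.
rewrite -addrA; apply: psdD.
  apply: psdZ; last by apply: (psdZ (invN_ge0 _)); exact: psd_sum.
  by rewrite subr_ge0 ler_pdivlMr ?ltr0n// mul1r ler_nat.
rewrite /avg -scalerBr; apply: (psdZ (invN_ge0 _)).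
rewrite [X in X - _](bigID (fun j => anc t.+1 j == anc t.+1 i)) /=.
rewrite [X in X + _ - _](_ : _ = \sum_(j | anc t.+1 j == anc t.+1 i) F j).
  by rewrite addrAC subrr add0r; apply: psd_sum.
apply: eq_bigl => j; apply: andb_idl => /eqP /anc_nested ->.
by rewrite eqxx.
Qed.

(** [qproj t] keeps the average of level [t] below [lam], and the next average is at most [D] times
    larger. *)
Lemma qproj_avgS_le t i :
  psd ((D%:R * lam)%:C%C%:M - qproj t i *m avg t.+1 i *m qproj t i).
Proof.
have [hq qq] := qproj_proj t i.
have -> : (D%:R * lam)%:C%C%:M - qproj t i *m avg t.+1 i *m qproj t i =
  D%:R%:C%C *: (lam%:C%C%:M - qproj t i *m avg t i *m qproj t i) +
  qproj t i *m (D%:R%:C%C *: avg t i - avg t.+1 i) *m adj (qproj t i).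
  rewrite hq; move: (qproj t i) (avg t i) (avg t.+1 i) => q a b.
  have -> : q *m (D%:R%:C%C *: a - b) *m q = D%:R%:C%C *: (q *m a *m q) - q *m b *m q.
    by rewrite mulmxBr mulmxBl -scalemxAr -scalemxAl.
  by rewrite scalerBr scale_scalar_mx rmorphM subrKA.
apply: psdD; last exact: psd_conj (avgS_le t i).
by apply: psdZ; [rewrite ler0n | exact: qproj_avg_le].
Qed.

Let DN0 : 1 <= D%:R :> R.
Proof.
rewrite ler1n; have := N_le 0; have := N_gt0 0; have := N_gt0 1; lia.
Qed.

Lemma qprojS_avgS_le t i :
  psd ((D%:R * lam)%:C%C%:M - qproj t.+1 i *m avg t.+1 i *m qproj t.+1 i).
Proof.
by apply: psd_ler_trans (qproj_avg_le t.+1 i); rewrite ler_peMl// ltW.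
Qed.


Lemma avg_top i : avg T i = F i.
Proof.
have h (G : I -> 'M[C]_m) : \sum_(j | anc T j == anc T i) G j = G i.
  by apply: big_pred1 => j; rewrite (inj_eq anc_fin).
rewrite /avg h.
suff -> : N T = 1%N by rewrite invr1 scale1r.
rewrite -(card_anc T i); rewrite -(card1 i); apply: eq_card => j.
by rewrite !inE (inj_eq anc_fin).
Qed.

(** Conditional expectation preserves the pairing with an adapted [X]: after exchanging the sums
    every cell is counted [N t] times. *)
Lemma sum_avg t (X : I -> 'M[C]_m) :
  (forall i j, anc t i = anc t j -> X i = X j) ->
  \sum_i Retr (X i *m avg t i) = \sum_i Retr (X i *m F i).
Proof.
move=> hX; have NR u : (N u)%:R != 0 :> R by rewrite pnatr_eq0 -lt0n.
transitivity (\sum_i \sum_(j | anc t j == anc t i)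
    (N t)%:R^-1 * Retr (X j *m F j)).
  apply: eq_bigr => i _; rewrite /avg -scalemxAr RetrZ mulmx_sumr Retr_sum mulr_sumr.
  by apply: eq_bigr => j /eqP/esym/hX ->.
rewrite (exchange_big_dep xpredT)//=; apply: eq_bigr => j _.
rewrite sumr_const (eq_card (B := [pred i | anc t i == anc t j])).
  by rewrite card_anc -[LHS]mulr_natl mulrA mulfV// mul1r.
by move=> i; rewrite !inE eq_sym.
Qed.

Definition gpart (i : I) : 'M[C]_m := qproj T i *m F i *m qproj T i +
  \sum_(t < T) pproj t i *m avg t.+1 i *m pproj t i.

(** The second factor is [qproj t] in one term and [qproj t.+1] in the other, so that the diagonal
    corner at [pproj t] is counted once. *)
Definition bpart (t : nat) (i : I) : 'M[C]_m :=
  pproj t i *m (F i - avg t.+1 i) *m qproj t i +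
  qproj t.+1 i *m (F i - avg t.+1 i) *m pproj t i.

Lemma bpartE t i : bpart t i =
  pproj t i *m (F i - avg t.+1 i) *m qproj t i +
  qproj t.+1 i *m (F i - avg t.+1 i) *m pproj t i.
Proof. by []. Qed.

(** Induction on the level. Peeling [p] off [q *m F i *m q] leaves the corners [p *m F i *m q] and
    [(q - p) *m F i *m p]; they equal [bpart] plus [p *m a *m p], because the average [a] has no
    corner between [p] and [q - p]. *)
Lemma calderon_zygmund i : F i = gpart i + \sum_(t < T) bpart t i.
Proof.
rewrite /gpart; elim: (T) => [|n IH].
  by rewrite !big_ord0 !addr0 mul1mx mulmx1.
rewrite {1}IH !big_ord_recr /= -/(pproj n i).
have [pq qp pa _ _] := qprojP n i; move: pa.
rewrite /bpart qprojS; move: (qproj n i) (pproj n i) (avg n.+1 i) pq qp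
  (adj_pproj n i) (qproj_proj n i).1 (psd_adj (psd_avg n.+1 i)) => q p a pq qp hp hq ha pa.
have ap : (q - p) *m a *m p = 0.
  by have := congr1 (@adj R _ _) pa; rewrite !adjM adjB hq hp ha adj0 mulmxA.
have {}pa : p *m a *m q = p *m a *m p.
  by apply/eqP; rewrite -subr_eq0 -mulmxBr pa.
rewrite [X in _ = _ + (_ + X)](_ : _ = p *m F i *m q + (q - p) *m F i *m p - p *m a *m p).
  rewrite [X in X + _ + _ = _](_ : _ = (q - p) *m F i *m (q - p) +
     (p *m F i *m q + (q - p) *m F i *m p)).
    set s1 := \sum_(t < n) _; set s2 := \sum_(t < n) _.
    move: ((q - p) *m F i *m (q - p)) (_ + (q - p) *m F i *m p) (p *m a *m p).
    move: s1 s2 => s1 s2 x y z.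
    have -> : s2 + (y - z) = (y + s2) - z by rewrite addrA [s2 + y]addrC.
    by rewrite [x + (s1 + z)]addrA [RHS]addrACA subrr addr0 -addrA addrACA.
  have {1}-> : q = (q - p) + p by rewrite subrK.
  rewrite mulmxDl mulmxDl; have {2}-> : q = (q - p) + p by rewrite subrK.
  rewrite mulmxDr -addrA; congr (_ + _).
  by rewrite addrC.
rewrite !mulmxBr !(mulmxBl _ _ p) !(mulmxBl _ _ q).
rewrite !mulmxBl pa.
have e : q *m a *m p - p *m a *m p = 0 by rewrite -!mulmxBl ap.
rewrite e; exact: etrans (congr1 _ (subr0 _)) (addrAC _ _ _).
Qed.

(** The blocks live under mutually orthogonal projections. Any [Y] under [qproj n] is allowed, so
    that the induction can move the last block into [Y]. *)
Lemma hs_orthogonal_sum i (n : nat) (Y : 'M[C]_m) :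
  qproj n i *m Y *m qproj n i = Y ->
  hs (Y + \sum_(t < n) pproj t i *m avg t.+1 i *m pproj t i) =
  hs Y + \sum_(t < n) hs (pproj t i *m avg t.+1 i *m pproj t i).
Proof.
elim: n Y => [|n IH] Y hY; first by rewrite !big_ord0 !addr0.
have [pq qp _ _ _] := qprojP n i; have [hq qq] := qproj_proj n i.
have hp := adj_pproj n i; have pp := pproj_idem n i.
rewrite !big_ord_recr /= -/(pproj n i) [X in _ + X]addrC addrA IH.
  rewrite (_ : hs (Y + _) = hs Y + hs (pproj n i *m avg n.+1 i *m pproj n i)).
    by rewrite -addrA [X in _ + X]addrC.
    rewrite hsD; set X := _ *m avg _ _ *m _.
    rewrite (_ : ip Y X = 0) ?mul0rn ?addr0//.
    rewrite /ip /X -hY qprojS; move: hp pp pq qp.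
    move: (pproj n i) (qproj n i) => p q hp pp pq qp; rewrite !adjM hp -!mulmxA.
    have z : (q - p) *m p = 0 by rewrite mulmxBl qp pp subrr.
    by rewrite [(_ - _) *m (p *m _)]mulmxA z mul0mx !mulmx0 Retr0.
move: hY; rewrite qprojS.
move: (pproj n i) (qproj n i) pq qp hp pp hq qq => p q pq qp hp pp hq qq hY.
rewrite mulmxDr mulmxDl; congr (_ + _).
  have l : q *m (q - p) = q - p by rewrite mulmxBr qq qp.
  have r : (q - p) *m q = q - p by rewrite mulmxBl qq pq.
  by rewrite -[in LHS]hY !mulmxA l -mulmxA r.
by rewrite !mulmxA qp -mulmxA pq.
Qed.

(** The projections [qproj T] and [pproj t], for [t < T], add up to the identity, and averaging
    preserves traces against them. *)
Lemma sum_trace_pproj :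
  \sum_i Retr (qproj T i *m F i *m qproj T i) +
  \sum_(t < T) \sum_i Retr (pproj t i *m avg t.+1 i *m pproj t i) =
  \sum_i Retr (F i).
Proof.
have -> : \sum_(t < T) \sum_i Retr (pproj t i *m avg t.+1 i *m pproj t i) =
    \sum_i \sum_(t < T) Retr (pproj t i *m F i).
  rewrite [RHS]exchange_big /=; apply: eq_bigr => t _.
  under eq_bigr do rewrite Retr_mulC mulmxA pproj_idem.
  by apply: sum_avg => i j; exact: pproj_eq.
rewrite -big_split /=; apply: eq_bigr => i _.
rewrite Retr_mulC mulmxA (qproj_proj T i).2 -Retr_sum -mulmx_suml -RetrD -mulmxDl.
suff -> : qproj T i + \sum_(t < T) pproj t i = 1%:M by rewrite mul1mx.
elim: (T) => [|n IH]; first by rewrite big_ord0 addr0.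
by rewrite qprojS big_ord_recr /= addrACA addNr addr0.
Qed.

(** Each diagonal block lies between 0 and [D * lam], so its square has trace at most [D * lam]
    times its own trace; these traces add up to that of [F]. *)
Lemma sum_hs_gpart : \sum_i hs (gpart i) <= D%:R * lam * \sum_i Retr (F i).
Proof.
have DL : 0 <= D%:R * lam by rewrite mulr_ge0// ltW.
rewrite -sum_trace_pproj mulrDr mulr_sumr [X in _ <= _ + X]mulr_sumr.
have -> : \sum_i hs (gpart i) = \sum_i hs (qproj T i *m F i *m qproj T i) +
    \sum_(t < T) \sum_i hs (pproj t i *m avg t.+1 i *m pproj t i).
  rewrite [X in _ = _ + X]exchange_big -big_split /=; apply: eq_bigr => i _.
  apply: hs_orthogonal_sum; have [_ qq] := qproj_proj T i.
  by rewrite !mulmxA qq -mulmxA qq.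
apply: lerD; apply: ler_sum => x _.
  have [hq qq] := qproj_proj T x.
  apply: psd_hs; first by rewrite -{2}hq; exact: psd_conj.
  have lDL : lam <= D%:R * lam by rewrite ler_peMl// ltW.
  by have := psd_ler_trans lDL (qproj_avg_le T x); rewrite avg_top.
rewrite mulr_sumr; apply: ler_sum => i _.
have [pq qp _ _ _] := qprojP x i; have hp := adj_pproj x i.
apply: psd_hs; first by rewrite -{2}hp; exact: psd_conj (psd_avg _ _).
have := psd_le_proj DL (qproj_avgS_le x i) hp (pproj_idem x i).
move: (pproj x i) (qproj x i) pq qp {hp} => p q pq qp.
by rewrite !mulmxA pq -(mulmxA _ q) qp.
Qed.

Lemma sum_trace_pproj_le :
  \sum_(t < T) \sum_i Retr (pproj t i *m avg t.+1 i *m pproj t i) <=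
  \sum_i Retr (F i).
Proof.
rewrite -sum_trace_pproj lerDr; apply: sumr_ge0 => i _.
have [hq qq] := qproj_proj T i; rewrite -{2}hq.
exact: psd_tr.
Qed.

Lemma sum_trace_pprojF (t : nat) :
  \sum_i Retr (pproj t i *m F i *m pproj t i) =
  \sum_i Retr (pproj t i *m avg t.+1 i *m pproj t i).
Proof.
under eq_bigr do rewrite Retr_mulC mulmxA pproj_idem.
under [RHS]eq_bigr do rewrite Retr_mulC mulmxA pproj_idem.
by apply/esym/sum_avg => i j; exact: pproj_eq.
Qed.

(** Cuculescu's maximal inequality: on the range of [pproj t] the compressed average exceeds [lam],
    so its trace there is at least [lam] times the rank. *)
Lemma sum_rank_pproj :
  lam * \sum_(t < T) \sum_i (\rank (pproj t i))%:R <= \sum_i Retr (F i).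
Proof.
apply: le_trans sum_trace_pproj_le; rewrite mulr_sumr; apply: ler_sum => t _.
rewrite mulr_sumr; apply: ler_sum => i _.
have [_ _ _ h _] := qprojP t i.
rewrite [X in _ <= X]Retr_mulC mulmxA pproj_idem; apply: le_trans h.
by rewrite ler_pM2l//; exact: rank_cut.
Qed.

End cuculescu.

(** * Trace norm of a single block *)

Section trace_norm_forms.
Context (R : realType) (m : nat) (I : finType) (P : pred I).
Local Notation C := R[i].
Implicit Types (p q : 'M[C]_m) (G : I -> 'M[C]_m) (f : I -> C).

(** The factor [p] bounds the rank, and the compressions by [q] bound the Hilbert-Schmidt norm
    through [hs_sum_form]. *)
Lemma trn_form_left p q G f (c t : R) :
  (forall i, psd (G i)) -> adj q = q -> adj p = p -> 0 < c -> 0 < t ->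
  psd (c%:C%C%:M - \sum_(i | P i) q *m G i *m q) ->
  trn (\sum_(i | P i) f i *: (p *m G i *m q)) <=
  (t * (\rank p)%:R + t^-1 * (c *
    \sum_(i | P i) cabs (f i) ^+ 2 * Retr (p *m G i *m p))) / 2.
Proof.
move=> pG hq hp c0 t0 pc; apply: le_trans (trn_young _ t0) _.
rewrite ler_pM2r ?invr_gt0//; apply: lerD.
  rewrite ler_pM2l// ler_nat.
  under eq_bigr do rewrite -mulmxA scalemxAr.
  by rewrite -mulmx_sumr; exact: mxrankM_maxl.
by rewrite ler_pM2l ?invr_gt0//; exact: hs_sum_form.
Qed.

(** The rank is read off directly; for the Hilbert-Schmidt norm, taking adjoints puts [p] back on
    the left. *)
Lemma trn_form_right p q G f (c t : R) :
  (forall i, psd (G i)) -> adj q = q -> adj p = p -> 0 < c -> 0 < t ->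
  psd (c%:C%C%:M - \sum_(i | P i) q *m G i *m q) ->
  trn (\sum_(i | P i) f i *: (q *m G i *m p)) <=
  (t * (\rank p)%:R + t^-1 * (c *
    \sum_(i | P i) cabs (f i) ^+ 2 * Retr (p *m G i *m p))) / 2.
Proof.
move=> pG hq hp c0 t0 pc; apply: le_trans (trn_young _ t0) _.
rewrite ler_pM2r ?invr_gt0//; apply: lerD.
  rewrite ler_pM2l// ler_nat.
  under eq_bigr do rewrite scalemxAl.
  by rewrite -mulmx_suml; exact: mxrankM_maxr.
rewrite ler_pM2l ?invr_gt0// -hs_adj adj_sum.
have -> : \sum_(i | P i) cabs (f i) ^+ 2 * Retr (p *m G i *m p) =
  \sum_(i | P i) cabs ((f i)^*)%R ^+ 2 * Retr (p *m G i *m p).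
  by apply: eq_bigr => i _; rewrite cabs_conj.
have -> : \sum_(i | P i) adj (f i *: (q *m G i *m p)) =
    \sum_(i | P i) ((f i)^*)%R *: (p *m G i *m q).
  by apply: eq_bigr => i _; rewrite adjZ !adjM hq hp (psd_adj (pG i)) mulmxA.
exact: hs_sum_form.
Qed.

(** [G] will be the values on the cells of a cube and [G'] their average; both satisfy the same
    bounds, so a single [c] serves. *)
Lemma trn_form_block p q q' G G' f (c t : R) :
  (forall i, psd (G i)) -> (forall i, psd (G' i)) ->
  adj p = p -> adj q = q -> adj q' = q' -> 0 < c -> 0 < t ->
  psd (c%:C%C%:M - \sum_(i | P i) q *m G i *m q) ->
  psd (c%:C%C%:M - \sum_(i | P i) q *m G' i *m q) ->
  psd (c%:C%C%:M - \sum_(i | P i) q' *m G i *m q') ->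
  psd (c%:C%C%:M - \sum_(i | P i) q' *m G' i *m q') ->
  let H := \sum_(i | P i) f i *: G i - \sum_(i | P i) f i *: G' i in
  trn (p *m H *m q + q' *m H *m p) <= 2 * t * (\rank p)%:R +
    t^-1 * (c * \sum_(i | P i) cabs (f i) ^+ 2 *
      (Retr (p *m G i *m p) + Retr (p *m G' i *m p))).
Proof.
move=> pG pG' hp hq hq' c0 t0 p1 p2 p3 p4 /=.
set H := \sum_(i | P i) f i *: G i - \sum_(i | P i) f i *: G' i.
have sw (r r' : 'M[C]_m) (Z : I -> 'M[C]_m) :
    r *m (\sum_(i | P i) f i *: Z i) *m r' =
    \sum_(i | P i) f i *: (r *m Z i *m r').
  rewrite mulmx_sumr mulmx_suml.
  by apply: eq_bigr => i _; rewrite -scalemxAr -scalemxAl.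
have trHB (r r' : 'M[C]_m) : trn (r *m H *m r') <=
    trn (\sum_(i | P i) f i *: (r *m G i *m r')) +
    trn (\sum_(i | P i) f i *: (r *m G' i *m r')).
  rewrite -(sw r r' G) -(sw r r' G') mulmxBr mulmxBl.
  apply: le_trans (trnD _ _) _; rewrite lerD2l.
  by rewrite -scaleN1r trnZ// cabsN cabs_real normr1.
have aux (X1 X2 X3 X4 r S1 S2 : R) :
    X1 <= (t * r + t^-1 * (c * S1)) / 2 -> X2 <= (t * r + t^-1 * (c * S2)) / 2 ->
    X3 <= (t * r + t^-1 * (c * S1)) / 2 -> X4 <= (t * r + t^-1 * (c * S2)) / 2 ->
    X1 + X2 + (X3 + X4) <= 2 * t * r + t^-1 * (c * (S1 + S2)).
  move=> e1 e2 e3 e4.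
  rewrite (mulrDr c) (mulrDr t^-1).
  by move: (t^-1 * (c * S1)) (t^-1 * (c * S2)) e1 e2 e3 e4 => Y1 Y2; lra.
rewrite (eq_bigr _ (fun i _ => mulrDr _ _ _)) big_split.
apply: le_trans (trnD _ _) _.
apply: le_trans (lerD (trHB p q) (trHB q' p)) _.
apply: aux.
- exact: (trn_form_left f pG hq hp c0 t0 p1).
- exact: (trn_form_left f pG' hq hp c0 t0 p2).
- exact: (trn_form_right f pG hq' hp c0 t0 p3).
- exact: (trn_form_right f pG' hq' hp c0 t0 p4).
Qed.

End trace_norm_forms.

Opaque pproj qproj.

(** * The distribution inequality at a fixed point *)

Section pointwise.
Context (R : realType) (m : nat) (I : finType).
Local Notation C := R[i].
Variables (anc : nat -> I -> I) (N : nat -> nat) (D : nat).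
Hypothesis anc_nested : forall t i j,
  anc t.+1 i = anc t.+1 j -> anc t i = anc t j.
Hypothesis anc_idem : forall t i, anc t (anc t i) = anc t i.
Hypothesis N_gt0 : forall t, (0 < N t)%N.
Hypothesis card_anc : forall t i, #|[pred j | anc t j == anc t i]| = N t.
Hypothesis N_le : forall t, (N t <= D * N t.+1)%N.
Variables (T : nat) (F : I -> 'M[C]_m) (lam : R).
Hypothesis anc_fin : injective (anc T).
Hypothesis lam0 : 0 < lam.
Hypothesis psdF : forall i, psd (F i).
Local Notation avg := (avg anc N F).
Local Notation qproj := (qproj anc N F lam).
Local Notation pproj := (pproj anc N F lam).
Local Notation gpart := (gpart anc N T F lam).
Local Notation bpart := (bpart anc N F lam).
Hypothesis avg0_le : forall i, psd (lam%:C%C%:M - avg 0 i).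

Variables (phi : I -> C) (K : nat -> I -> C).
Variables (near : nat -> I -> bool) (tau : nat -> I -> R).

(** [phi i] stands for the image of the indicator of the cell [i] at a fixed point, and [K t k] for
    the volume of a cell times the kernel frozen at the center of the cube [k]. *)
Let psi t i := phi i - K t (anc t.+1 i).
Let c t := (N t.+1)%:R * (D%:R * lam) : R.

Let D_gt0 : (0 < D)%N.
Proof. by have := N_le 0; have := N_gt0 0; have := N_gt0 1; lia. Qed.

Let c_gt0 t : 0 < c t.
Proof. by rewrite !mulr_gt0 ?ltr0n. Qed.

(** An atom has [N t.+1] cells sharing one average, whence [c t] is [N t.+1] times the bound for
    that average. *)
Let form_le t k q (G : I -> 'M[C]_m) :
  psd ((D%:R * lam)%:C%C%:M - q *m avg t.+1 k *m q) ->
  \sum_(i | anc t.+1 i == k) G i = \sum_(i | anc t.+1 i == k) avg t.+1 i ->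
  anc t.+1 k = k ->
  psd ((c t)%:C%C%:M - \sum_(i | anc t.+1 i == k) q *m G i *m q).
Proof.
move=> pq hG kk; rewrite -mulmx_suml -mulmx_sumr hG.
rewrite (eq_bigr (fun=> avg t.+1 k)) => [|i /eqP h]; last first.
  by apply: avg_eq; rewrite h kk.
rewrite sumr_const (eq_card (B := [pred i | anc t.+1 i == anc t.+1 k])); last first.
  by move=> i; rewrite !inE kk.
rewrite card_anc -scaler_nat.
have -> : (N t.+1)%:R = ((N t.+1)%:R : R)%:C%C :> C by rewrite rmorph_nat.
rewrite -scalemxAr -scalemxAl /c rmorphM -scale_scalar_mx -scalerBr.
by apply: psdZ => //; rewrite ler0n.
Qed.

Let sum_avg_class t k : anc t.+1 k = k ->
  \sum_(i | anc t.+1 i == k) F i = \sum_(i | anc t.+1 i == k) avg t.+1 i.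
Proof.
move=> kk; rewrite [RHS](eq_bigr (fun=> avg t.+1 k)) => [|i /eqP h]; last first.
  by apply: avg_eq; rewrite h kk.
rewrite sumr_const (eq_card (B := [pred i | anc t.+1 i == anc t.+1 k])); last first.
  by move=> i; rewrite !inE kk.
rewrite card_anc -scaler_nat.
have -> : (N t.+1)%:R = ((N t.+1)%:R : R)%:C%C :> C by rewrite rmorph_nat.
rewrite avgE kk scalerA -rmorphM mulfV ?scale1r//.
by rewrite pnatr_eq0 -lt0n.
Qed.

Let block t k := \sum_(i | anc t.+1 i == k) phi i *: bpart t i.

Let blockE t k : anc t.+1 k = k -> block t k =
  pproj t k *m (\sum_(i | anc t.+1 i == k) phi i *: (F i - avg t.+1 i)) *m qproj t k +
  qproj t.+1 k *m (\sum_(i | anc t.+1 i == k) phi i *: (F i - avg t.+1 i)) *m pproj t k.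
Proof.
move=> kk; rewrite /block !mulmx_sumr !mulmx_suml -big_split /=.
apply: eq_bigr => i /eqP h; rewrite bpartE.
have e : anc t.+1 i = anc t.+1 k by rewrite h kk.
rewrite (pproj_eq N anc_nested F lam e) (qproj_eq N anc_nested F lam (anc_nested e)).
rewrite (qproj_eq N anc_nested F lam e).
by rewrite scalerDr -!scalemxAr -!scalemxAl.
Qed.

Let block_near t k : anc t.+1 k = k ->
  (\rank (block t k) <= 2 * \rank (pproj t k))%N.
Proof.
move=> kk; rewrite blockE//; apply: leq_trans (mxrank_add _ _) _.
rewrite mul2n -addnn; apply: leq_add; last exact: mxrankM_maxr.
by rewrite -mulmxA; exact: mxrankM_maxl.
Qed.

(** Cancellation: [F - avg] sums to 0 over an atom, so the constant [K t k] may be subtracted from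
    [phi]. *)
Let block_far t k : anc t.+1 k = k -> 0 < tau t k ->
  trn (block t k) <= 2 * tau t k * (\rank (pproj t k))%:R +
    (tau t k)^-1 * (c t * \sum_(i | anc t.+1 i == k) cabs (psi t i) ^+ 2 *
      (Retr (pproj t k *m F i *m pproj t k) +
       Retr (pproj t k *m avg t.+1 i *m pproj t k))).
Proof.
move=> kk t0; rewrite blockE//.
have -> : \sum_(i | anc t.+1 i == k) phi i *: (F i - avg t.+1 i) =
    \sum_(i | anc t.+1 i == k) psi t i *: F i -
    \sum_(i | anc t.+1 i == k) psi t i *: avg t.+1 i.
  rewrite -sumrB.
  have -> : \sum_(i | anc t.+1 i == k) (psi t i *: F i - psi t i *: avg t.+1 i) =
      \sum_(i | anc t.+1 i == k) phi i *: (F i - avg t.+1 i) -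
      \sum_(i | anc t.+1 i == k) K t k *: (F i - avg t.+1 i).
    rewrite -sumrB; apply: eq_bigr => i /eqP h.
    by rewrite /psi h -scalerBl scalerBr.
  by rewrite -scaler_sumr sumrB sum_avg_class// subrr scaler0 subr0.
have [hq _] := qproj_proj anc N lam0 psdF t k.
have [hq' _] := qproj_proj anc N lam0 psdF t.+1 k.
have pq := qproj_avgS_le anc_nested N_gt0 N_le lam0 psdF avg0_le t k.
have pq' := qprojS_avgS_le N_gt0 N_le lam0 psdF avg0_le t k.
have pavg i := psd_avg anc N psdF t.+1 i.
have e1 := form_le pq (sum_avg_class kk) kk.
have e2 := form_le pq erefl kk.
have e3 := form_le pq' (sum_avg_class kk) kk.
have e4 := form_le pq' erefl kk.
exact: (trn_form_block (psi t) psdF pavg (adj_pproj _ _ _ _ _ _) hq hq' (c_gt0 t) t0 e1 e2 e3 e4).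
Qed.

(** The level is shared as [lam / 2 + 0 + lam / 2] among the good part, the near blocks and the far
    blocks. Near blocks are counted by rank and need no level; the halves produce the factors
    [4 / lam ^+ 2] for [hs] and [2 / lam] for [trn]. *)
Lemma nsv_pointwise : (forall t k, ~~ near t k -> 0 < tau t k) ->
  (nsv lam (\sum_i phi i *: F i))%:R <=
  4 / lam ^+ 2 * hs (\sum_i phi i *: gpart i) +
  \sum_(t < T) \sum_(k | anc t.+1 k == k)
    (if near t k then 2 * (\rank (pproj t k))%:R else
     4 / lam * tau t k * (\rank (pproj t k))%:R +
     2 / lam * (tau t k)^-1 * (c t *
       \sum_(i | anc t.+1 i == k) cabs (psi t i) ^+ 2 *
      (Retr (pproj t k *m F i *m pproj t k) +
       Retr (pproj t k *m avg t.+1 i *m pproj t k)))).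
Proof.
move=> tau0.
pose Z := \sum_(t < T) \sum_(k | anc t.+1 k == k) if near t k then block t k else 0.
pose E := \sum_(t < T) \sum_(k | anc t.+1 k == k) if near t k then 0 else block t k.
have split_E : \sum_i phi i *: F i = \sum_i phi i *: gpart i + (Z + E).
  have -> : \sum_i phi i *: F i =
      \sum_i phi i *: gpart i + \sum_(t < T) \sum_i phi i *: bpart t i.
    rewrite [X in _ + X]exchange_big -big_split /=; apply: eq_bigr => i _.
    rewrite -scaler_sumr -scalerDr; congr (_ *: _).
    exact: calderon_zygmund.
  congr (_ + _); rewrite /Z /E -big_split /=; apply: eq_bigr => t _.
  rewrite -big_split /= (partition_big (anc t.+1) (fun k => anc t.+1 k == k)) /=; last first.
    by move=> i _; rewrite anc_idem.
  by apply: eq_bigr => k _; rewrite -/(block t k); case: ifP; rewrite ?addr0 ?add0r.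
have l2 : 0 < lam / 2 by rewrite divr_gt0.
have n1 : (nsv lam (\sum_i phi i *: F i) <=
    nsv (lam / 2) (\sum_i phi i *: gpart i) + (nsv 0 Z + nsv (lam / 2) E))%N.
  rewrite split_E [X in nsv X _](splitr lam).
  apply: leq_trans (nsv_add _ _ (ltW l2) (ltW l2)) _; rewrite leq_add2l.
  by rewrite -[X in nsv X _]add0r; apply: nsv_add => //; exact: ltW.
apply: (@le_trans _ _ _ _ _ (_ : (_ <= (nsv (lam / 2) (\sum_i phi i *: gpart i) +
  (nsv 0 Z + nsv (lam / 2) E))%:R))); first by rewrite ler_nat.
rewrite !natrD; apply: lerD.
  have h := nsv_hs (\sum_i phi i *: gpart i) l2.
  rewrite -(ler_pM2l (exprn_gt0 2 l2)); apply: le_trans h _.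
  rewrite mulrA (_ : (lam / 2) ^+ 2 * (4 / lam ^+ 2) = 1) ?mul1r//.
  by field; rewrite gt_eqF.
have nZ : (nsv 0 Z)%:R <= \sum_(t < T) \sum_(k | anc t.+1 k == k)
    (if near t k then 2 * (\rank (pproj t k))%:R else 0) :> R.
  apply: (@le_trans _ _ (\rank Z)%:R); first by rewrite ler_nat nsv_rank.
  rewrite /Z; elim/big_ind2 : _ => [|A x B y hA hB|t _].
  - by rewrite mxrank0.
  - by apply: le_trans (lerD hA hB); rewrite -natrD ler_nat mxrank_add.
  elim/big_ind2 : _ => [|A x B y hA hB|k /eqP kk].
  - by rewrite mxrank0.
  - by apply: le_trans (lerD hA hB); rewrite -natrD ler_nat mxrank_add.
  case: ifP => _; last by rewrite mxrank0.
  by rewrite -natrM ler_nat block_near.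
have nE : (nsv (lam / 2) E)%:R <= 2 / lam * \sum_(t < T) \sum_(k | anc t.+1 k == k)
    (if near t k then 0 else trn (block t k)).
  have h := nsv_trn E l2.
  rewrite -(ler_pM2l l2) mulrA (_ : lam / 2 * (2 / lam) = 1) ?mul1r; last first.
    by field; rewrite gt_eqF.
  apply: le_trans h _; apply: le_trans (trn_sum _ _ _) _; apply: ler_sum => t _.
  apply: le_trans (trn_sum _ _ _) _; apply: ler_sum => k _.
  by case: ifP => _; rewrite ?trn0.
apply: le_trans (lerD nZ nE) _; rewrite mulr_sumr -big_split /=.
apply: ler_sum => t _; rewrite mulr_sumr -big_split /=; apply: ler_sum => k /eqP kk.
case: ifPn => [_|fk]; first by rewrite mulr0 addr0.
rewrite add0r; have h := block_far kk (tau0 _ _ fk).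
have l2' : 0 <= 2 / lam by rewrite divr_ge0// ltW.
apply: le_trans (ler_wpM2l l2' h) _; rewrite mulrDr !mulrA lerD2r.
by rewrite (_ : 2 / lam * 2 = 4 / lam)//; field; rewrite gt_eqF.
Qed.

End pointwise.

(** * Functions on R^d and dyadic cells *)

Section complex_functions.
Context (R : realType) (d : nat).
Local Notation E := 'rV[R]_d.
Local Notation C := R[i].
Local Notation mu := (lebesgue_rV R d).
Implicit Types (f g : E -> C).

Lemma measurable_sqrt : measurable_fun [set: R] (@Num.sqrt R).
Proof. by apply: continuous_measurable_fun; exact: sqrt_continuous. Qed.

Lemma cmeasurable_cst (a : C) : cmeasurable (fun _ : E => a).
Proof. by split; exact: measurable_cst. Qed.

Lemma cmeasurableD f g : cmeasurable f -> cmeasurable g ->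
  cmeasurable (fun x => f x + g x).
Proof.
move=> [rf fi] [rg gi]; split.
  by under eq_fun do rewrite cReD; exact: measurable_funD.
by under eq_fun do rewrite cImD; exact: measurable_funD.
Qed.

Lemma cmeasurableM f g : cmeasurable f -> cmeasurable g ->
  cmeasurable (fun x => f x * g x).
Proof.
move=> [rf fi] [rg gi]; split.
  under eq_fun do rewrite cReM.
  by apply: measurable_funB; exact: measurable_funM.
under eq_fun do rewrite cImM.
by apply: measurable_funD; exact: measurable_funM.
Qed.

Lemma cmeasurableZ (a : C) f : cmeasurable f -> cmeasurable (fun x => a * f x).
Proof. by apply: cmeasurableM; exact: cmeasurable_cst. Qed.

Lemma cmeasurableB f g : cmeasurable f -> cmeasurable g ->
  cmeasurable (fun x => f x - g x).
Proof.
move=> mf mg; under eq_fun do rewrite -mulN1r.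
by apply: cmeasurableD => //; exact: cmeasurableZ.
Qed.

Lemma cmeasurable_sum (I : Type) (s : seq I) (h : I -> E -> C) :
  (forall i, cmeasurable (h i)) -> cmeasurable (fun x => \sum_(i <- s) h i x).
Proof.
move=> mh; elim: s => [|i s IH].
  by under eq_fun do rewrite big_nil; exact: cmeasurable_cst.
by under eq_fun do rewrite big_cons; exact: cmeasurableD.
Qed.

Lemma measurable_cabs f : cmeasurable f -> measurable_fun setT (fun x => cabs (f x)).
Proof.
move=> [rf fi]; rewrite (_ : (fun x => cabs (f x)) =
    Num.sqrt \o (fun x => complex.Re (f x) ^+ 2 + complex.Im (f x) ^+ 2)); last first.
  by apply/funext => x /=; rewrite cabsE.
apply: measurableT_comp; first exact: measurable_sqrt.
by apply: measurable_funD; exact: measurable_funX.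
Qed.

Lemma measurable_cabsE f : cmeasurable f ->
  measurable_fun setT (fun x => (cabs (f x))%:E).
Proof. by move=> mf; apply/measurable_EFinP; exact: measurable_cabs. Qed.

Lemma measurable_cabs2E f : cmeasurable f ->
  measurable_fun setT (fun x => (cabs (f x) ^+ 2)%:E).
Proof.
by move=> mf; apply/measurable_EFinP/measurable_funX; exact: measurable_cabs.
Qed.

Lemma cLnorm1E f : cLnorm 1%:E f = (\int[mu]_x (cabs (f x))%:E)%E.
Proof.
rewrite /cLnorm Lnorm1; apply: eq_integral => x _ /=.
by rewrite ger0_norm// cabs_ge0.
Qed.

Lemma cLnorm_ge0 p f : (0 <= cLnorm p f)%E.
Proof. exact: Lnorm_ge0. Qed.

(** The product form avoids square roots and covers an infinite norm as well. *)
Lemma cLnorm2E f :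
  (cLnorm 2%:E f * cLnorm 2%:E f = \int[mu]_x (cabs (f x) ^+ 2)%:E)%E.
Proof.
have -> : (cLnorm 2%:E f * cLnorm 2%:E f = cLnorm 2%:E f `^ 2)%E.
  have := cLnorm_ge0 2%:E f; case: (cLnorm 2%:E f) => [r r0||] //.
    by rewrite poweR_EFin powR_mulrn// expr2 EFinM.
  by rewrite poweRyr ?pnatr_eq0// mulyy.
rewrite /cLnorm poweR_Lnorm ?pnatr_eq0//; apply: eq_integral => x _ /=.
by rewrite ger0_norm ?cabs_ge0// powR_mulrn ?cabs_ge0.
Qed.

Lemma Lp1P f : Lp 1%:E f <->
  cmeasurable f /\ (\int[mu]_x (cabs (f x))%:E < +oo)%E.
Proof. by rewrite /Lp cLnorm1E. Qed.

Lemma Lp2P f : Lp 2%:E f <->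
  cmeasurable f /\ (\int[mu]_x (cabs (f x) ^+ 2)%:E < +oo)%E.
Proof.
rewrite /Lp -cLnorm2E; split => -[mf h]; split => //.
  by rewrite lte_mul_pinfty ?cLnorm_ge0// ge0_fin_numE ?cLnorm_ge0.
have := cLnorm_ge0 2%:E f; move: h; case: (cLnorm 2%:E f) => [r _ _||] //=.
exact: ltry.
Qed.

Lemma cLnorm2_le (M : R) f g : 0 <= M ->
  (cLnorm 2%:E f <= M%:E * cLnorm 2%:E g)%E ->
  (\int[mu]_x (cabs (f x) ^+ 2)%:E <=
   (M ^+ 2)%:E * \int[mu]_x (cabs (g x) ^+ 2)%:E)%E.
Proof.
move=> M0 h; rewrite -!cLnorm2E expr2 EFinM.
apply: (@le_trans _ _ ((M%:E * cLnorm 2%:E g) * (M%:E * cLnorm 2%:E g))%E).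
  by apply: lee_pmul => //; exact: cLnorm_ge0.
by rewrite muleACA.
Qed.

End complex_functions.

Section ae_tools.
Context d (T : measurableType d) (R : realType) (mu : {measure set T -> \bar R}).
Local Open Scope ereal_scope.

(* The integral of a nonmeasurable nonnegative function is a lower integral. *)
Lemma nonmeasurable_ge0_integral_le (f g : T -> \bar R) :
  (forall x, 0 <= f x) -> (forall x, 0 <= g x) -> measurable_fun setT g ->
  {ae mu, forall x, f x <= g x} ->
  \int[mu]_x f x <= \int[mu]_x g x.
Proof.
move=> f0 g0 mg fg.
rewrite [X in X <= _]ge0_integralTE//; apply: ge_ereal_sup => _ /= [h hf <-].
rewrite -integralT_nnsfun; apply: ae_ge0_le_integral => //=.
- move=> x _; have h0 : (0 <= h x)%R by [].
  by rewrite lee_fin.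
- by apply/measurable_EFinP; exact: measurable_funP.
by apply: filterS fg => x fx _; exact: le_trans (hf x) fx.
Qed.

End ae_tools.

Section boxes.
Context (R : realType) (d : nat).
Local Notation E := 'rV[R]_d.
Local Notation mu := (lebesgue_rV R d).
Implicit Types (x c : E).

Lemma measurable_box (A : 'I_d -> set R) :
  (forall i, measurable (A i : set (measurableTypeR R))) ->
  measurable [set v : E | forall i, A i (v ord0 i)].
Proof.
move=> mA; rewrite (_ : [set v : E | _] = \bigcap_(i in [set: 'I_d])
    ((fun v : E => v ord0 i) @^-1` A i)); last first.
  by apply/seteqP; split => v /= vA => [i _|i]; exact: vA.
apply: fin_bigcap_measurable => // i _; rewrite -[X in measurable X]setTI.
exact: measurable_coord.
Qed.

Lemma mu_box (a b : 'I_d -> R) : (forall i, a i <= b i) ->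
  mu [set v : E | forall i, a i <= v ord0 i < b i] =
  (\prod_i (b i - a i))%:E.
Proof.
move=> ab; rewrite (_ : mu _ = (\prod_i lebesgue_measure (`[a i, b i[%classic : set R))%E).
  rewrite -prodEFin; apply: eq_bigr => i _.
  rewrite lebesgue_measure_itv /= lte_fin; case: ltP => //.
  by move=> ba; rewrite (_ : b i = a i) ?subrr//; apply/eqP; rewrite eq_le ba ab.
by rewrite -(@lebesgue_rV_box R d (fun i => `[a i, b i[%classic)).
Qed.

Lemma measurable_halfopen_box (a b : 'I_d -> R) :
  measurable [set v : E | forall i, a i <= v ord0 i < b i].
Proof.
apply: (@measurable_box (fun i => `[a i, b i[%classic)) => i.
exact: measurable_itv.
Qed.

Lemma side_gt0 j : 0 < side R j.
Proof. by rewrite /side exprz_gt0. Qed.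

Lemma measurable_dyadic_cube j k : measurable (@dyadic_cube R d j k).
Proof. exact: measurable_halfopen_box. Qed.

Lemma mu_dyadic_cube j k : mu (@dyadic_cube R d j k) = (side R j ^+ d)%:E.
Proof.
rewrite /dyadic_cube mu_box => [|i]; last first.
  by rewrite ler_pM2l ?side_gt0// ler_int lerDl.
congr EFin; rewrite (eq_bigr (fun=> side R j)) ?prodr_const ?card_ord// => i _.
by rewrite rmorphD /= mulrDr mulr1 addrAC subrr add0r.
Qed.

Lemma measurable_enorm c : measurable_fun setT (fun x => enorm (x - c)).
Proof.
rewrite /enorm; apply: measurableT_comp; first exact: measurable_sqrt.
apply: measurable_sum => i; apply: measurable_funX.
under eq_fun do rewrite !mxE.
by apply: measurable_funB => //; exact: measurable_coord.
Qed.

Lemma measurable_annulus c r s : measurable (annulus c r s).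
Proof.
rewrite /annulus -[X in measurable X]setTI.
rewrite (_ : [set x : E | _] = (fun x => enorm (x - c)) @^-1` `[r, s]%classic).
  by apply: measurable_enorm => //; exact: measurable_itv.
by apply/seteqP; split => x /=; rewrite in_itv.
Qed.

Lemma coord_le_enorm x i : `|x ord0 i| <= enorm x.
Proof.
rewrite /enorm -sqrtr_sqr ler_wsqrtr// (bigD1 i)//= lerDl.
by apply: sumr_ge0 => j _; exact: sqr_ge0.
Qed.

(** A power of two in place of the square root of [d] makes the near region of a cube end exactly
    where one of the dyadic annuli begins. *)
Lemma enorm_le x (r : R) : 0 <= r -> (forall i, `|x ord0 i| <= r) ->
  enorm x <= 2 ^+ d * r.
Proof.
move=> r0 h; rewrite /enorm -[leRHS]ger0_norm ?mulr_ge0 ?exprn_ge0//.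
rewrite -sqrtr_sqr ler_wsqrtr// exprMn.
apply: (@le_trans _ _ (\sum_(i < d) r ^+ 2)).
  apply: ler_sum => i _; rewrite -real_normK ?num_real// ler_pXn2r ?nnegrE//.
rewrite sumr_const card_ord -[leLHS]mulr_natl ler_wpM2r ?sqr_ge0//.
rewrite -exprM -natrX ler_nat (leq_trans (ltnW (ltn_expl d (ltnSn 1))))//.
by rewrite leq_exp2l// leq_pmulr.
Qed.

Lemma mu_ball_le c (r : R) (A : set E) : 0 < r -> measurable A ->
  (forall x, A x -> enorm (x - c) <= r) -> (mu A <= ((4 * r) ^+ d)%:E)%E.
Proof.
move=> r0 mA hA.
(* The box has half-side [r + r], because it is half-open while the ball is closed. *)
have -> : (4 * r) ^+ d =
    \prod_i (c ord0 i + (r + r) - (c ord0 i - (r + r))) :> R.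
  rewrite (eq_bigr (fun=> 4 * r)) ?prodr_const ?card_ord// => i _; ring.
rewrite -mu_box => [|i]; last by lra.
apply: le_measure; rewrite ?inE//; first exact: measurable_halfopen_box.
move=> x /hA h i; have := le_trans (coord_le_enorm (x - c) i) h.
by rewrite !mxE ler_norml; lra.
Qed.

End boxes.

Section dyadic_index.
Context (d J L : nat).
Let T := (J + L)%N.

(* The cells of generation J in the box [-2^L, 2^L)^d.  Level t of the filtration
   consists of the dyadic cubes of side 2^(L - t), so level J + L is the finest;
   [anc t i] is the cell at the lower corner of the cube of level t that
   contains the cell i. *)
Definition idx : finType := {ffun 'I_d -> 'I_(2 ^ T.+1)}.

Let anc_lt t (i : idx) j : (i j %/ 2 ^ (T - t) * 2 ^ (T - t) < 2 ^ T.+1)%N.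
Proof. exact: leq_ltn_trans (leq_divM _ _) (ltn_ord (i j)). Qed.

Definition anc (t : nat) (i : idx) : idx := [ffun j => Ordinal (anc_lt t i j)].

Definition ncell (t : nat) : nat := ((2 ^ (T - t)) ^ d)%N.

Lemma anc_eqP t (i i' : idx) : reflect
  (forall j, i j %/ 2 ^ (T - t) = i' j %/ 2 ^ (T - t))%N (anc t i == anc t i').
Proof.
apply: (iffP eqP) => [h j|h].
  have := congr1 (fun f : idx => val (f j)) h; rewrite !ffunE /= => /eqP.
  by rewrite eqn_pmul2r ?expn_gt0// => /eqP.
by apply/ffunP => j; rewrite !ffunE; apply/val_inj; rewrite /= h.
Qed.

Lemma anc_val t i j : (anc t i j = i j %/ 2 ^ (T - t) * 2 ^ (T - t) :> nat)%N.
Proof. by rewrite ffunE. Qed.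

Lemma anc_idem t i : anc t (anc t i) = anc t i.
Proof. by apply/eqP/anc_eqP => j; rewrite anc_val mulnK ?expn_gt0. Qed.

Lemma anc_nested t i i' : anc t.+1 i = anc t.+1 i' -> anc t i = anc t i'.
Proof.
move=> /eqP/anc_eqP h; apply/eqP/anc_eqP => j.
(* From level [T] on the truncated difference [T - t] is 0, and all levels coincide. *)
have [tT|tT] := ltnP t T; last first.
  by have := h j; rewrite (eqP tT) (eqP (leqW tT)).
have e : (2 ^ (T - t) = 2 ^ (T - t.+1) * 2)%N by rewrite -expnSr subnSK.
by rewrite e !divnMA (h j).
Qed.

Lemma anc_fin : injective (anc T).
Proof.
move=> i i' /eqP/anc_eqP h; apply/ffunP => j; apply/val_inj.
by have := h j; rewrite subnn expn0 !divn1.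
Qed.

Lemma ncell_gt0 t : (0 < ncell t)%N.
Proof. by rewrite /ncell !expn_gt0. Qed.

Lemma ncell_le t : (ncell t <= 2 ^ d * ncell t.+1)%N.
Proof.
rewrite /ncell -expnMn -expnS; have h : (2 ^ (T - t) <= 2 ^ (T - t.+1).+1)%N.
  by rewrite leq_exp2l//; lia.
move: (2 ^ _)%N (2 ^ _)%N h => a b ab.
by elim: (d) => [//|n IH]; rewrite !expnS; exact: leq_mul.
Qed.

Let card_block (M K c : nat) : (0 < M)%N -> (c < K)%N ->
  #|[pred a : 'I_(K * M) | (a %/ M == c)%N]| = M.
Proof.
move=> M0 cK.
have lt (b : 'I_M) : (c * M + b < K * M)%N.
  by rewrite (leq_trans (n := c.+1 * M))// ?leq_mul2r ?cK ?orbT// mulSnr ltn_add2l.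
pose f (b : 'I_M) := Ordinal (lt b).
rewrite -[RHS](card_ord M) -(card_imset _ (f := f)) => [|b b' /(congr1 val)/= /addnI].
  apply: eq_card => a; rewrite inE; apply/idP/imsetP => [/eqP ac|[b _ ->]].
    have lb : (a %% M < M)%N by rewrite ltn_pmod.
    by exists (Ordinal lb) => //; apply/val_inj; rewrite /= -ac -divn_eq.
  by rewrite /= divnMDl// divn_small ?addn0.
exact: val_inj.
Qed.

Lemma card_anc t i : #|[pred i' | anc t i' == anc t i]| = ncell t.
Proof.
pose F j := [pred a : 'I_(2 ^ T.+1) | (a %/ 2 ^ (T - t) == i j %/ 2 ^ (T - t))%N].
rewrite (eq_card (B := family F)) => [|i']; last first.
  rewrite inE; apply/idP/familyP => [/anc_eqP h j|h]; first by rewrite inE h.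
  by apply/anc_eqP => j; have := h j; rewrite inE => /eqP.
rewrite card_family.
have cF j : #|F j| = (2 ^ (T - t))%N.
  rewrite /F; move: (i j); rewrite (_ : (2 ^ T.+1 = 2 ^ (T.+1 - (T - t)) * 2 ^ (T - t))%N).
    move=> b; apply: card_block; first by rewrite expn_gt0.
    by rewrite ltn_divLR ?expn_gt0.
  by rewrite -expnD subnK//; lia.
rewrite /image_mem /ncell -[in RHS](card_ord d) cardE.
by elim: (enum _) => //= a s ->; rewrite cF expnS.
Qed.

End dyadic_index.

Section dyadic_cells.
Context (R : realType) (d J L : nat).
Local Notation E := 'rV[R]_d.
Local Notation mu := (lebesgue_rV R d).
Let T := (J + L)%N.
Local Notation idx := (idx d J L).
Local Notation anc := (@anc d J L).

Definition gen (t : nat) : int := t%:Z - L%:Z.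

(** The shift by [2 ^ t] places the index 0 at the lower corner [- 2 ^+ L] of the box. *)
Definition corner (t : nat) (i : idx) : 'rV[int]_d :=
  \row_j ((i j %/ 2 ^ (T - t))%N%:Z - (2 ^ t)%N%:Z).

Definition cube (t : nat) (i : idx) : set E := dyadic_cube (gen t) (corner t i).
Definition ctr (t : nat) (i : idx) : E := cube_center R (gen t) (corner t i).

Definition ell (t : nat) : R := side R (gen t).

Lemma ell_gt0 t : 0 < ell t. Proof. exact: side_gt0. Qed.

Lemma ellE t : (t <= T)%N -> ell t = 2 ^+ (T - t) * ell T.
Proof.
move=> tT; rewrite /ell /side /gen /T.
have u2 : (2 : R) \is a GRing.unit by rewrite unitfE pnatr_eq0.
rewrite -[2 ^+ _]/(2 ^ (Posz _)) -exprzDr//; congr (_ ^ _).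
by rewrite -subzn//; ring.
Qed.

Lemma ell_T : ell T = (2 ^+ J)^-1.
Proof.
rewrite /ell /side /gen /T PoszD addrK.
by rewrite -invr_expz.
Qed.

Lemma cube_anc t i : cube t (anc t i) = cube t i.
Proof.
rewrite /cube /corner; congr dyadic_cube; apply/rowP => j; rewrite !mxE.
by rewrite anc_val mulnK ?expn_gt0.
Qed.

Lemma ctr_anc t i : ctr t (anc t i) = ctr t i.
Proof.
rewrite /ctr /corner; congr cube_center; apply/rowP => j; rewrite !mxE.
by rewrite anc_val mulnK ?expn_gt0.
Qed.

Lemma cubeP t i x : cube t i x <-> forall j,
  ell t * ((i j %/ 2 ^ (T - t))%N%:R - 2 ^+ t) <= x ord0 j <
  ell t * ((i j %/ 2 ^ (T - t))%N%:R + 1 - 2 ^+ t).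
Proof.
rewrite /cube /dyadic_cube /=.
suff e j : (corner t i ord0 j)%:~R = (i j %/ 2 ^ (T - t))%N%:R - 2 ^+ t :> R.
  split=> h j; have := h j; rewrite rmorphD /= e /ell.
    by rewrite [_ - _ + _]addrAC.
  by rewrite [_ + _ - _]addrAC.
by rewrite mxE rmorphB /= -natrX.
Qed.

Lemma cell_sub t i x : (t <= T)%N -> cube T i x -> cube t i x.
Proof.
move=> tT /cubeP h; apply/cubeP => j; have := h j.
rewrite subnn expn0 divn1 (ellE tT).
set M := (2 ^ (T - t))%N; have -> : 2 ^+ (T - t) = M%:R :> R by rewrite natrX.
have -> : 2 ^+ T = M%:R * 2 ^+ t :> R by rewrite natrX -exprD subnK.
have M0 : (0 < M)%N by rewrite expn_gt0.
have e1 : (i j %/ M)%:R * M%:R <= (i j)%:R :> R by rewrite -natrM ler_nat leq_divM.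
have e2 : (i j)%:R + 1 <= ((i j %/ M)%:R + 1) * M%:R :> R.
  by rewrite !natr1 -natrM ler_nat mulSnr {1}(divn_eq (i j) M) -addnS leq_add2l ltn_pmod.
have s0 := ell_gt0 T; move: (i j)%:R (i j %/ M)%:R M%:R (ell T) s0 e1 e2 (2 ^+ t) (x ord0 j).
move=> a b c s s0 e1 e2 p y /andP[y1 y2]; apply/andP; split.
  apply: le_trans y1; rewrite [c * s]mulrC -mulrA ler_pM2l//; lra.
apply: lt_le_trans y2 _; rewrite [c * s]mulrC -mulrA ler_pM2l//; lra.
Qed.

(** As integer identities these conditions show at once that distinct cells are disjoint;
    [same_cell] below has the same form. *)
Lemma cellP i x : cube T i x <->
  forall j, Num.floor (2 ^+ J * x ord0 j) = (i j)%:Z - (2 ^ T)%N%:Z.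
Proof.
rewrite cubeP subnn expn0 ell_T; under eq_forall do rewrite divn1.
have p0 : 0 < 2 ^+ J :> R by rewrite exprn_gt0.
have e j : ((i j)%:Z - (2 ^ T)%N%:Z)%:~R = (i j)%:R - 2 ^+ T :> R.
  by rewrite rmorphB /= -natrX.
split=> h j; have := h j.
  move=> hj; apply: floor_def; rewrite [X in _ < X]rmorphD /= e.
  move: hj; rewrite ler_pdivrMl// ltr_pdivlMl//.
  by rewrite [_ - _ + _]addrAC.
move=> hj; have := floor_itv (2 ^+ J * x ord0 j); rewrite hj [X in _ < X]rmorphD /= e.
rewrite ler_pdivrMl// ltr_pdivlMl//.
by rewrite [_ - _ + _]addrAC.
Qed.

Lemma cell_inj i i' x : cube T i x -> cube T i' x -> i = i'.
Proof.
move=> /cellP h /cellP h'; apply/ffunP => j; apply/val_inj.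
by have := h j; rewrite h' => /addIr [].
Qed.

Definition bigbox : set E := [set x | forall j, - 2 ^+ L <= x ord0 j < 2 ^+ L].

Lemma bigboxP x : bigbox x <-> exists i, cube T i x.
Proof.
have p0 : 0 < 2 ^+ J :> R by rewrite exprn_gt0.
split=> [h|[i /cellP h] j]; last first.
  have := floor_itv (2 ^+ J * x ord0 j); rewrite h [X in _ < X]rmorphD /= rmorphB /=.
  rewrite -!pmulrn natrX /T exprD; set a := (nat_of_ord _)%:R => /andP[h1 h2].
  have a0 : 0 <= a by rewrite ler0n.
  have a1 : a + 1 <= 2 ^+ J * 2 ^+ L * 2.
    rewrite -exprD -exprSr -[X in _ + X]/(1%:R) -natrD -natrX ler_nat addn1.
    exact: ltn_ord.
  apply/andP; split.
    by rewrite -(ler_pM2l p0); lra.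
  by rewrite -(ltr_pM2l p0); lra.
have lt j : exists o : 'I_(2 ^ T.+1),
    Num.floor (2 ^+ J * x ord0 j) + (2 ^ T)%N%:Z = (o : nat)%:Z.
  have := floor_itv (2 ^+ J * x ord0 j); set f := Num.floor _ => /andP[f1 f2].
  have /andP[h1 h2] := h j.
  have g1 : - 2 ^+ T < (f + 1)%:~R :> R.
    apply: le_lt_trans f2; rewrite /T exprD -mulrN ler_pM2l//.
  have g2 : f%:~R < 2 ^+ T :> R.
    by apply: (le_lt_trans f1); rewrite /T exprD ltr_pM2l.
  have eT : 2 ^+ T = ((2 ^ T)%N%:Z)%:~R :> R by rewrite -pmulrn natrX.
  move: g1 g2; rewrite eT -rmorphN /= !ltr_int => g1 g2.
  have z0 : 0 <= f + (2 ^ T)%N%:Z by lia.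
  have lt2 : (absz (f + (2 ^ T)%N%:Z)%R < 2 ^ T.+1)%N by rewrite expnS; lia.
  by exists (Ordinal lt2); rewrite /= gez0_abs.
have [g hg] := choice lt.
exists [ffun j => g j]; apply/cellP => j.
by rewrite ffunE -hg addrK.
Qed.

Lemma compact_closed_box (a b : 'I_d -> R) :
  compact [set y : E | forall j, `[a j, b j]%classic (y ord0 j)].
Proof. by apply: (@rV_compact R d (fun j => `[a j, b j]%classic)) => j; exact: segment_compact. Qed.

Lemma closed_closed_box (a b : 'I_d -> R) :
  closed [set y : E | forall j, `[a j, b j]%classic (y ord0 j)].
Proof.
by apply: compact_closed; [exact: norm_hausdorff | exact: compact_closed_box].
Qed.

Lemma cell_sub_box t i : (t <= T)%N -> cube T i `<=`
  [set y : E | forall j, `[ctr t i ord0 j - ell t / 2, ctr t i ord0 j + ell t / 2]%classic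
    (y ord0 j)].
Proof.
move=> tT y /(cell_sub tT)/cubeP h j; rewrite /= in_itv /=.
have := h j; rewrite /ctr /cube_center /corner !mxE -/(ell t).
rewrite rmorphB /= -natrX; set a := (_ %/ _)%:R => /andP[h1 h2]; apply/andP; split.
  by apply: le_trans h1; rewrite le_eqVlt; apply/orP; left; apply/eqP; field.
by apply: (le_trans (ltW h2)); rewrite le_eqVlt; apply/orP; left; apply/eqP; field.
Qed.

Lemma mu_cell i : mu (cube T i) = (ell T ^+ d)%:E.
Proof. exact: mu_dyadic_cube. Qed.

Lemma measurable_cube t i : measurable (cube t i).
Proof. exact: measurable_dyadic_cube. Qed.

Lemma ncell_ell t : (t <= T)%N -> (ncell d J L t)%:R * ell T ^+ d = ell t ^+ d.
Proof. by move=> tT; rewrite (ellE tT) exprMn /ncell natrX natrX. Qed.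

(** The closure is needed because the kernel formula holds off the support, which is closed. *)
Lemma cell_ctr t i x : (t <= T)%N -> closure (cube T i) x ->
  enorm (x - ctr t i) <= 2 ^+ d * (ell t / 2).
Proof.
move=> tT; have e0 := ell_gt0 t.
pose A := [set y : E | forall j, `[ctr t i ord0 j - ell t / 2, ctr t i ord0 j + ell t / 2]%classic (y ord0 j)].
have cA : closed A by exact: closed_closed_box.
have sA : cube T i `<=` A by exact: cell_sub_box.
rewrite closureE => /(_ A (conj cA sA)) Ax; apply: enorm_le; first by rewrite divr_ge0// ltW.
by move=> j; have := Ax j; rewrite /= in_itv /= !mxE ler_norml; lra.
Qed.

Lemma compact_cell i : compact (closure (cube T i)).
Proof.
apply: (subclosed_compact (@closed_closure _ _) (@compact_closed_box
  (fun j => ctr T i ord0 j - ell T / 2) (fun j => ctr T i ord0 j + ell T / 2))).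
rewrite closureE => x; apply; split; first exact: closed_closed_box.
exact: cell_sub_box.
Qed.

End dyadic_cells.

(** * The operator on dyadic step functions *)

Section Lp_closure.
Context (R : realType) (d : nat).
Local Notation E := 'rV[R]_d.
Local Notation C := R[i].
Local Notation mu := (lebesgue_rV R d).
Implicit Types (f g : E -> C).
Local Open Scope ereal_scope.

Lemma cabs2_ge0 (z : C) : 0 <= (cabs z ^+ 2)%:E.
Proof. by rewrite lee_fin sqr_ge0. Qed.

Lemma cabs2D_le (a b : C) : (cabs (a + b) ^+ 2 <= 2 * cabs a ^+ 2 + 2 * cabs b ^+ 2)%R.
Proof.
have h : (cabs (a + b) ^+ 2 <= (cabs a + cabs b) ^+ 2)%R.
  by rewrite ler_pXn2r ?nnegrE ?addr_ge0 ?cabs_ge0// cabsD.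
apply: (le_trans h); have := sqr_ge0 (cabs a - cabs b)%R; lra.
Qed.

Lemma Lp2_lin (a : C) f g : Lp 2%:E f -> Lp 2%:E g ->
  Lp 2%:E (fun x => a * f x + g x)%R.
Proof.
move=> /Lp2P[mf hf] /Lp2P[mg hg]; apply/Lp2P; split.
  by apply: cmeasurableD => //; exact: cmeasurableZ.
have m1 := measurable_cabs2E mf; have m2 := measurable_cabs2E mg.
apply: (@le_lt_trans _ _ (\int[mu]_x ((2 * cabs a ^+ 2)%:E * (cabs (f x) ^+ 2)%:E
    + 2%:E * (cabs (g x) ^+ 2)%:E))).
  apply: ge0_le_integral => //.
  - by move=> x _; exact: cabs2_ge0.
  - apply: measurable_cabs2E; apply: cmeasurableD => //; exact: cmeasurableZ.
  - by apply: emeasurable_funD; apply: measurable_funeM.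
  - move=> x _; rewrite -!EFinM -EFinD lee_fin.
    by apply: le_trans (cabs2D_le _ _) _; rewrite cabsM exprMn mulrA.
rewrite ge0_integralD//; first last.
- by apply: measurable_funeM.
- by move=> x _; rewrite mule_ge0 ?cabs2_ge0// lee_fin.
- by apply: measurable_funeM.
- by move=> x _; rewrite mule_ge0 ?cabs2_ge0// lee_fin mulr_ge0 ?sqr_ge0.
rewrite !ge0_integralZl_EFin ?mulr_ge0 ?sqr_ge0 ?cabs_ge0//; first last.
- by move=> x _; exact: cabs2_ge0.
- by move=> x _; exact: cabs2_ge0.
by rewrite lte_add_pinfty// lte_mul_pinfty// ?lee_fin ?mulr_ge0 ?sqr_ge0 ?cabs_ge0.
Qed.

Lemma Lp2_0 : Lp 2%:E (fun _ : E => 0 : C)%R.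
Proof.
apply/Lp2P; split; first exact: cmeasurable_cst.
by rewrite integral0_eq// => x _; rewrite cabs0 expr0n.
Qed.

Lemma Lp2_sum (I : Type) (s : seq I) (c : I -> C) (h : I -> E -> C) :
  (forall i, Lp 2%:E (h i)) -> Lp 2%:E (fun x => \sum_(i <- s) c i * h i x)%R.
Proof.
move=> hh; elim: s => [|i s IH].
  by under eq_fun do rewrite big_nil; exact: Lp2_0.
by under eq_fun do rewrite big_cons; exact: Lp2_lin.
Qed.

Definition cind (A : set E) : E -> C := fun x => ((\1_A x : R)%:C)%C.

Lemma cmeasurable_cind A : measurable A -> cmeasurable (cind A).
Proof.
move=> mA; split; first exact: measurable_indic.
exact: measurable_cst.
Qed.

Lemma cabs_cind A x : (cabs (cind A x) = \1_A x)%R.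
Proof. by rewrite /cind cabs_real ger0_norm// indicE. Qed.

Lemma cabs2_cind A x : (cabs (cind A x) ^+ 2 = \1_A x)%R.
Proof. by rewrite cabs_cind indicE; case: (_ \in _); rewrite ?expr1n ?expr0n. Qed.

Lemma Lp2_cind A : measurable A -> mu A < +oo -> Lp 2%:E (cind A).
Proof.
move=> mA Aoo; apply/Lp2P; split; first exact: cmeasurable_cind.
under eq_integral do rewrite cabs2_cind.
by rewrite integral_indic// setIT.
Qed.

Lemma supp_cind A : supp (cind A) = closure A.
Proof.
rewrite /supp; congr closure; apply/seteqP; split => x /=.
  rewrite /cind indicE; case: (boolP (x \in A)) => [|_]; first by rewrite inE.
  by rewrite eqxx.
by move=> Ax; rewrite /cind indicE mem_set// oner_eq0.
Qed.

End Lp_closure.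

Section operator.
Context (R : realType) (d : nat).
Local Notation E := 'rV[R]_d.
Local Notation C := R[i].
Local Notation mu := (lebesgue_rV R d).
Variables (k : E -> E -> C) (S : (E -> C) -> (E -> C)).
Hypothesis CZ : CZ_operator k S.
Implicit Types (f g : E -> C).

Lemma S_zero : {ae mu, forall x, S (fun=> 0) x = 0}.
Proof.
have z := Lp2_0 R d; have := CZ_linear CZ 1 z z.
apply: filterS => x; rewrite (_ : (fun y => _) = (fun=> 0)); last first.
  by apply/funext => y; rewrite mulr0 addr0.
by rewrite mul1r => /eqP; rewrite -subr_eq0 opprD addrA subrr sub0r oppr_eq0 => /eqP.
Qed.

Lemma S_sum (I : Type) (s : seq I) (c : I -> C) (h : I -> E -> C) :
  (forall i, Lp 2%:E (h i)) ->
  {ae mu, forall x, S (fun y => \sum_(i <- s) c i * h i y) x =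
    \sum_(i <- s) c i * S (h i) x}.
Proof.
move=> hh; elim: s => [|i s IH].
  under [X in S X]eq_fun do rewrite big_nil.
  by apply: filterS S_zero => x; rewrite big_nil.
under [X in S X]eq_fun do rewrite big_cons.
have := CZ_linear CZ (c i) (hh i) (Lp2_sum s c hh).
by apply: filterS2 IH => x e1 e2; rewrite e2 big_cons e1.
Qed.

Lemma S_sub f g : Lp 2%:E f -> Lp 2%:E g ->
  {ae mu, forall x, S (fun y => f y - g y) x = S f x - S g x}.
Proof.
move=> hf hg; have := CZ_linear CZ (-1) hg hf.
rewrite (_ : (fun y => -1 * g y + f y) = (fun y => f y - g y)); last first.
  by apply/funext => y; rewrite mulN1r addrC.
by apply: filterS => x ->; rewrite mulN1r addrC.
Qed.

Lemma opnorm_ge0 : 0 <= opnorm S.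
Proof.
apply: lb_le_inf; last by move=> M [].
have [M hM] := CZ_bounded CZ; exists (Num.max M 0); split.
  by rewrite le_max lexx orbT.
move=> f hf; apply: (le_trans (hM f hf)); apply: lee_wpmul2r; first exact: cLnorm_ge0.
by rewrite lee_fin le_max lexx.
Qed.

(** The [+ 1] leaves room for an admissible bound above the infimum [opnorm S]. *)
Lemma S_bounded f : Lp 2%:E f ->
  (\int[mu]_x (cabs (S f x) ^+ 2)%:E <=
   ((opnorm S + 1) ^+ 2)%:E * \int[mu]_x (cabs (f x) ^+ 2)%:E)%E.
Proof.
move=> hf; have [M [M0 hM] M1] : exists2 M : R, (0 <= M /\ forall f, Lp 2%:E f ->
    (cLnorm 2%:E (S f) <= M%:E * cLnorm 2%:E f)%E) & M < opnorm S + 1.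
  apply: inf_adherent => //; split; last by exists 0 => M [].
  have [M hM] := CZ_bounded CZ; exists (Num.max M 0); split.
    by rewrite le_max lexx orbT.
  move=> g hg; apply: (le_trans (hM g hg)); apply: lee_wpmul2r; first exact: cLnorm_ge0.
  by rewrite lee_fin le_max lexx.
apply: (le_trans (cLnorm2_le M0 (hM f hf))); apply: lee_wpmul2r.
  by apply: integral_ge0 => x _; exact: cabs2_ge0.
rewrite lee_fin; apply: lerXn2r; rewrite ?nnegrE ?addr_ge0 ?opnorm_ge0//.
exact: ltW.
Qed.

Section cells.
Variables (J L : nat).
Let T := (J + L)%N.
Local Notation idx := (idx d J L).
Local Notation cell := (@cube R d J L T).
Local Notation w := ((ell R L T) ^+ d).

Definition phi (i : idx) : E -> C := S (cind (cell i)).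

Let Lcell i : Lp 2%:E (cind (cell i)).
Proof. by apply: Lp2_cind; [exact: measurable_cube|rewrite mu_cell ltry]. Qed.

Lemma phi_cell i : phi i = S (cind (cell i)). Proof. by []. Qed.

Lemma cmeasurable_phi i : cmeasurable (phi i).
Proof. by have [] := CZ_L2 CZ (Lcell i). Qed.

Lemma w_gt0 : 0 < w. Proof. by rewrite exprn_gt0// ell_gt0. Qed.

Lemma sum_cind_in (V : lmodType C) (c : idx -> V) i x : cell i x ->
  \sum_j cind (cell j) x *: c j = c i.
Proof.
move=> ix; rewrite (bigD1 i)//= big1 => [|j ji].
  by rewrite addr0 /cind indicE mem_set// scale1r.
rewrite /cind indicE memNset ?scale0r// => jx.
by move: ji; rewrite (cell_inj jx ix) eqxx.
Qed.

Lemma sum_cind_out (V : lmodType C) (c : idx -> V) x : ~ (exists i, cell i x) ->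
  \sum_j cind (cell j) x *: c j = 0.
Proof.
move=> nx; rewrite big1// => j _; rewrite /cind indicE memNset ?scale0r// => jx.
by apply: nx; exists j.
Qed.

(** [h] is kept general so that one computation serves moduli, their squares and trace norms. *)
Lemma integral_step (V : lmodType C) (c : idx -> V) (h : V -> R) : h 0 = 0 ->
  (forall v, 0 <= h v) ->
  (\int[mu]_x (h (\sum_j cind (cell j) x *: c j))%:E = (w * \sum_i h (c i))%:E)%E.
Proof.
move=> h0 hge; transitivity (\int[mu]_x (\sum_i (h (c i))%:E * (\1_(cell i) x)%:E))%E.
  apply: eq_integral => x _; have [[i ix]|nx] := pselect (exists i, cell i x).
    rewrite (sum_cind_in _ ix) (bigD1 i)//= big1 => [|j ji].
      by rewrite adde0 indicE mem_set// mule1.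
    rewrite indicE memNset ?mule0// => jx.
    by move: ji; rewrite (cell_inj jx ix) eqxx.
  rewrite sum_cind_out// h0 big1// => j _.
  by rewrite indicE memNset ?mule0// => jx; apply: nx; exists j.
have mi i : measurable_fun setT (fun x => (\1_(cell i) x : R)%:E).
  by apply/measurable_EFinP; apply: measurable_indic; exact: measurable_cube.
rewrite ge0_integral_sum//.
- rewrite mulr_sumr -sumEFin; apply: eq_bigr => i _.
  rewrite ge0_integralZl_EFin//.
  rewrite integral_indic// ?setIT; last exact: measurable_cube.
  transitivity ((h (c i))%:E * w%:E)%E; last by rewrite -EFinM mulrC.
  by congr (_ * _)%E; exact: mu_cell.
- by move=> i; apply: measurable_funeM.
- by move=> i x _; rewrite mule_ge0// lee_fin ?indicE.
Qed.

Lemma S_step (c : idx -> C) :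
  {ae mu, forall x, S (fun y => \sum_i cind (cell i) y *: c i) x =
    \sum_i c i * phi i x}.
Proof.
have := S_sum (index_enum idx) c Lcell.
rewrite (_ : (fun y => \sum_i c i * _) = (fun y => \sum_i cind (cell i) y *: c i))//.
by apply/funext => y; apply: eq_bigr => i _; rewrite mulrC.
Qed.

Lemma S_step_bound (c : idx -> C) :
  (\int[mu]_x (cabs (\sum_i c i * phi i x) ^+ 2)%:E <=
   ((opnorm S + 1) ^+ 2 * (w * \sum_i cabs (c i) ^+ 2))%:E)%E.
Proof.
have hL : Lp 2%:E (fun y => \sum_i cind (cell i) y *: c i).
  have := Lp2_sum (index_enum idx) c Lcell.
  rewrite (_ : (fun y => \sum_i c i * _) = (fun y => \sum_i cind (cell i) y *: c i))//.
  by apply/funext => y; apply: eq_bigr => i _; rewrite mulrC.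
have := S_bounded hL.
rewrite (integral_step c (h := fun v => cabs v ^+ 2)); last 2 first.
- by rewrite cabs0 expr0n.
- by move=> v; exact: sqr_ge0.
rewrite -EFinM; apply: le_trans.
have [mS _] := CZ_L2 CZ hL.
apply: ae_ge0_le_integral => //.
- by move=> x _; exact: cabs2_ge0.
- apply: measurable_cabs2E; apply: cmeasurable_sum => i; apply: cmeasurableZ.
  exact: cmeasurable_phi.
- by move=> x _; exact: cabs2_ge0.
- exact: measurable_cabs2E.
by apply: filterS (S_step c) => x -> _.
Qed.

End cells.
End operator.

(** * The kernel estimate far from a cube *)

Section square_integral.
Context d (T : measurableType d) (R : realType) (mu : {measure set T -> \bar R}).

(** Cauchy-Schwarz on [K], from Young's inequality integrated with a free weight; an infinite
    right-hand side is allowed. *)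
Lemma sqr_Rintegral_le (K : set T) (w : R) (g : T -> R) :
  measurable K -> mu K = w%:E -> 0 < w ->
  mu.-integrable setT (EFin \o g) -> (forall x, ~ K x -> g x = 0) ->
  (((\int[mu]_x g x) ^+ 2)%:E <= w%:E * \int[mu]_x (g x ^+ 2)%:E)%E.
Proof.
move=> mK muK w0 ig g0.
have mg : measurable_fun setT g by have /integrableP[/measurable_EFinP] := ig.
have mg2 : measurable_fun setT (fun x => (g x ^+ 2)%:E).
  by apply/measurable_EFinP; exact: measurable_funX.
have g20 x : setT x -> (0 <= (g x ^+ 2)%:E)%E by rewrite lee_fin sqr_ge0.
have := integral_ge0 mu g20; case B : (\int[mu]_x (g x ^+ 2)%:E)%E => [b||] // b0; last first.
  by rewrite gt0_muley ?leey// lte_fin.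
have [a aE] : exists a : R, (\int[mu]_x `|g x|%:E)%E = a%:E.
  have : (\int[mu]_x `|(EFin \o g) x| < +oo)%E by have /integrableP[] := ig.
  have : (0 <= \int[mu]_x `|(EFin \o g) x|)%E by exact: integral_ge0.
  by move=> /ge0_fin_numE <- /fineK <-; eexists.
have a0 : 0 <= a by rewrite -lee_fin -aE integral_ge0// => x _; rewrite lee_fin.
have ub t : 0 < t -> a <= (t * w + t^-1 * b) / 2.
  move=> t0; rewrite -lee_fin -aE.
  apply: (@le_trans _ _ (\int[mu]_x ((t / 2)%:E * (\1_K x)%:E + (t^-1 / 2)%:E * (g x ^+ 2)%:E))%E).
    apply: ge0_le_integral => //.
    - by apply/measurable_EFinP; exact: measurableT_comp.
    - apply: emeasurable_funD; apply: measurable_funeM => //.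
      by apply/measurable_EFinP; exact: measurable_indic.
    move=> x _; rewrite -!EFinM -EFinD lee_fin indicE.
    case: (boolP (x \in K)) => [_|]; last first.
      by rewrite notin_setE => /g0 ->; rewrite normr0 expr0n /= !mulr0 addr0.
    rewrite mulr1 -(ler_pM2l t0) mulrDr !mulrA mulfV ?gt_eqF// mul1r.
    have := real_normK (num_real (g x)); have := sqr_ge0 (t - `|g x|).
    by set y := `|g x|; lra.
  rewrite ge0_integralD//; first last.
  - exact: measurable_funeM.
  - by move=> x _; rewrite mule_ge0 ?g20// lee_fin mulr_ge0 ?invr_ge0 ?ltW.
  - by apply: measurable_funeM; apply/measurable_EFinP; exact: measurable_indic.
  - by move=> x _; apply: mule_ge0; rewrite lee_fin ?indicE// divr_ge0// ltW.
  rewrite !ge0_integralZl_EFin//; first last.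
  - by rewrite divr_ge0// ltW.
  - by apply/measurable_EFinP; exact: measurable_indic.
  - by rewrite mulr_ge0 ?invr_ge0 ?ltW.
  rewrite integral_indic// setIT muK B -!EFinM -EFinD lee_fin.
  by rewrite le_eqVlt; apply/orP; left; apply/eqP; field; rewrite gt_eqF.
have ga : (\int[mu]_x g x) ^+ 2 <= a ^+ 2.
  rewrite -real_normK ?num_real//; apply: lerXn2r; rewrite ?nnegrE//.
  have := le_normr_Rintegral (@measurableT _ T) ig.
  by rewrite /Rintegral aE.
rewrite -EFinM lee_fin; apply: (le_trans ga).
have b1 : 0 <= b by rewrite -lee_fin.
have wb : 0 <= w * b by exact: mulr_ge0 (ltW w0) b1.
have [a00|an0] := eqVneq a 0; first by rewrite a00 expr0n.
have ap : 0 < a by rewrite lt_neqAle eq_sym an0.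
(* The weight [a / w] gives [a <= (a + w * b / a) / 2]. *)
have := ub _ (divr_gt0 ap w0); rewrite invf_div divfK ?gt_eqF// => h.
have : a <= w / a * b by lra.
by rewrite mulrAC ler_pdivlMr// expr2.
Qed.

End square_integral.

Section hormander_estimate.
Context (R : realType) (d : nat).
Local Notation E := 'rV[R]_d.
Local Notation C := R[i].
Local Notation mu := (lebesgue_rV R d).
Variables (k : E -> E -> C) (S : (E -> C) -> (E -> C)).
Hypothesis CZ : CZ_operator k S.
Hypothesis d0 : (0 < d)%N.
Hypothesis hk : (hormander k < +oo)%E.
Variables (J L : nat).
Let T := (J + L)%N.
Local Notation idx := (idx d J L).
Local Notation cell := (@cube R d J L T).
Local Notation w := ((ell R L T) ^+ d).
Local Notation phi := (@phi R d S J L).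
Local Notation ctr := (@ctr R d J L).
Local Notation ell := (@ell R L).

Definition ann (t : nat) (i : idx) (n : nat) : set E :=
  annulus (ctr t i) (2 ^+ n * ell t) (2 ^+ n.+1 * ell t).

(** The summand of index [n] in [hormander k] for the cube [cube t i]. *)
Definition hsup (t : nat) (i : idx) (n : nat) : \bar R :=
  ereal_sup [set (((2 ^+ (n * d) * ell t ^+ d)%R%:E *
    \int[mu]_(x in ann t i n) ((cabs (k x y - k x (ctr t i))) ^+ 2)%:E) `^ 2^-1)%E
    | y in cube t i].

Lemma ann_anc t i n : ann t (anc t i) n = ann t i n.
Proof. by rewrite /ann ctr_anc. Qed.

Lemma hsup_anc t i n : hsup t (anc t i) n = hsup t i n.
Proof. by rewrite /hsup ann_anc ctr_anc cube_anc. Qed.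

Lemma hsup_sum t i : (\sum_(1 <= n <oo) hsup t i n <= hormander k)%E.
Proof.
apply: ereal_sup_ubound; exists (gen L t, corner t i) => //.
Qed.

(** The supremum of an empty set would be [-oo]; the lower corner of the cube shows that there is a
    point to test. *)
Lemma hsup_ge0 t i n : (0 <= hsup t i n)%E.
Proof.
have h0 : cube t i (\row_j (ell t * (corner t i ord0 j)%:~R) : E).
  rewrite /cube /dyadic_cube /= => j; rewrite mxE lexx /= ltr_pM2l ?ell_gt0// ltr_int.
  by rewrite ltrDl.
move: h0; set y := (\row_j _ : E) => h0.
apply: le_trans (ereal_sup_ubound _); last by exists y; [exact: h0|].
exact: poweR_ge0.
Qed.

Lemma hsup_fin t i n : (0 < n)%N -> hsup t i n \is a fin_num.
Proof.
move=> n0; rewrite ge0_fin_numE ?hsup_ge0//.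
apply: le_lt_trans hk; apply: le_trans (hsup_sum t i).
apply: le_trans (nneseries_lim_ge n.+1 _); last by move=> m _ _; exact: hsup_ge0.
rewrite (bigD1_seq n) /= ?mem_index_iota ?iota_uniq ?n0 ?ltnS ?leqnn//.
by rewrite leeDl// sume_ge0// => m _; exact: hsup_ge0.
Qed.

Lemma hsup_integral_le t i n y : (0 < n)%N -> cube t i y ->
  (\int[mu]_(x in ann t i n) ((cabs (k x y - k x (ctr t i))) ^+ 2)%:E <=
   (fine (hsup t i n) ^+ 2 / (2 ^+ (n * d) * ell t ^+ d))%:E)%E.
Proof.
move=> n0 yQ; set I := (\int[mu]_(x in _) _)%E; set a := 2 ^+ (n * d) * ell t ^+ d.
have a0 : 0 < a by rewrite mulr_gt0// ?exprn_gt0 ?ell_gt0.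
have I0 : (0 <= I)%E by apply: integral_ge0 => x _; exact: cabs2_ge0.
have h : ((a%:E * I) `^ 2^-1 <= (fine (hsup t i n))%:E)%E.
  by rewrite fineK ?hsup_fin//; apply: ereal_sup_ubound; exists y.
move: h I0; case: I => [b||] //; last first.
  by rewrite gt0_muley ?lte_fin// poweRyr ?invr_eq0 ?pnatr_eq0.
rewrite -EFinM poweR_EFin !lee_fin => h b0.
have ab0 : 0 <= a * b by rewrite mulr_ge0// ltW.
rewrite ler_pdivlMr// mulrC.
rewrite powR12_sqrt// in h; rewrite -(sqr_sqrtr ab0).
by apply: lerXn2r => //; rewrite ?nnegrE ?sqrtr_ge0// fine_ge0// hsup_ge0.
Qed.

Definition offdiag : set (E * E) := [set xy | xy.1 != xy.2].

Lemma measurable_offdiag : measurable offdiag.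
Proof.
rewrite (_ : offdiag = \bigcup_(j in [set: 'I_d])
   [set xy : E * E | xy.1 ord0 j != xy.2 ord0 j]); last first.
  apply/seteqP; split => -[x y] /=; last by case=> j _ /=; apply: contra => /eqP /= ->.
  rewrite /offdiag /= => xy; apply: contrapT => h; move: xy => /negP; apply.
  apply/eqP/rowP => j; apply/eqP/negPn/negP => xyj; apply: h; exists j => //.
apply: fin_bigcup_measurable => // j _.
pose f := fun xy : E * E => xy.1 ord0 j - xy.2 ord0 j.
rewrite (_ : [set xy : E * E | _] = setT `&` f @^-1` (~` [set 0])).
  have mf : measurable_fun setT f.
    apply: measurable_funB.
      exact: (measurableT_comp (measurable_coord j) measurable_fst).
    exact: (measurableT_comp (measurable_coord j) measurable_snd).
  by apply: mf => //; apply: measurableC; exact: measurable_set1.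
apply/seteqP; split => -[x y] /=; rewrite /f /=.
  by move=> h; split => // /eqP; rewrite subr_eq0 (negbTE h).
by move=> [_ h]; apply/negP => /eqP e; apply: h; rewrite e subrr.
Qed.

Section cell_estimate.
Variables (t : nat) (i : idx) (n : nat).
Hypotheses (tT : (t <= T)%N) (dn : (d <= n)%N).
Let A := ann t i n.
Let c := ctr t i.
Let n0 : (0 < n)%N := leq_trans d0 dn.

Let mA : measurable A. Proof. exact: measurable_annulus. Qed.
Let mK : measurable (cell i). Proof. exact: measurable_cube. Qed.

(** Here [d <= n] enters: the annulus begins beyond the radius given by [cell_ctr], so it misses the
    closure of the cell and also the center. *)
Let A_far x : A x -> 2 ^+ d * (ell t / 2) < enorm (x - c).
Proof.
move=> /andP[h _]; apply: lt_le_trans h.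
have l0 := ell_gt0 R L t.
apply: (@lt_le_trans _ _ (2 ^+ d * ell t)).
  by rewrite ltr_pM2l ?exprn_gt0// ltr_pdivrMr// ltr_pMr// ltr1n.
by rewrite ler_pM2r// ler_eXn2l// ltr1n.
Qed.

Let A_neq_c x : A x -> x != c.
Proof.
move=> /A_far; apply: contraTN => /eqP ->; rewrite subrr -leNgt.
apply: (@le_trans _ _ 0); last by rewrite mulr_ge0 ?exprn_ge0// divr_ge0// ltW// ell_gt0.
by rewrite /enorm big1 ?sqrtr0// => j _; rewrite mxE expr0n.
Qed.

Let A_closure x : A x -> ~ closure (cell i) x.
Proof. by move=> /A_far h /(cell_ctr tT); rewrite leNgt h. Qed.

Let A_neq_cell x y : A x -> cell i y -> x != y.
Proof.
move=> Ax iy; apply/negP => /eqP xy.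
by apply: (A_closure Ax); apply: subset_closure; rewrite xy.
Qed.

Let G (xy : E * E) : \bar R := (cabs (k xy.1 xy.2 - k xy.1 c) ^+ 2)%:E.
Let H := G \_ (A `*` cell i).

Let H_ge0 xy : (0 <= H xy)%E.
Proof. by rewrite /H /patch; case: ifP => // _; exact: cabs2_ge0. Qed.

Let mH : measurable_fun setT H.
Proof.
have mP : measurable (A `*` cell i) by exact: measurableX.
apply/(measurable_restrictT _ mP) => //.
have sub1 : A `*` cell i `<=` offdiag by move=> [x y] /= [Ax iy]; exact: A_neq_cell.
have mRe := measurable_funS measurable_offdiag sub1 (CZ_kernel_Re CZ).
have mIm := measurable_funS measurable_offdiag sub1 (CZ_kernel_Im CZ).
have mc : measurable_fun (A `*` cell i) (fun xy : E * E => (xy.1, c)).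
  by apply: measurable_funTS; apply: measurable_fun_pair => //; exact: measurable_fst.
have sub2 : (fun xy : E * E => (xy.1, c)) @` (A `*` cell i) `<=` offdiag.
  by move=> _ /= [[x y] /= [Ax iy] <-]; exact: A_neq_c.
have mRec := measurable_comp measurable_offdiag sub2 (CZ_kernel_Re CZ) mc.
have mImc := measurable_comp measurable_offdiag sub2 (CZ_kernel_Im CZ) mc.
apply/measurable_EFinP; under eq_fun do rewrite cabs_sq cReB cImB.
by apply: measurable_funD; apply: measurable_funX; exact: measurable_funB.
Qed.

Let wE : mu (cell i) = w%:E := mu_cell R i.

(** Off the closure of the cell the kernel formula represents [phi i x], and subtracting [w * k x c]
    subtracts [k x c] under the integral over the cell. Cauchy-Schwarz is applied to the real and
    imaginary parts separately. *)
Let pointwise : {ae mu, forall x, A x ->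
  ((cabs (phi i x - w%:C%C * k x c) ^+ 2)%:E <= w%:E * \int[mu]_y H (x, y))%E}.
Proof.
have w0 := w_gt0 R d J L.
have Lc : Lp 2%:E (@cind R d (cell i)).
  by apply: Lp2_cind => //; rewrite wE ltry.
have := CZ_kernel CZ Lc; rewrite supp_cind => /(_ (@compact_cell R d J L i)).
apply: filterS => x h Ax; have [/Lp1P[[mr mi] foo] phiE] := h (A_closure Ax).
set f := (fun y => k x y * cind (cell i) y) in mr mi foo phiE.
have fE y : f y = if y \in cell i then k x y else 0.
  by rewrite /f /cind indicE; case: (y \in _); rewrite ?mulr1 ?mulr0.
have iRe : mu.-integrable setT (EFin \o (fun y => complex.Re (f y))).
  apply/integrableP; split; first exact/measurable_EFinP.
  apply: le_lt_trans foo; apply: ge0_le_integral => //.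
  - by apply/measurable_EFinP; exact: measurableT_comp.
  - exact: measurable_cabsE.
  - by move=> y _; rewrite /= lee_fin cabs_Re.
have iIm : mu.-integrable setT (EFin \o (fun y => complex.Im (f y))).
  apply/integrableP; split; first exact/measurable_EFinP.
  apply: le_lt_trans foo; apply: ge0_le_integral => //.
  - by apply/measurable_EFinP; exact: measurableT_comp.
  - exact: measurable_cabsE.
  - by move=> y _; rewrite /= lee_fin cabs_Im.
have iI : mu.-integrable setT (EFin \o (\1_(cell i) : E -> R)).
  apply/integrableP; split.
    by apply/measurable_EFinP; exact: measurable_indic.
  rewrite (eq_integral (fun y => (\1_(cell i) y : R)%:E)); last first.
    by move=> y _ /=; rewrite ger0_norm ?indicE.
  by rewrite integral_indic// setIT [X in (X < _)%E]wE ltry.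
have iK (a : R) : mu.-integrable setT (EFin \o (fun y => a * \1_(cell i) y)).
  exact: (@integrableZl _ _ _ mu setT measurableT a (EFin \o \1_(cell i))).
have intK (a : R) : \int[mu]_y (a * \1_(cell i) y) = a * w.
  rewrite /Rintegral; under eq_integral do rewrite EFinM.
  rewrite integralZl//.
  by rewrite integral_indic// setIT [X in (_ * X)%E]wE.
pose gr := fun y => complex.Re (f y) - complex.Re (k x c) * \1_(cell i) y.
pose gi := fun y => complex.Im (f y) - complex.Im (k x c) * \1_(cell i) y.
have igr : mu.-integrable setT (EFin \o gr) by exact: integrableB (iRe) (iK _).
have igi : mu.-integrable setT (EFin \o gi) by exact: integrableB (iIm) (iK _).
have gr0 y : ~ cell i y -> gr y = 0.
  by move=> ny; rewrite /gr fE indicE memNset//= mulr0 subr0.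
have gi0 y : ~ cell i y -> gi y = 0.
  by move=> ny; rewrite /gi fE indicE memNset//= mulr0 subr0.
have e1 := sqr_Rintegral_le mK wE w0 igr gr0.
have e2 := sqr_Rintegral_le mK wE w0 igi gi0.
have -> : cabs (phi i x - w%:C%C * k x c) ^+ 2 =
    (\int[mu]_y gr y) ^+ 2 + (\int[mu]_y gi y) ^+ 2.
  rewrite cabs_sq cReB cImB cReZ cImZ phi_cell phiE /cintegral /=.
  rewrite /gr /gi !RintegralB//; try exact: iK.
  by rewrite !intK ![w * _]mulrC.
rewrite EFinD; apply: (le_trans (leeD e1 e2)).
rewrite -ge0_muleDr; last 2 first.
- by apply: integral_ge0 => y _; rewrite lee_fin sqr_ge0.
- by apply: integral_ge0 => y _; rewrite lee_fin sqr_ge0.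
apply: lee_wpmul2l; first by rewrite lee_fin ltW.
rewrite -ge0_integralD//; first last.
- apply/measurable_EFinP; apply: measurable_funX.
  by have /integrableP[/measurable_EFinP] := igi.
- by move=> y _; rewrite lee_fin sqr_ge0.
- apply/measurable_EFinP; apply: measurable_funX.
  by have /integrableP[/measurable_EFinP] := igr.
- by move=> y _; rewrite lee_fin sqr_ge0.
rewrite le_eqVlt; apply/orP; left; apply/eqP; apply: eq_integral => y _.
rewrite /H /patch; case: ifPn => [|].
  rewrite inE /= => -[_ iy]; rewrite -EFinD /G /=; congr EFin.
  by rewrite cabs_sq /gr /gi fE indicE mem_set// !mulr1 cReB cImB.
rewrite notin_setE /= => h'.
have ny : ~ cell i y by move=> iy; apply: h'.
by rewrite gr0// gi0// expr0n /= adde0.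
Qed.

(** Tonelli exchanges the integrals; for each [y] in the cell, hence in the larger cube, the
    integral over the annulus is bounded through [hsup]. One factor [w] is the Cauchy-Schwarz
    constant, the other the measure of the cell. *)
Lemma cell_estimate :
  (\int[mu]_(x in ann t i n) (cabs (phi i x - w%:C%C * k x (ctr t i)) ^+ 2)%:E <=
   (w ^+ 2 * (fine (hsup t i n) ^+ 2 / (2 ^+ (n * d) * ell t ^+ d)))%:E)%E.
Proof.
have w0 := w_gt0 R d J L.
have mH1 : measurable_fun setT (fun x => \int[mu]_y H (x, y))%E.
  exact: (@measurable_fun_fubini_tonelli_F _ _ _ _ _ mu H mH H_ge0).
set B := fine _ ^+ 2 / _.
have B0 : 0 <= B.
  by rewrite divr_ge0 ?sqr_ge0// mulr_ge0 ?exprn_ge0// ltW// ell_gt0.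
apply: (@le_trans _ _ (\int[mu]_x (w%:E * \int[mu]_y H (x, y)))%E).
  rewrite integral_mkcond; apply: nonmeasurable_ge0_integral_le.
  - by move=> x; rewrite /patch; case: ifP => // _; exact: cabs2_ge0.
  - move=> x; apply: mule_ge0; first by rewrite lee_fin ltW.
    exact: integral_ge0.
  - exact: measurable_funeM.
  apply: filterS pointwise => x hx; rewrite /patch; case: ifPn => [|_].
    by rewrite inE => /hx.
  apply: mule_ge0; first by rewrite lee_fin ltW.
  exact: integral_ge0.
rewrite ge0_integralZl_EFin//; last 2 first.
- by move=> x _; exact: integral_ge0.
- exact: ltW.
rewrite expr2 -mulrA EFinM; apply: lee_wpmul2l; first by rewrite lee_fin ltW.
rewrite (@fubini_tonelli _ _ _ _ _ mu mu H mH H_ge0).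
apply: (@le_trans _ _ (\int[mu]_y (B%:E * (\1_(cell i) y)%:E))%E).
  apply: ge0_le_integral => //.
  - by move=> y _; exact: integral_ge0.
  - exact: (@measurable_fun_fubini_tonelli_G _ _ _ _ _ mu H mH H_ge0).
  - by apply: measurable_funeM; apply/measurable_EFinP; exact: measurable_indic.
  move=> y _; rewrite indicE; case: (boolP (y \in cell i)) => [|]; last first.
    rewrite notin_setE => ny; rewrite mule0 integral0_eq// => x _.
    by rewrite /H /patch memNset// => -[_].
  rewrite inE => iy; rewrite mule1.
  apply: le_trans (hsup_integral_le n0 (cell_sub tT iy)).
  rewrite [leRHS]integral_mkcond le_eqVlt; apply/orP; left; apply/eqP.
  apply: eq_integral => x _; rewrite /H /patch.
  case: (boolP (x \in ann t i n)) => [|]; last first.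
    by rewrite notin_setE => nx; rewrite memNset// => -[].
  by rewrite inE => Ax; rewrite mem_set.
rewrite ge0_integralZl_EFin//; last first.
- by apply/measurable_EFinP; exact: measurable_indic.
by rewrite integral_indic// setIT [X in (_ * X)%E]wE -EFinM mulrC.
Qed.

End cell_estimate.
End hormander_estimate.

(** * Summation over the annuli around one cube *)

Section far_part.
Context (R : realType) (d : nat).
Local Notation E := 'rV[R]_d.
Local Notation C := R[i].
Local Notation mu := (lebesgue_rV R d).
Variables (k : E -> E -> C) (S : (E -> C) -> (E -> C)).
Hypothesis CZ : CZ_operator k S.
Hypothesis d0 : (0 < d)%N.
Hypothesis hk : (hormander k < +oo)%E.
Variables (J L : nat).
Let T := (J + L)%N.
Local Notation idx := (idx d J L).
Local Notation w := ((ell R L T) ^+ d).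
Local Notation phi := (@phi R d S J L).
Local Notation ctr := (@ctr R d J L).
Local Notation ell := (@ell R L).
Local Notation anc := (@anc d J L).
Local Notation ann := (@ann R d J L).
Local Notation hsup := (@hsup R d k J L).

Lemma ann_neq_ctr t i n x : ann t i n x -> x != ctr t i.
Proof.
move=> /andP[h _]; apply: contraTN h => /eqP ->; rewrite subrr -ltNge.
rewrite (_ : enorm 0 = 0) ?mulr_gt0 ?exprn_gt0 ?ell_gt0//.
by rewrite /enorm big1 ?sqrtr0// => j _; rewrite mxE expr0n.
Qed.

Definition psi t i x : C := phi i x - w%:C%C * k x (ctr t (anc t i)).

Lemma measurable_psi t i n :
  measurable_fun (ann t i n) (fun x => cabs (psi t i x) ^+ 2).
Proof.
have mA : measurable (ann t i n) by exact: measurable_annulus.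
have mc : measurable_fun (ann t i n) (fun x : E => (x, ctr t (anc t i))).
  by apply: measurable_funTS; apply: measurable_fun_pair.
have sub : (fun x : E => (x, ctr t (anc t i))) @` ann t i n `<=` @offdiag R d.
  by move=> _ /= [x Ax <-]; rewrite /offdiag /= ctr_anc; exact: ann_neq_ctr Ax.
have mRe := measurable_comp (@measurable_offdiag R d) sub (CZ_kernel_Re CZ) mc.
have mIm := measurable_comp (@measurable_offdiag R d) sub (CZ_kernel_Im CZ) mc.
have [pr pi] := cmeasurable_phi CZ i.
have {}pr := measurable_funTS pr; have {}pi := measurable_funTS pi.
rewrite /psi; under eq_fun do rewrite cabs_sq cReB cImB cReZ cImZ.
apply: measurable_funD; apply: measurable_funX; apply: measurable_funB => //;
  exact: measurable_funM.
Qed.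

Variables (t : nat) (a : idx) (r lam : R) (s : idx -> R).
Hypotheses (tT : (t <= T)%N) (r0 : 0 <= r) (lam0 : 0 < lam).
Hypothesis (s0 : forall i, 0 <= s i).

Let h n := fine (hsup t a (n + d)).
Let eps n := ((2 ^ n.+1)%:R)^-1 : R.

(* The weight balances the two terms of [farterm] on the annulus of index n + d.
   The summand [eps n] keeps it positive when [h n] vanishes, at the cost of the
   convergent series of the [eps n]. *)
Definition ftau n := lam * (h n + eps n) / 2 ^+ ((n + d) * d).

Let h0 n : 0 <= h n. Proof. by rewrite fine_ge0// hsup_ge0. Qed.
Let eps0 n : 0 < eps n. Proof. by rewrite invr_gt0 ltr0n expn_gt0. Qed.

Lemma ftau_gt0 n : 0 < ftau n.
Proof. by rewrite divr_gt0 ?exprn_gt0// mulr_gt0// ltr_wpDl. Qed.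

(** The far summand of [nsv_pointwise] as a function of the point, with [r] for the rank of the
    projection and [s] for the two traces. *)
Definition farterm n x : R := 4 / lam * ftau n * r + 2 / lam * (ftau n)^-1 *
  ((ncell d J L t)%:R * ((2 ^ d)%:R * lam) *
   \sum_(i | anc t i == a) cabs (psi t i x) ^+ 2 * s i).

(* The annuli of index at least d cover the complement of the near region. *)
Definition far x : \bar R :=
  (\sum_(n <oo) ((fun x => (farterm n x)%:E) \_ (ann t a (n + d))) x)%E.

Lemma farterm_ge0 n x : 0 <= farterm n x.
Proof.
have t0 := ltW (ftau_gt0 n); have l0 := ltW lam0.
rewrite /farterm; move: (ftau n) t0 => tau t0.
apply: addr_ge0; first by rewrite !mulr_ge0 ?invr_ge0.
rewrite mulr_ge0 ?mulr_ge0 ?invr_ge0// sumr_ge0// => i _.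
by rewrite mulr_ge0 ?sqr_ge0.
Qed.

Lemma measurable_farterm n :
  measurable_fun (ann t a (n + d)) (fun x => (farterm n x)%:E).
Proof.
apply/measurable_EFinP; apply: measurable_funD => //.
apply: measurable_funM => //; apply: measurable_funM => //.
under eq_fun do rewrite -big_filter.
have : forall i, i \in [seq i <- index_enum idx | anc t i == a] ->
    measurable_fun (ann t a (n + d)) (fun x => cabs (psi t i x) ^+ 2 * s i).
  move=> i; rewrite mem_filter => /andP[/eqP <- _]; rewrite ann_anc.
  by apply: measurable_funM => //; exact: measurable_psi.
elim: [seq _ <- _ | _] => [|i q IH] hq.
  rewrite (_ : (fun x => _) = cst 0); first exact: measurable_cst.
  by apply/funext => x; rewrite big_nil.
rewrite (_ : (fun x => _) = (fun x => cabs (psi t i x) ^+ 2 * s i +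
    \sum_(j <- q) cabs (psi t j x) ^+ 2 * s j)); last first.
  by apply/funext => x; rewrite big_cons.
apply: measurable_funD.
  by apply: hq; rewrite mem_head.
by apply: IH => j jq; apply: hq; rewrite in_cons jq orbT.
Qed.

Let alpha : R := 4 * 8 ^+ d * ell t ^+ d * r.
Let beta : R := 2 * (2 ^ d)%:R * w / lam * \sum_(i | anc t i == a) s i.

Let alpha0 : 0 <= alpha.
Proof. by rewrite !mulr_ge0 ?exprn_ge0 ?(ltW (ell_gt0 _ _ _)). Qed.

Let beta0 : 0 <= beta.
Proof.
rewrite !mulr_ge0 ?exprn_ge0 ?(ltW (ell_gt0 _ _ _)) ?invr_ge0 ?(ltW lam0)//.
exact: sumr_ge0.
Qed.

Lemma mu_ann n : (mu (ann t a (n + d)) <= (8 ^+ d * 2 ^+ ((n + d) * d) * ell t ^+ d)%:E)%E.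
Proof.
rewrite (_ : 8 ^+ d * _ * _ = (4 * (2 ^+ (n + d).+1 * ell t)) ^+ d).
  apply: (@mu_ball_le _ _ (ctr t a)); first by rewrite mulr_gt0 ?exprn_gt0 ?ell_gt0.
    exact: measurable_annulus.
  by move=> x /andP[].
by rewrite exprS !mulrA -[4 * 2]natrM !exprMn -exprM.
Qed.

(** With the weight [ftau n] the volume factors cancel: the rank term becomes a multiple of
    [h n + eps n], and the Hilbert-Schmidt term a multiple of [h n ^+ 2 / (h n + eps n)], which is
    at most [h n]. The multiples are [alpha] and [beta]. *)
Lemma far_term_integral n :
  (\int[mu]_(x in ann t a (n + d)) (farterm n x)%:E <=
   alpha%:E * (h n + eps n)%:E + beta%:E * (h n)%:E)%E.
Proof.
have t0 := ftau_gt0 n; have l0 := ell_gt0 R L t; have w0 := w_gt0 R d J L.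
have mA : measurable (ann t a (n + d)) by exact: measurable_annulus.
have nc0 : 0 < (ncell d J L t)%:R :> R by rewrite ltr0n ncell_gt0.
set c := (ncell d J L t)%:R * ((2 ^ d)%:R * lam).
have c0 : 0 <= c by rewrite !mulr_ge0 ?ltW.
pose b := 2 / lam * (ftau n)^-1 * c.
have b0 : 0 <= b by rewrite !mulr_ge0 ?invr_ge0 ?(ltW t0) ?(ltW lam0).
pose q := [seq i <- index_enum idx | anc t i == a].
have fE x : (farterm n x)%:E = ((4 / lam * ftau n * r)%:E +
    \sum_(i <- q) (b * s i)%:E * (cabs (psi t i x) ^+ 2)%:E)%E.
  rewrite /farterm -/c -big_filter -/q /b; move: (ftau n) => tau.
  rewrite EFinD mulr_sumr mulr_sumr -sumEFin; congr (_ + _)%E.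
  by apply: eq_bigr => i _; rewrite -EFinM; congr EFin; ring.
under eq_integral do rewrite fE.
have mp i : anc t i == a ->
    measurable_fun (ann t a (n + d)) (fun x => (b * s i)%:E * (cabs (psi t i x) ^+ 2)%:E)%E.
  move=> /eqP <-; rewrite ann_anc; apply: measurable_funeM.
  by apply/measurable_EFinP; exact: measurable_psi.
have p0 i x : (0 <= (b * s i)%:E * (cabs (psi t i x) ^+ 2)%:E)%E.
  by apply: mule_ge0; rewrite lee_fin ?sqr_ge0//; exact: mulr_ge0 b0 (s0 i).
have al0 : 0 <= 4 / lam * ftau n * r.
  exact: mulr_ge0 (mulr_ge0 (divr_ge0 (ler0n _ 4) (ltW lam0)) (ltW t0)) r0.
have [mS hS] : measurable_fun (ann t a (n + d))
      (fun x => \sum_(i <- q) (b * s i)%:E * (cabs (psi t i x) ^+ 2)%:E)%E /\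
    (\int[mu]_(x in ann t a (n + d))
      (\sum_(i <- q) (b * s i)%:E * (cabs (psi t i x) ^+ 2)%:E) =
     \sum_(i <- q) \int[mu]_(x in ann t a (n + d))
       ((b * s i)%:E * (cabs (psi t i x) ^+ 2)%:E))%E.
  have : forall i, i \in q -> anc t i == a.
    by move=> i; rewrite mem_filter => /andP[].
  elim: (q) => [|i q' IH] hq.
    under eq_fun do rewrite big_nil; split => //.
    by rewrite integral0 big_nil.
  have [|m1 e1] := IH; first by move=> j jq; apply: hq; rewrite in_cons jq orbT.
  have m2 := mp i (hq i (mem_head _ _)); split.
    by under eq_fun do rewrite big_cons; exact: emeasurable_funD.
  rewrite big_cons -e1 -ge0_integralD//; last by move=> x _; exact: sume_ge0.
  by apply: eq_integral => x _; rewrite big_cons.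
rewrite ge0_integralD//; last by move=> x _; exact: sume_ge0.
rewrite hS integral_cst//; apply: leeD.
  apply: (le_trans (lee_wpmul2l _ (mu_ann n))); first by rewrite lee_fin.
  rewrite -EFinM lee_fin /alpha /ftau le_eqVlt; apply/orP; left; apply/eqP.
  by field; rewrite ?gt_eqF ?exprn_gt0.
have -> : (beta%:E * (h n)%:E = \sum_(i <- q) (2 * (2 ^ d)%:R * w / lam * s i * h n)%:E)%E.
  by rewrite -EFinM /beta mulr_sumr mulr_suml -big_filter sumEFin.
rewrite big_seq [leRHS]big_seq; apply: lee_sum => i.
rewrite mem_filter => /andP[ia _]; have ea := eqP ia.
rewrite ge0_integralZl_EFin//; first last.
- by rewrite mulr_ge0.
- apply/measurable_EFinP; rewrite -ea ann_anc; exact: measurable_psi.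
- by move=> x _; exact: cabs2_ge0.
have := cell_estimate CZ d0 hk i tT (leq_addl n d).
rewrite -(ann_anc R t i) -(hsup_anc k t i) ea.
have -> : (fun x => (cabs (phi i x - w%:C%C * k x (ctr t i)) ^+ 2)%:E) =
    (fun x => (cabs (psi t i x) ^+ 2)%:E).
  by apply/funext => x; rewrite /psi ctr_anc.
rewrite -/(h n) => hi.
apply: (le_trans (lee_wpmul2l _ hi)); first by rewrite lee_fin mulr_ge0.
rewrite -EFinM lee_fin.
have -> : b * s i * (w ^+ 2 * (h n ^+ 2 / (2 ^+ ((n + d) * d) * ell t ^+ d))) =
    2 * (2 ^ d)%:R * w / lam * s i * (h n * (h n / (h n + eps n))).
  have h1 : 0 < h n + eps n by rewrite ltr_wpDl.
  have p1 : 0 < 2 ^+ ((n + d) * d) :> R by rewrite exprn_gt0.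
  rewrite /b /c /ftau -(ncell_ell R d tT).
  move: w0 nc0 p1 h1 lam0; move: (h n + eps n) => e.
  move: (h n) (2 ^+ ((n + d) * d)) (s i) => h' P s'.
  move: (ell _ ^+ d) ((ncell d J L t)%:R) ((2 ^ d)%:R).
  move=> W N D2 W0 N0 P0 e0 l00.
  by field; rewrite !gt_eqF.
have h1 : 0 < h n + eps n by rewrite ltr_wpDl.
rewrite ler_wpM2l//.
  by rewrite !mulr_ge0 ?invr_ge0 ?(ltW lam0) ?(ltW w0).
by rewrite ler_piMr// ler_pdivrMr// mul1r lerDl ltW.
Qed.

Lemma far_ge0 x : (0 <= far x)%E.
Proof.
apply: nneseries_ge0 => n _ _; rewrite /patch; case: ifP => // _.
by rewrite lee_fin farterm_ge0.
Qed.

Let mfar n : measurable_fun setT ((fun x => (farterm n x)%:E) \_ (ann t a (n + d))).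
Proof.
apply/(measurable_restrictT _ (measurable_annulus _ _ _)).
exact: measurable_farterm.
Qed.

Let far_pos n x : (0 <= ((fun x => (farterm n x)%:E) \_ (ann t a (n + d))) x)%E.
Proof. by rewrite /patch; case: ifP => // _; rewrite lee_fin farterm_ge0. Qed.

Lemma measurable_far : measurable_fun setT far.
Proof. exact: ge0_emeasurable_sum. Qed.

Lemma farterm_le x n : ann t a (n + d) x -> ((farterm n x)%:E <= far x)%E.
Proof.
move=> Ax; apply: le_trans (nneseries_lim_ge n.+1 _); last by [].
rewrite big_nat_recr//= [X in (_ <= _ + X)%E](_ : _ = (farterm n x)%:E).
  by rewrite leeDr// sume_ge0.
by rewrite /patch mem_set.
Qed.

Lemma far_integral :
  (\int[mu]_x far x <= (alpha * (fine (hormander k) + 1) +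
                        beta * fine (hormander k))%:E)%E.
Proof.
have hsum : (\sum_(n <oo) (h n)%:E <= hormander k)%E.
  apply: le_trans (hsup_sum k t a).
  have -> : (\sum_(n <oo) (h n)%:E = \sum_(n <oo) hsup t a (n + d))%E.
    apply: eq_eseriesr => n _; rewrite fineK// hsup_fin//.
    by rewrite ltn_addl.
  rewrite (nneseries_addn d (f := hsup t a)); last by move=> n; exact: hsup_ge0.
  (* As [0 < d], the indices from [d] on are among those of the kernel condition, which start at
     1. *)
  rewrite (nneseries_split 1 (d - 1)); last by move=> n _; exact: hsup_ge0.
  rewrite subnKC// leeDr// sume_ge0// => n _; exact: hsup_ge0.
have H0 : (0 <= hormander k)%E.
  by apply: le_trans hsum; apply: nneseries_ge0 => n _ _; rewrite lee_fin.
rewrite integral_nneseries//.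
apply: (@le_trans _ _ (\sum_(n <oo) (alpha%:E * ((h n)%:E + (1 / (2 ^ n.+1)%:R)%:E) + beta%:E * (h n)%:E))%E).
  apply: lee_nneseries => [n _ _|n _]; first exact: integral_ge0.
  rewrite -integral_mkcond -EFinD div1r.
  exact: far_term_integral.
rewrite nneseriesD => [|n _ _|n _ _]; last 2 first.
- by rewrite -EFinD -EFinM lee_fin mulr_ge0// addr_ge0// divr_ge0.
- by rewrite -EFinM lee_fin mulr_ge0.
rewrite !nneseriesZl => [|n _|n _]; last 2 first.
- by rewrite lee_fin.
- by rewrite -EFinD lee_fin addr_ge0// divr_ge0.
rewrite EFinD !EFinM EFinD fineK ?ge0_fin_numE//.
apply: leeD; apply: lee_wpmul2l; rewrite ?lee_fin//.
(* The series of the [eps n] contributes at most 1. *)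
apply: le_trans (epsilon_trick _ _ _) _; rewrite ?ler01//.
by rewrite EFinD fineK ?ge0_fin_numE ?leeD2r.
Qed.

End far_part.

(** The four terms come from the good part (Chebyshev at level [lam / 2], with [M + 1] for the
    operator and [2 ^ d] for the filtration), from the near regions, from the rank terms of the far
    blocks, and from their Hilbert-Schmidt terms, which count both [F] and its average. *)
Definition weak_const (R : realType) (d : nat) (M H : R) : R :=
  4 * (M + 1) ^+ 2 * (2 ^ d)%:R + 2 * (4 * 2 ^+ d) ^+ d + 4 * 8 ^+ d * (H + 1) +
  4 * (2 ^ d)%:R * H.

Lemma weak_const_ge0 (R : realType) (d : nat) (M H : R) : 0 <= H ->
  0 <= weak_const d M H.
Proof.
move=> H0; rewrite /weak_const; apply: addr_ge0; [apply: addr_ge0; [apply: addr_ge0|]|].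
- by rewrite mulr_ge0// mulr_ge0// sqr_ge0.
- by rewrite mulr_ge0// exprn_ge0// mulr_ge0// exprn_ge0.
- by rewrite mulr_ge0 ?addr_ge0// mulr_ge0// exprn_ge0.
- by rewrite mulr_ge0// mulr_ge0.
Qed.

Lemma fine_hormander_ge0 (R : realType) (d : nat) (k : 'rV[R]_d -> 'rV[R]_d -> R[i]) :
  0 <= fine (hormander k).
Proof.
apply: fine_ge0; apply: le_trans (hsup_sum k 0 ([ffun=> ord0] : idx d 0 0)).
by apply: nneseries_ge0 => n _ _; exact: hsup_ge0.
Qed.

(** * The estimate for positive step functions *)

Section psd_step.
Context (R : realType) (d : nat).
Local Notation E := 'rV[R]_d.
Local Notation C := R[i].
Local Notation mu := (lebesgue_rV R d).
Variables (k : E -> E -> C) (S : (E -> C) -> (E -> C)).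
Hypothesis CZ : CZ_operator k S.
Hypothesis d0 : (0 < d)%N.
Hypothesis hk : (hormander k < +oo)%E.
Variables (J L m : nat).
Let T := (J + L)%N.
Local Notation idx := (idx d J L).
Local Notation w := ((ell R L T) ^+ d).
Local Notation phi := (@phi R d S J L).
Local Notation ctr := (@ctr R d J L).
Local Notation ell := (@ell R L).
Local Notation anc := (@anc d J L).
Local Notation ncell := (@ncell d J L).
Variables (F : idx -> 'M[C]_m) (lam : R).
Hypothesis lam0 : 0 < lam.
Hypothesis psdF : forall i, psd (F i).
Hypothesis avg0_le : forall i, psd (lam%:C%C%:M - avg anc ncell F 0 i).

Let p t i := pproj anc ncell F lam t i.
Let r t i : R := (\rank (p t i))%:R.
Let s t a i := Retr (p t a *m F i *m p t a) + Retr (p t a *m avg anc ncell F t.+1 i *m p t a).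
Let H := fine (hormander k).
Let reps t := [seq a <- index_enum idx | anc t.+1 a == a].
Let near t a : set E := [set x | enorm (x - ctr t.+1 a) < 2 ^+ d * ell t.+1].
Let gp := gpart anc ncell T F lam.

Let H0 : 0 <= H. Proof. exact: fine_hormander_ge0. Qed.

Let mnear t a : measurable (near t a).
Proof.
rewrite -[X in measurable X]setTI (_ : near t a = (fun x => enorm (x - ctr t.+1 a)) @^-1`
  `]-oo, 2 ^+ d * ell t.+1[%classic).
  by apply: measurable_enorm => //; exact: measurable_itv.
by apply/seteqP; split => x /=; rewrite in_itv.
Qed.

Let s_ge0 t a i : 0 <= s t a i.
Proof.
have hp := adj_pproj anc ncell F lam t a; rewrite /s /p.
have h (A : 'M[C]_m) : psd A -> 0 <= Retr (pproj anc ncell F lam t a *m A *m pproj anc ncell F lam t a).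
  by move=> pA; rewrite -{2}hp; exact: psd_tr.
by apply: addr_ge0; apply: h => //; exact: psd_avg.
Qed.

Let r_ge0 t a : 0 <= r t a. Proof. exact: ler0n. Qed.

Let fr t a x := far k S t.+1 a (r t a) lam (s t a) x.

Let piece t a x := ((2 * r t a)%:E * (\1_(near t a) x)%:E + fr t a x)%E.

Let piece_ge0 t a x : (0 <= piece t a x)%E.
Proof.
apply: adde_ge0; last by apply: far_ge0 => //; exact: s_ge0.
by apply: mule_ge0; rewrite lee_fin ?indicE// mulr_ge0.
Qed.

Let mpiece t a : measurable_fun setT (piece t a).
Proof.
apply: emeasurable_funD.
  by apply: measurable_funeM; apply/measurable_EFinP; exact: measurable_indic.
by apply: measurable_far => //; exact: s_ge0.
Qed.

Let hsg x := hs (\sum_i phi i x *: gp i).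

Let hsgE x : (hsg x)%:E =
  (\sum_(u : 'I_m) \sum_(v : 'I_m) (cabs (\sum_i gp i u v * phi i x) ^+ 2)%:E)%E.
Proof.
rewrite /hsg hsE -sumEFin; apply: eq_bigr => u _; rewrite -sumEFin.
apply: eq_bigr => v _; rewrite summxE; congr (cabs _ ^+ 2)%:E.
by apply: eq_bigr => i _; rewrite mxE mulrC.
Qed.

Let mentry (u v : 'I_m) :
  measurable_fun setT (fun x => (cabs (\sum_i gp i u v * phi i x) ^+ 2)%:E).
Proof.
apply: measurable_cabs2E; apply: cmeasurable_sum => i.
by apply: cmeasurableZ; exact: (cmeasurable_phi CZ).
Qed.

Let mhsg : measurable_fun setT (fun x => (hsg x)%:E).
Proof.
under eq_fun do rewrite hsgE.
by apply: emeasurable_sum => u; apply: emeasurable_sum => v; exact: mentry.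
Qed.

Let hsg_integral :
  (\int[mu]_x (hsg x)%:E <=
   ((opnorm S + 1) ^+ 2 * (w * ((2 ^ d)%:R * lam * \sum_i Retr (F i))))%:E)%E.
Proof.
under eq_integral do rewrite hsgE.
rewrite ge0_integral_sum//; last 2 first.
- by move=> u; apply: emeasurable_sum => v; exact: mentry.
- by move=> u x _; apply: sume_ge0 => v _; exact: cabs2_ge0.
apply: (@le_trans _ _ (\sum_(u : 'I_m) \sum_(v : 'I_m)
    ((opnorm S + 1) ^+ 2 * (w * \sum_i cabs (gp i u v) ^+ 2))%:E)%E).
  apply: lee_sum => u _; rewrite ge0_integral_sum//; last first.
    by move=> v x _; exact: cabs2_ge0.
  by apply: lee_sum => v _; exact: (S_step_bound CZ).
have w0 := w_gt0 R d J L.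
have := sum_hs_gpart (@anc_nested d J L) (ncell_gt0 d J L) (@card_anc d J L)
  (ncell_le d J L) (@anc_fin d J L) lam0 psdF avg0_le.
move=> h; apply: (@le_trans _ _ ((opnorm S + 1) ^+ 2 * (w * \sum_i hs (gp i)))%:E); last first.
  by rewrite lee_fin ler_wpM2l ?sqr_ge0// ler_wpM2l// ltW.
under eq_bigr do rewrite sumEFin; rewrite sumEFin lee_fin.
rewrite le_eqVlt; apply/orP; left; apply/eqP.
under eq_bigr do rewrite -mulr_sumr -mulr_sumr; rewrite -!mulr_sumr.
congr (_ * (_ * _)).
under [RHS]eq_bigr do rewrite hsE.
rewrite [RHS]exchange_big /=; apply: eq_bigr => u _.
by rewrite exchange_big.
Qed.

(** The volume of the cube is spread evenly over its cells, on which the projection is constant; the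
    bound becomes a sum over cells, to which the global estimates on ranks and traces apply. *)
Let piece_integral t a : (t < T)%N -> anc t.+1 a == a ->
  (\int[mu]_x piece t a x <= (\sum_(i | anc t.+1 i == a)
    (w * (2 * (4 * 2 ^+ d) ^+ d + 4 * 8 ^+ d * (H + 1)) * r t i +
     2 * (2 ^ d)%:R * w / lam * H * s t i i))%:E)%E.
Proof.
move=> tT /eqP aa; have w0 := w_gt0 R d J L; have l0 := ell_gt0 R L t.+1.
rewrite ge0_integralD//; first last.
- by apply: measurable_far => //; exact: s_ge0.
- by move=> x _; apply: far_ge0 => //; exact: s_ge0.
- by apply: measurable_funeM; apply/measurable_EFinP; exact: measurable_indic.
- by move=> x _; apply: mule_ge0; rewrite lee_fin ?indicE// mulr_ge0.
have eqp i : anc t.+1 i == a -> p t i = p t a.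
  by move=> /eqP ia; apply: pproj_eq; [exact: anc_nested|rewrite ia aa].
have -> : \sum_(i | anc t.+1 i == a)
    (w * (2 * (4 * 2 ^+ d) ^+ d + 4 * 8 ^+ d * (H + 1)) * r t i +
     2 * (2 ^ d)%:R * w / lam * H * s t i i) =
   2 * r t a * (4 * (2 ^+ d * ell t.+1)) ^+ d +
   (4 * 8 ^+ d * ell t.+1 ^+ d * r t a * (H + 1) +
    2 * (2 ^ d)%:R * w / lam * (\sum_(i | anc t.+1 i == a) s t a i) * H).
  rewrite big_split /= addrA; congr (_ + _); last first.
    rewrite -[RHS]mulrAC [RHS]mulr_sumr; apply: eq_bigr => i ia.
    by rewrite [in LHS]/s eqp.
  rewrite (eq_bigr (fun=> w * (2 * (4 * 2 ^+ d) ^+ d + 4 * 8 ^+ d * (H + 1)) * r t a)); last first.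
    by move=> i ia; rewrite /r eqp.
  rewrite sumr_const (eq_card (B := [pred i | anc t.+1 i == anc t.+1 a])); last first.
    by move=> i; rewrite !inE aa.
  rewrite card_anc.
  have -> : (4 * (2 ^+ d * ell t.+1)) ^+ d = (4 * 2 ^+ d) ^+ d * ell t.+1 ^+ d.
    by rewrite -exprMn mulrA.
  rewrite -(ncell_ell R d tT) -[LHS]mulr_natr.
  move: ((4 * 2 ^+ d) ^+ d : R) (8 ^+ d : R) (ell T ^+ d) ((ncell t.+1)%:R) (r t a).
  move=> X8 X4 W N' r'.
  ring.
rewrite EFinD; apply: leeD; last first.
  by apply: (far_integral CZ d0 hk) => //; exact: s_ge0.
rewrite ge0_integralZl_EFin//; first last.
- by rewrite mulr_ge0.
- by apply/measurable_EFinP; exact: measurable_indic.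
rewrite integral_indic// setIT [leRHS]EFinM; apply: lee_wpmul2l.
  by rewrite lee_fin mulr_ge0.
apply: (@mu_ball_le _ _ (ctr t.+1 a)) => //; first by rewrite mulr_gt0 ?exprn_gt0.
by move=> x; rewrite /near /= => /ltW.
Qed.

Let far_index t a x : ~ near t a x -> exists n, ann t.+1 a (n + d) x.
Proof.
move=> /negP; rewrite -leNgt; set e := enorm _ => hx.
have l0 := ell_gt0 R L t.+1.
have ex : exists n, e <= 2 ^+ (n + d).+1 * ell t.+1.
  exists (Num.bound (e / ell t.+1)); rewrite -ler_pdivrMr//.
  have e0 : 0 <= e / ell t.+1 by rewrite divr_ge0 ?sqrtr_ge0// ltW.
  apply: (le_trans (ltW (archi_boundP e0))); rewrite -natrX ler_nat.
  apply: leq_trans (ltnW (ltn_expl _ (ltnSn 1))) _.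
  by rewrite leq_exp2l// -addnS leq_addr.
(* Minimality gives the inner radius; at index 0 it is the failure of [near]. *)
have [n hn min] := ex_minnP ex; exists n; apply/andP; split => //.
rewrite -/e; case: n hn min => [//|n] hn min.
rewrite leNgt; apply/negP => hlt.
by have := min n (ltW hlt); rewrite ltnn.
Qed.

(* A measurable majorant, because the left-hand side is not known to be
   measurable and lower integrals are not subadditive. *)
Lemma psd_step : exists g : E -> \bar R, [/\ measurable_fun setT g,
  (forall x, 0 <= g x)%E,
  (forall x, ((nsv lam (\sum_i phi i x *: F i))%:R%:E <= g x)%E) &
  (\int[mu]_x g x <=
    (weak_const d (opnorm S) H / lam * (w * \sum_i Retr (F i)))%:E)%E].
Proof.
pose g x := ((4 / lam ^+ 2)%:E * (hsg x)%:E +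
  \sum_(t < T) \sum_(a <- reps t) piece t a x)%E.
have c0 : 0 <= 4 / lam ^+ 2 by rewrite divr_ge0// sqr_ge0.
have hs0 x : (0 <= (4 / lam ^+ 2)%:E * (hsg x)%:E)%E.
  by rewrite -EFinM lee_fin mulr_ge0// hs_ge0.
have sp0 t x : (0 <= \sum_(a <- reps t) piece t a x)%E by exact: sume_ge0.
have msp t : measurable_fun setT (fun x => \sum_(a <- reps t) piece t a x)%E.
  exact: emeasurable_sum.
exists g; split.
- apply: emeasurable_funD; first exact: measurable_funeM.
  exact: emeasurable_sum.
- by move=> x; apply: adde_ge0 => //; exact: sume_ge0.
- move=> x.
  have hn t a : exists n, ~ near t a x -> ann t.+1 a (n + d) x.
    have [h|/far_index[n hn]] := pselect (near t a x); first by exists 0%N.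
    by exists n.
  (* For each cube, an annulus containing [x] is chosen when [x] is far, and [tau] is the weight of
     that annulus. *)
  have [N hN] := choice (fun ta : nat * idx => hn ta.1 ta.2).
  pose tau t a := ftau k t.+1 a lam (N (t, a)).
  have tau0 t a : ~~ (enorm (x - ctr t.+1 a) < 2 ^+ d * ell t.+1) -> 0 < tau t a.
    by move=> _; exact: ftau_gt0.
  have := nsv_pointwise (@anc_nested d J L) (@anc_idem d J L) (ncell_gt0 d J L)
    (@card_anc d J L) (ncell_le d J L) T lam0 psdF avg0_le (fun i => phi i x)
    (fun t a => w%:C%C * k x (ctr t.+1 a)) tau0.
  rewrite -lee_fin => /le_trans; apply.
  rewrite EFinD EFinM; apply: leeD => //.
  rewrite -sumEFin; apply: lee_sum => t _; rewrite /reps big_filter -sumEFin.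
  apply: lee_sum => a _; case: ifPn => [hnear|hfar].
    rewrite /piece indicE mem_set// mule1 leeDl//.
    by apply: far_ge0 => //; exact: s_ge0.
  have nn : ~ near t a x by apply/negP.
  rewrite /piece indicE memNset// mule0 add0e.
  exact: (farterm_le k S (r_ge0 t a) lam0 (s_ge0 t a) (hN (nat_of_ord t, a) nn)).
have w0 := w_gt0 R d J L.
rewrite ge0_integralD//; first last.
- exact: emeasurable_sum.
- by move=> x _; exact: sume_ge0.
- exact: measurable_funeM.
rewrite ge0_integralZl_EFin//; last first.
  by move=> x _; rewrite lee_fin hs_ge0.
rewrite ge0_integral_sum//.
pose tr := \sum_i Retr (F i).
pose A := 2 * (4 * 2 ^+ d) ^+ d + 4 * 8 ^+ d * (H + 1).
have A0 : 0 <= A.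
  by rewrite addr_ge0// mulr_ge0 ?exprn_ge0 ?mulr_ge0 ?exprn_ge0 ?addr_ge0.
(* [tr] occurs twice in the last factor because [s] adds the traces of [F] and of its average, whose
   sums over the cells agree. *)
have hB : (\sum_(t < T) \int[mu]_x (\sum_(a <- reps t) piece t a x) <=
    (w * A * (tr / lam) + 2 * (2 ^ d)%:R * w / lam * H * (tr + tr))%:E)%E.
  apply: (@le_trans _ _ (\sum_(t < T) (\sum_i (w * A * r t i +
      2 * (2 ^ d)%:R * w / lam * H * s t i i))%:E)%E).
    apply: lee_sum => t _; rewrite ge0_integral_sum// /reps big_filter.
    rewrite [X in (_ <= EFin X)%E](partition_big (anc t.+1) (fun a => anc t.+1 a == a)) /=; last first.
      by move=> i _; rewrite anc_idem.
    rewrite -sumEFin; apply: lee_sum => a aa; exact: piece_integral.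
  rewrite sumEFin lee_fin; under eq_bigr do rewrite big_split /= -!mulr_sumr.
  rewrite big_split /= -!mulr_sumr; apply: lerD.
    apply: ler_wpM2l; first by rewrite mulr_ge0// ltW.
    rewrite ler_pdivlMr// mulrC.
    exact: (sum_rank_pproj (@anc_nested d J L) (ncell_gt0 d J L) (@card_anc d J L)).
  apply: ler_wpM2l; first by rewrite !mulr_ge0 ?invr_ge0// ltW.
  under eq_bigr do rewrite big_split /=.
  rewrite big_split /=; under eq_bigr => t _.
    rewrite /p (sum_trace_pprojF (@anc_nested d J L) (ncell_gt0 d J L) (@card_anc d J L)).
    over.
  have h := sum_trace_pproj_le (@anc_nested d J L) (ncell_gt0 d J L) (@card_anc d J L) T lam0 psdF.
  exact: (lerD h h).
apply: (le_trans (leeD (lee_wpmul2l _ hsg_integral) hB)); first by rewrite lee_fin.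
rewrite -EFinM -EFinD lee_fin le_eqVlt; apply/orP; left; apply/eqP.
rewrite /weak_const -/tr /A; have := lt0r_neq0 lam0.
move: (ell T ^+ d) (tr) (opnorm S) => W t' M l0; field.
exact: l0.
Qed.

End psd_step.

(** * Reduction to positive matrices *)

Section matrix_splitting.
Context (R : realType) (m : nat).
Local Notation C := R[i].
Implicit Types A : 'M[C]_m.

Lemma psd_sub_Retr A (c : R) : psd A -> Retr A <= c -> psd (c%:C%C%:M - A).
Proof.
move=> pA hc; set P := spectralmx A; have uP : uni P := uni_spectral A.
have -> : c%:C%C%:M - A = adj P *m dg (fun i => c - sdiag A i) *m P.
  rewrite -dgB dg_scalar mulmxBr mulmxBl -(spectralE pA.1).
  by rewrite mul_mx_scalar -scalemxAl uP.2 scalemx1.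
apply: psd_dg => i; rewrite subr_ge0; apply: le_trans hc.
have -> : Retr A = \sum_i sdiag A i.
  by rewrite {1}(spectralE pA.1) -/P Retr_mulC mulmxA uP.1 mul1mx Retr_dg.
by rewrite (bigD1 i)//= lerDl sumr_ge0// => j _; exact: sdiag_ge0.
Qed.

(** Hermitian and skew parts, then positive and negative parts of each. The family is indexed by
    [nat], with the default 0 from index 4 on. *)
Lemma psd_split A : exists F : nat -> 'M[C]_m, [/\ forall l, psd (F l),
  A = F 0%N - F 1%N + 'i%C *: (F 2%N - F 3%N) & forall l, Retr (F l) <= trn A].
Proof.
have cI : cabs (- 'i%C : C) = 1.
  by rewrite cabsE /= oppr0 expr0n add0r sqrrN expr1n sqrtr1.
have hh (B : 'M[C]_m) : adj (2^-1%:C%C *: (B + adj B)) = 2^-1%:C%C *: (B + adj B).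
  by rewrite adjZr adjD adjK addrC.
have [F1 [G1 [pF1 pG1 e1 t1]]] := herm_split (hh A).
have [F2 [G2 [pF2 pG2 e2 t2]]] := herm_split (hh (- 'i%C *: A)).
have {}t1 := le_trans t1 (trn_herm A).
have {}t2 := le_trans t2 (trn_herm (- 'i%C *: A)); rewrite trnZ// in t2.
exists (nth 0 [:: F1; G1; F2; G2]); split.
- by move=> [|[|[|[|l]]]] /=; [exact: pF1|exact: pG1|exact: pF2|exact: pG2|];
    rewrite nth_nil; exact: psd0.
- rewrite /= -e1 -e2 adjZ scalerA; apply/matrixP => i j; rewrite !mxE.
  set b := (X in A i j + X).
  suff -> : (- 'i%C : C)^*%R = 'i%C.
    by apply: complex_inj; rewrite ?(cReD, cImD, cReM, cImM) /=; lra.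
  by apply: complex_inj; rewrite ?cRe_conj ?cIm_conj /= ?oppr0 ?opprK.
- have := psd_tr_ge0 pF1; have := psd_tr_ge0 pG1.
  have := psd_tr_ge0 pF2; have := psd_tr_ge0 pG2.
  move=> a1 a2 a3 a4 [|[|[|[|l]]]] /=; [lra|lra|lra|lra|].
  by rewrite nth_nil Retr0 trn_ge0.
Qed.

(** Multiplication by -1 or by the imaginary unit keeps the singular values, so Weyl's inequality
    deals a quarter of the level to each part. *)
Lemma nsv_split lam (F : nat -> 'M[C]_m) : 0 < lam ->
  (nsv lam (F 0%N - F 1%N + 'i%C *: (F 2%N - F 3%N))%R <= \sum_(l < 4) nsv (lam / 4)%R (F l))%N.
Proof.
move=> l0; have q0 : 0 <= lam / 4 by rewrite divr_ge0// ltW.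
have cI : cabs ('i%C : C) = 1.
  by rewrite cabsE /= expr0n add0r expr1n sqrtr1.
have cN : cabs (-1 : C) = 1 by rewrite cabsN cabs_real normr1.
have h (A B : 'M[C]_m) : (nsv (lam / 4 + lam / 4) (A - B) <= nsv (lam / 4) A + nsv (lam / 4) B)%N.
  by rewrite -[nsv _ B](nsvZ _ B cN) scaleN1r; exact: nsv_add.
have e : lam = (lam / 4 + lam / 4) + (lam / 4 + lam / 4) by lra.
rewrite {1}e; apply: leq_trans (nsv_add _ _ _ _) _; rewrite ?addr_ge0//.
rewrite (nsvZ _ _ cI); apply: leq_trans (leq_add (h _ _) (h _ _)) _.
have s4 (u : nat -> nat) : (\sum_(l < 4) u l = u 0 + u 1 + (u 2 + u 3))%N.
  by rewrite !big_ord_recr big_ord0 /= add0n !addnA.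
by rewrite (s4 (fun l => nsv (lam / 4) (F l))).
Qed.

End matrix_splitting.

(** * Dyadic step functions *)

Section dyadic_points.
Context (R : realType) (d : nat).
Local Notation E := 'rV[R]_d.
Implicit Types (x y : E).

Definition same_cell (J : nat) x y :=
  forall j, Num.floor (2 ^+ J * x ord0 j) = Num.floor (2 ^+ J * y ord0 j).

(** The integer part of [2 * a] determines that of [a]: for an integer [z], [z <= a] means
    [2 * z <= 2 * a]. *)
Lemma same_cellS J x y : same_cell J.+1 x y -> same_cell J x y.
Proof.
suff h z (a b : R) : Num.floor (2 * a) = Num.floor (2 * b) -> z <= Num.floor a ->
    z <= Num.floor b.
  move=> hxy j; have := hxy j; rewrite !exprS -!mulrA => e.
  by apply: le_anti; rewrite (h _ _ _ e (lexx _)) (h _ _ _ (esym e) (lexx _)).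
rewrite !floor_ge_int => e za.
have : (2 * z)%:~R <= 2 * a by rewrite intrM ler_pM2l.
by rewrite -(floor_ge_int (2 * a)) e floor_ge_int intrM ler_pM2l.
Qed.

Lemma same_cell_le J J' x y : (J <= J')%N -> same_cell J' x y -> same_cell J x y.
Proof.
move=> /subnK <-; elim: (_ - _)%N => [//|n IH]; rewrite addSn => h.
exact/IH/same_cellS.
Qed.

Lemma bigbox_le L L' : (L <= L')%N -> bigbox L `<=` @bigbox R d L'.
Proof.
move=> LL' x h j; have /andP[h1 h2] := h j.
have : 2 ^+ L <= 2 ^+ L' :> R by rewrite ler_eXn2l// ltr1n.
by move=> h'; apply/andP; split; [apply: le_trans h1; rewrite lerN2|exact: lt_le_trans h2 h'].
Qed.

Definition cpt (J L : nat) (i : idx d J L) : E :=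
  \row_j (ell R L (J + L) * ((i j)%:R - 2 ^+ (J + L))).

Lemma cell_cpt J L (i : idx d J L) : cube (J + L) i (cpt i).
Proof.
apply/cubeP => j; rewrite /cpt mxE subnn expn0 divn1 lexx /= ltr_pM2l ?ell_gt0//.
by rewrite ltrD2r ltrDl.
Qed.

End dyadic_points.

Section dyadic_steps.
Context (R : realType) (d : nat) (V : lmodType R[i]).
Local Notation E := 'rV[R]_d.
Local Notation mu := (lebesgue_rV R d).
Implicit Types (x y : E) (f : E -> V).

(** Invariance rather than a finite sum over cells: refining the grid or enlarging the box then
    costs nothing, and [dstepE] recovers the sum. *)
Definition dstep (J L : nat) f :=
  (forall x y, same_cell J x y -> f x = f y) /\ forall x, ~ bigbox L x -> f x = 0.

Lemma dstep_le J L J' L' f : (J <= J')%N -> (L <= L')%N -> dstep J L f -> dstep J' L' f.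
Proof.
move=> JJ' LL' [fc f0]; split => [x y h|x nx]; first exact/fc/(same_cell_le JJ').
by apply: f0 => h; apply: nx; exact: bigbox_le h.
Qed.

Lemma dstepE J L f : dstep J L f ->
  f = fun x => \sum_(i : idx d J L) cind (cube (J + L) i) x *: f (cpt R i).
Proof.
move=> [fc f0]; apply/funext => x; have [/(bigboxP J)[i ix]|nx] := pselect (bigbox L x).
  rewrite (sum_cind_in _ ix); apply: fc => j.
  by rewrite (cellP i x).1// (cellP i (cpt R i)).1//; exact: cell_cpt.
by rewrite f0// sum_cind_out// => -[i ix]; apply: nx; apply/(bigboxP J); exists i.
Qed.

Lemma integral_dstep J L f (h : V -> R) : dstep J L f -> h 0 = 0 ->
  (forall v, 0 <= h v) ->
  (\int[mu]_x (h (f x))%:E =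
   (ell R L (J + L) ^+ d * \sum_(i : idx d J L) h (f (cpt R i)))%:E)%E.
Proof.
move=> fs h0 hge; rewrite -integral_step//; apply: eq_integral => x _.
by rewrite {1}(dstepE fs).
Qed.

End dyadic_steps.

Lemma dstep_comp (R : realType) (d : nat) (V W : lmodType R[i]) (h : V -> W) J L
  (f : 'rV[R]_d -> V) : h 0 = 0 -> dstep J L f -> dstep J L (h \o f).
Proof.
move=> h0 [fc f0]; split => [x y /fc e|x /f0 e]; by rewrite /= e.
Qed.

(** * The weak type estimate on step functions *)

Section step_weak.
Context (R : realType) (d : nat).
Local Notation E := 'rV[R]_d.
Local Notation C := R[i].
Local Notation mu := (lebesgue_rV R d).
Variables (k : E -> E -> C) (S : (E -> C) -> (E -> C)).
Hypothesis CZ : CZ_operator k S.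
Hypothesis d0 : (0 < d)%N.
Hypothesis hk : (hormander k < +oo)%E.
Local Notation K := (weak_const d (opnorm S) (fine (hormander k))).

(* L may be increased so that the averages at level 0, which are at most
   2^(-L d) int tr |f|, do not exceed lam / 4. *)
Lemma step_weak m J L (f : E -> 'M[C]_m) (lam : R) : dstep J L f -> 0 < lam ->
  exists g : E -> \bar R, [/\ measurable_fun setT g,
  (forall x, 0 <= g x)%E,
  {ae mu, forall x, ((nsv lam (entrywise S f x))%:R%:E <= g x)%E} &
  (\int[mu]_x g x <= (16 * K / lam)%:E * \int[mu]_x (trn (f x))%:E)%E].
Proof.
move=> fs lam0; pose I0 := fine (\int[mu]_x (trn (f x))%:E)%E.
have [L' LL' hL] : exists2 L', (L <= L')%N & I0 / (lam / 4) <= 2 ^+ L'.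
  pose n := Num.bound (I0 / (lam / 4)); exists (maxn L n); first exact: leq_maxl.
  have I00 : 0 <= I0 / (lam / 4).
    rewrite divr_ge0 ?divr_ge0 ?(ltW lam0)// fine_ge0// integral_ge0// => x _.
    by rewrite lee_fin trn_ge0.
  apply: (le_trans (ltW (archi_boundP I00))).
  rewrite -natrX ler_nat; apply: leq_trans (ltnW (ltn_expl _ (ltnSn 1))) _.
  by rewrite leq_exp2l// leq_maxr.
have {}fs := dstep_le (leqnn J) LL' fs.
have Iw := integral_dstep fs (@trn0 R m) (@trn_ge0 R m).
set w := ell _ _ _ ^+ d in Iw.
have w0 : 0 < w := w_gt0 R d J L'.
pose A (i : idx d J L') := f (cpt R i).
have [F hF] := choice (fun i => psd_split (A i)).
have l40 : 0 < lam / 4 by rewrite divr_gt0.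
pose tr := \sum_i trn (A i).
have avg0 l i : psd ((lam / 4)%:C%C%:M -
    avg (@anc d J L') (@ncell d J L') (fun i => F i l) 0 i).
  apply: psd_sub_Retr; first by apply: psd_avg => j; have [] := hF j.
  rewrite /avg RetrZ Retr_sum mulrC ler_pdivrMr ?ltr0n ?ncell_gt0//.
  apply: (@le_trans _ _ tr).
    rewrite /tr [leRHS](bigID (fun j => anc 0 j == anc 0 i)) /= -[leLHS]addr0.
    apply: lerD; last by apply: sumr_ge0 => j _; exact: trn_ge0.
    by apply: ler_sum => j _; have [_ _] := hF j.
  have : I0 = w * tr by rewrite /I0 Iw.
  move=> e; move: hL; rewrite e ler_pdivrMr// => hL.
  rewrite -(ler_pM2l w0); apply: (le_trans hL); rewrite [leRHS]mulrCA mulrC.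
  rewrite ler_pM2l// mulrC ncell_ell// /ell /side /gen sub0r opprK.
  rewrite -[2 ^ (Posz L')]/(2 ^+ L') -exprM ler_eXn2l ?ltr1n//.
  by rewrite leq_pmulr.
have [g hg] := choice (fun l : 'I_4 => psd_step CZ d0 hk l40
  (fun i => let: And3 h _ _ := hF i in h l) (avg0 l)).
exists (fun x => \sum_l g l x)%E; split.
- by apply: emeasurable_sum => l; have [] := hg l.
- by move=> x; apply: sume_ge0 => l _; have [] := hg l.
- have hS u v : {ae mu, forall x, S (fun y => f y u v) x =
      \sum_i A i u v * phi S i x}.
    apply: filterS (S_step CZ (fun i => A i u v)) => x <-; congr (S _ x).
    apply/funext => y; rewrite {1}(dstepE fs) summxE.
    by apply: eq_bigr => i _; rewrite mxE.
  have : {ae mu, forall x, forall uv : 'I_m * 'I_m,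
      S (fun y => f y uv.1 uv.2) x = \sum_i A i uv.1 uv.2 * phi S i x}.
    exact: filter_forall.
  apply: filterS => x hx.
  have -> : entrywise S f x = (\sum_i phi S i x *: F i 0%N) -
      (\sum_i phi S i x *: F i 1%N) +
      'i%C *: ((\sum_i phi S i x *: F i 2%N) - (\sum_i phi S i x *: F i 3%N)).
    rewrite -!sumrB scaler_sumr -big_split /=; apply/matrixP => u v.
    rewrite mxE (hx (u, v)) /= summxE; apply: eq_bigr => i _.
    have [_ -> _] := hF i; rewrite -!scalerBr scalerA ['i%C * _]mulrC -scalerA.
    by rewrite -scalerDr [RHS]mxE mulrC.
  apply: (@le_trans _ _ ((\sum_(l < 4) nsv (lam / 4) (\sum_i phi S i x *: F i l))%N%:R%:E)).
    by rewrite lee_fin ler_nat; exact: (nsv_split (fun l => \sum_i phi S i x *: F i l) lam0).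
  rewrite natr_sum -sumEFin; apply: lee_sum => l _.
  by have [_ _ + _] := hg l; exact.
rewrite ge0_integral_sum; last 3 first.
- exact: measurableT.
- by move=> l; have [] := hg l.
- by move=> l x _; have [] := hg l.
rewrite Iw -EFinM.
have K0 : 0 <= K by rewrite weak_const_ge0// fine_hormander_ge0.
(* Four parts, each at level [lam / 4]: hence the factor 16. *)
apply: (@le_trans _ _ (\sum_(l < 4) (K / (lam / 4) * (w * tr))%:E)%E).
  apply: lee_sum => l _; have [_ _ _ h] := hg l; apply: (le_trans h).
  rewrite lee_fin; apply: ler_wpM2l; first exact: divr_ge0 K0 (ltW l40).
  apply: ler_wpM2l; first exact: ltW.
  by apply: ler_sum => i _; have [_ _] := hF i.
rewrite sumEFin sumr_const card_ord lee_fin -/tr le_eqVlt; apply/orP; left.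
apply/eqP; move: (K) (w * tr) => K' X; field.
by rewrite gt_eqF.
Qed.

Lemma nsv11 (lam : R) (a : C) : (nsv lam (a%:M : 'M[C]_1) = (lam < cabs a)%R)%N.
Proof.
have := hs_sv (a%:M : 'M[C]_1).
rewrite big_ord1 hsE big_ord1 big_ord1 mxE eqxx mulr1n => e.
have {}e : sv (a%:M : 'M[C]_1) ord0 = cabs a.
  apply/eqP; rewrite -(eqrXn2 (n := 2)) ?sv_ge0 ?cabs_ge0//; exact/eqP.
rewrite /nsv; case: ltP => h.
  rewrite (_ : [set i | _]%SET = [set: 'I_1]%SET) ?cardsT ?card_ord//.
  by apply/setP => i; rewrite !inE (ord1 i) e.
by apply/eqP; rewrite cards_eq0; apply/eqP/setP => i; rewrite !inE (ord1 i) e ltNge h.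
Qed.

(** The case of 1 by 1 matrices, on which the extension of [S] to L1 rests. *)
Lemma scalar_step_weak J L (f : E -> C) (lam : R) : dstep J L (f : E -> C^o) ->
  0 < lam -> measurable_fun setT (fun x => cabs (S f x)) ->
  (lam%:E * mu [set x | (lam < cabs (S f x))%R] <=
   (16 * K)%:E * \int[mu]_x (cabs (f x))%:E)%E.
Proof.
move=> fs lam0 mS.
pose F (x : E) : 'M[C]_1 := (f x)%:M.
have Fs : dstep J L F.
  by apply: (dstep_comp (h := fun a : C^o => a%:M : 'M[C]_1) _ fs); rewrite raddf0.
have [g [mg g0 hg ig]] := step_weak Fs lam0.
have e x : trn (F x) <= cabs (f x).
  by apply: (le_trans (trn_entries _)); rewrite !big_ord1 mxE eqxx mulr1n.
have mA : measurable [set x | (lam < cabs (S f x))%R].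
  rewrite -[X in measurable X]setTI (_ : [set x | _] = (fun x => cabs (S f x)) @^-1` `]lam, +oo[%classic).
    by apply: mS => //; exact: measurable_itv.
  by apply/seteqP; split => x /=; rewrite in_itv /= andbT.
have -> : mu [set x | (lam < cabs (S f x))%R] =
    (\int[mu]_x (\1_[set x | (lam < cabs (S f x))%R] x)%:E)%E.
  by rewrite integral_indic// setIT.
have K0 : 0 <= K by rewrite weak_const_ge0// fine_hormander_ge0.
apply: (@le_trans _ _ (lam%:E * ((16 * K / lam)%:E * \int[mu]_x (cabs (f x))%:E))%E).
  apply: lee_wpmul2l; first by rewrite lee_fin ltW.
  apply: (@le_trans _ _ (\int[mu]_x g x)%E).
    apply: ae_ge0_le_integral => //.
    - by apply/measurable_EFinP; exact: measurable_indic.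
    apply: filterS hg => x + _; rewrite (_ : entrywise S F x = (S f x)%:M).
      by rewrite nsv11 indicE mem_setE.
    apply/matrixP => u v; rewrite !mxE (ord1 u) (ord1 v) eqxx mulr1n.
    by congr (S _ x); apply/funext => y; rewrite mxE eqxx mulr1n.
  apply: (le_trans ig); apply: lee_wpmul2l.
    by rewrite lee_fin divr_ge0 ?mulr_ge0// ltW.
  rewrite (integral_dstep Fs (@trn0 R 1) (@trn_ge0 R 1)).
  rewrite (integral_dstep (h := @cabs R) fs (@cabs0 R) (@cabs_ge0 R)) lee_fin.
  rewrite ler_pM2l ?w_gt0//; apply: ler_sum => i _; exact: e.
rewrite muleA -EFinM mulrCA mulfV ?gt_eqF// mulr1.
by rewrite lexx.
Qed.

End step_weak.

(** * Density of dyadic step functions *)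

Lemma ge0_cvg0_lt (R : realType) (u : (\bar R)^nat) (e : R) :
  (forall n, 0 <= u n)%E -> u n @[n --> \oo] --> 0%E -> 0 < e ->
  exists N, forall n, (N <= n)%N -> (u n < e%:E)%E.
Proof.
move=> u0 /fine_cvgP[[N' _ hN']] /cvgrPdist_lt h e0.
have [N _ hN] := h _ e0; exists (maxn N N') => n hn.
have f := hN' _ (leq_trans (leq_maxr N N') hn).
have := hN _ (leq_trans (leq_maxl N N') hn).
rewrite /= sub0r normrN ger0_norm ?fine_ge0// => h'.
by rewrite -[X in (X < _)%E]fineK// lte_fin.
Qed.

Section dyadic_approximation.
Context (R : realType) (d : nat).
Local Notation E := 'rV[R]_d.
Local Notation mu := (lebesgue_rV R d).
Implicit Types (A B U V : set E) (x y : E).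

Definition cell_inv (J : nat) U := forall x y, same_cell J x y -> U x -> U y.

Definition symdiff A U := (A `\` U) `|` (U `\` A).

(** Errors are measured inside a box, since the sets may have infinite measure; this makes the class
    stable under complements. *)
Definition dyadic_approx A := measurable A /\
  forall L (e : R), 0 < e -> exists J, exists U,
    [/\ measurable U, cell_inv J U & (mu (symdiff A U `&` bigbox L) < e%:E)%E].

Lemma mu_setU_le A B : measurable A -> measurable B ->
  (mu (A `|` B) <= mu A + mu B)%E.
Proof. by move=> mA mB; exact: measureU2. Qed.

Lemma measurable_symdiff A U : measurable A -> measurable U -> measurable (symdiff A U).
Proof. by move=> mA mU; apply: measurableU; exact: measurableD. Qed.

Lemma measurable_bigbox L : measurable (@bigbox R d L).
Proof. exact: measurable_halfopen_box. Qed.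

Lemma mu_bigbox L : (mu (@bigbox R d L) < +oo)%E.
Proof.
rewrite /bigbox mu_box ?ltry// => i.
by rewrite (@le_trans _ _ 0) ?oppr_le0 ?exprn_ge0.
Qed.

Lemma cell_inv_le J J' U : (J <= J')%N -> cell_inv J U -> cell_inv J' U.
Proof. by move=> JJ hU x y h; apply: hU; exact: same_cell_le h. Qed.

Lemma dyadic_approx_inv J U : measurable U -> cell_inv J U -> dyadic_approx U.
Proof.
move=> mU iU; split => // L e e0; exists J, U; split => //.
by rewrite /symdiff setDv setU0 set0I measure0 lte_fin.
Qed.

Lemma dyadic_approxC A : dyadic_approx A -> dyadic_approx (~` A).
Proof.
move=> [mA hA]; split => [|L e e0]; first exact: measurableC.
have [J [U [mU iU h]]] := hA L e e0; exists J, (~` U); split.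
- exact: measurableC.
- move=> x y xy nUx Uy; apply: nUx; apply: iU Uy => j; exact/esym.
- rewrite (_ : symdiff (~` A) (~` U) = symdiff A U)//.
  by rewrite /symdiff !setDE !setCK setUC [U `&` _]setIC [~` U `&` _]setIC.
Qed.

Lemma dyadic_approxU A B : dyadic_approx A -> dyadic_approx B -> dyadic_approx (A `|` B).
Proof.
move=> [mA hA] [mB hB]; split => [|L e e0]; first exact: measurableU.
have e20 : 0 < e / 2 by rewrite divr_gt0.
have [J [U [mU iU hU]]] := hA L _ e20; have [J' [V [mV iV hV]]] := hB L _ e20.
exists (maxn J J'), (U `|` V); split; first exact: measurableU.
  move=> x y xy [Ux|Vx]; [left|right].
    by apply: (cell_inv_le _ iU xy) Ux; exact: leq_maxl.
  by apply: (cell_inv_le _ iV xy) Vx; exact: leq_maxr.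
have mb := measurable_bigbox L.
have m1 := measurableI _ _ (measurable_symdiff mA mU) mb.
have m2 := measurableI _ _ (measurable_symdiff mB mV) mb.
have m3 := measurableI _ _ (measurable_symdiff (measurableU _ _ mA mB) (measurableU _ _ mU mV)) mb.
apply: (@le_lt_trans _ _ (mu ((symdiff A U `&` bigbox L) `|` (symdiff B V `&` bigbox L)))).
  apply: le_measure; rewrite ?inE//; first exact: measurableU.
  move=> x [[[[Ax|Bx] nUV]|[[Ux|Vx] nAB]] bx].
  - by left; split => //; left; split => // Ux; apply: nUV; left.
  - by right; split => //; left; split => // Vx; apply: nUV; right.
  - by left; split => //; right; split => // Ax; apply: nAB; left.
  - by right; split => //; right; split => // Bx; apply: nAB; right.
apply: (le_lt_trans (mu_setU_le m1 m2)).
by rewrite [e]splitr EFinD lteD.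
Qed.

(** Finite unions exhaust the countable one and, inside a box of finite measure, the remainder tends
    to 0; half of [e] pays for it and half for approximating the finite union. *)
Lemma dyadic_approx_bigcup (F : (set E)^nat) : (forall n, dyadic_approx (F n)) ->
  dyadic_approx (\bigcup_n F n).
Proof.
move=> hF; have mF n : measurable (F n) by have [] := hF n.
have mU : measurable (\bigcup_n F n) by exact: bigcup_measurable.
split => // L e e0.
pose G n := \big[setU/set0]_(i < n) F i.
have hG n : dyadic_approx (G n).
  elim: n => [|n IH]; rewrite /G; last by rewrite big_ord_recr; exact: dyadic_approxU.
  by rewrite big_ord0; apply: (dyadic_approx_inv (J := 0)) => //; exact: measurable0.
have mG n : measurable (G n) by have [] := hG n.
have mb := measurable_bigbox L.
pose H n := ((\bigcup_n F n) `\` G n) `&` bigbox L.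
have mH n : measurable (H n) by apply: measurableI => //; exact: measurableD.
have H0 : \bigcap_n H n = set0.
  rewrite -subset0 => x hx; have [[[n _ Fnx] _] _] := hx 0%N I.
  have [[_ nG] _] := hx n.+1 I; apply: nG; rewrite /G big_ord_recr /=; right.
  exact: Fnx.
have cvg : mu (H n) @[n --> \oo] --> 0%E.
  rewrite -(measure0 mu) -H0; apply: nonincreasing_cvg_mu => //.
  - apply: le_lt_trans (mu_bigbox L); apply: le_measure; rewrite ?inE//.
    by move=> x [].
  - by rewrite H0.
  - move=> n n' nn'; apply/subsetPset => x [[Fx nG] bx]; split => //; split => // Gx.
    by apply: nG; move: Gx; apply: subset_bigsetU.
have e20 : 0 < e / 2 by rewrite divr_gt0.
have [n /(_ n (leqnn n)) hn] := ge0_cvg0_lt (fun n => measure_ge0 mu (H n)) cvg e20.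
have [_ /(_ L _ e20) [J [U [mU' iU hU]]]] := hG n.
exists J, U; split => //.
have m1 := measurableI _ _ (measurable_symdiff (mG n) mU') mb.
have m2 := measurableI _ _ (measurable_symdiff mU mU') mb.
apply: (@le_lt_trans _ _ (mu (H n `|` (symdiff (G n) U `&` bigbox L)))).
  apply: le_measure; rewrite ?inE//; first exact: measurableU.
  move=> x [[[Fx nU]|[Ux nF]] bx].
    have [Gx|nG] := pselect (G n x); last by left.
    by right; split => //; left.
  right; split => //; right; split => // Gx; apply: nF.
  move: Gx; rewrite /G -bigcup_mkord => -[i _ Fix].
  by exists i.
apply: (le_lt_trans (mu_setU_le (mH n) m1)).
by rewrite [e]splitr EFinD lteD.
Qed.

(** The half-space is a union of dyadic ones: a coordinate below [a] is separated from it by the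
    integer part of [2 ^+ J * a] as soon as [2 ^+ J] times the gap is at least 1. *)
Lemma dyadic_approx_ray i (a : R) : dyadic_approx [set x : E | x ord0 i < a].
Proof.
rewrite (_ : [set x : E | _] =
    \bigcup_J [set x : E | 2 ^+ J * x ord0 i < (Num.floor (2 ^+ J * a))%:~R]); last first.
  apply/seteqP; split => x /=; last first.
    move=> [J _ h]; have := lt_le_trans h (floor_le_tmp (2 ^+ J * a)).
    by rewrite ltr_pM2l// exprn_gt0.
  move=> xa; have ax0 : 0 < a - x ord0 i by rewrite subr_gt0.
  pose n := Num.bound ((a - x ord0 i)^-1); exists n => //=.
  have ai0 : 0 <= (a - x ord0 i)^-1 by rewrite invr_ge0 ltW.
  have h : 1 <= 2 ^+ n * (a - x ord0 i).
    rewrite -ler_pdivrMr// div1r; apply: (le_trans (ltW (archi_boundP ai0))).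
    by rewrite -natrX ler_nat ltnW// ltn_expl.
  have := lt_succ_floor (2 ^+ n * a); rewrite intrD.
  move: h; rewrite mulrBr; move: (2 ^+ n * a) (2 ^+ n * _) (_%:~R) => y z fl.
  by clear; lra.
apply: dyadic_approx_bigcup => J; apply: (dyadic_approx_inv (J := J)).
  rewrite -[X in measurable X]setTI (_ : [set x : E | _] =
    (fun x : E => 2 ^+ J * x ord0 i) @^-1` `]-oo, (Num.floor (2 ^+ J * a))%:~R[%classic).
    have mf : measurable_fun setT (fun x : E => 2 ^+ J * x ord0 i).
      by apply: measurable_funM => //; exact: measurable_coord.
    by apply: mf => //; exact: measurable_itv.
  by apply/seteqP; split => x /=; rewrite in_itv.
by move=> x y xy /=; rewrite -!floor_lt_int (xy i).
Qed.

(** The approximable sets form a sigma-algebra containing the half-spaces that generate the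
    measurable sets. *)
Lemma dyadic_approx_measurable A : measurable A -> dyadic_approx A.
Proof.
have h0 : dyadic_approx set0.
  by apply: (dyadic_approx_inv (J := 0)) => //; exact: measurable0.
have hD B : dyadic_approx B -> dyadic_approx (setT `\` B).
  by rewrite setTD; exact: dyadic_approxC.
move: A; apply: smallest_sub; first by split => //; exact: dyadic_approx_bigcup.
rewrite -bigcup_seq /=; apply: bigcup_sub => i _ _ [B mB <-].
rewrite setTI; move: B mB => /= B.
rewrite (_ : measurable B = ((@RGenInftyO.G R).-sigma.-measurable) B); last first.
  by rewrite -RGenInftyO.measurableE.
move: B; apply: smallest_sub => /=.
  split => [||].
  - by rewrite /= preimage_set0.
  - by move=> B hB /=; rewrite setTD preimage_setC; exact: dyadic_approxC.
  - by move=> F hF /=; rewrite preimage_bigcup; exact: dyadic_approx_bigcup.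
move=> _ [a ->] /=.
rewrite (_ : _ @^-1` _ = [set x : E | x ord0 i < a]); first exact: dyadic_approx_ray.
by apply/seteqP; split => x /=; rewrite in_itv.
Qed.

End dyadic_approximation.

Section quantization.
Context (R : realType).
Implicit Types (y del : R).

(** The sum counts the positive multiples of [del] up to [y], so [del] times it is [y] rounded down
    to a multiple of [del], except at the top of the range, which loses nothing. *)
Lemma quantize y del M : 0 < del -> 0 <= y <= M%:R * del ->
  `|y - del * \sum_(l < M) ((l.+1)%:R * del <= y)%R%:R| <= del.
Proof.
move=> del0 /andP[y0 yM].
have full n : n%:R * del <= y ->
    \sum_(l < n) ((l.+1)%:R * del <= y)%R%:R = n%:R :> R.
  move=> h; rewrite (eq_bigr (fun=> 1)) ?sumr_const ?card_ord// => l _.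
  suff -> : (l.+1)%:R * del <= y by [].
  by apply: le_trans h; rewrite ler_pM2r// ler_nat.
suff : del * \sum_(l < M) ((l.+1)%:R * del <= y)%R%:R <= y /\
    y <= del * \sum_(l < M) ((l.+1)%:R * del <= y)%R%:R + del.
  by move=> [h1 h2]; rewrite ger0_norm; lra.
elim: M yM => [|n IH] yM.
  by rewrite big_ord0 mulr0; split => //; rewrite add0r; move: yM; rewrite mul0r; lra.
have [h|h] := leP (n.+1%:R * del) y.
  rewrite full// mulrC; split => //; apply: (le_trans yM); lra.
rewrite big_ord_recr /= (lt_geF h) addr0.
have [h'|h'] := leP y (n%:R * del); first exact: IH.
rewrite full; last exact: ltW.
by move: h; rewrite -natr1 mulrDl mul1r [del * _]mulrC => h; split; exact: ltW.
Qed.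

(** Truncation to [[-N, N]]. It keeps the approximants bounded, which turns L1 errors into L2 errors
    in [density]. *)
Definition clip (N : R) y := Num.max (- N) (Num.min N y).

Lemma clip_le N y : 0 <= N -> `|clip N y| <= N.
Proof.
move=> N0; rewrite ler_norml /clip le_max lexx /= ge_max ge_min lexx /= andbT.
by rewrite (le_trans _ N0)// oppr_le0.
Qed.

Lemma clip_dist N y z : `|y| <= N -> `|y - clip N z| <= `|y - z|.
Proof.
rewrite /clip ler_norml => /andP[h1 h2].
have [a|a] := leP N z; have [b|b] := leP (- N) _; try lra.
- by rewrite distrC [leRHS]distrC !ger0_norm; lra.
- by rewrite !ger0_norm; lra.
Qed.

End quantization.

Section density.
Context (R : realType) (d : nat).
Local Notation E := 'rV[R]_d.
Local Notation C := R[i].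
Local Notation mu := (lebesgue_rV R d).
Implicit Types (x y : E).

Lemma bigbox_inv J L : cell_inv J (@bigbox R d L).
Proof.
move=> x y xy /(bigboxP J)[i /cellP hi]; apply/(bigboxP J); exists i.
by apply/cellP => j; rewrite -xy hi.
Qed.

Lemma symdiff_indic (A U : set E) x :
  `|(\1_A x : R) - \1_U x| = \1_(symdiff A U) x.
Proof.
rewrite !indicE.
have [a|a] := pselect (A x); have [u|u] := pselect (U x).
- rewrite (mem_set a) (mem_set u) subrr normr0 memNset// => -[[_ /(_ u)]|[_ /(_ a)]] //.
- by rewrite (mem_set a) (memNset u) subr0 normr1 mem_set//; left.
- by rewrite (memNset a) (mem_set u) sub0r normrN normr1 mem_set//; right.
- by rewrite (memNset a) (memNset u) subrr normr0 memNset// => -[[/a]|[/u]].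
Qed.

(** [g + N] is quantized through [M] superlevel sets, each replaced by a dyadic set. Inside the box
    the first error is [del] pointwise, the second [del] for each symmetric difference containing
    the point. *)
Lemma real_density (g : E -> R) (N e : R) L : measurable_fun setT g ->
  0 <= N -> (forall x, `|g x| <= N) -> (forall x, ~ bigbox L x -> g x = 0) ->
  0 < e -> exists J, exists s : E -> R, [/\
    (forall x y, same_cell J x y -> s x = s y),
    (forall x, ~ bigbox L x -> s x = 0), (forall x, `|s x| <= N) &
    (\int[mu]_x (`|g x - s x|)%:E <= e%:E)%E].
Proof.
move=> mg N0 gN g0 e0.
have mB := @measurable_bigbox R d L.
pose b := fine (mu (@bigbox R d L)).
have bE : mu (bigbox L) = b%:E by rewrite fineK// ge0_fin_numE// mu_bigbox.
have b0 : 0 <= b by rewrite fine_ge0.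
(* Makes [del] times the measure of the box at most [e / 2]. *)
pose del := e / (2 * (b + 1)).
have del0 : 0 < del by rewrite divr_gt0// mulr_gt0// ltr_wpDl.
pose M := Num.bound (2 * N / del).
have hM : 2 * N <= M%:R * del.
  have q0 : 0 <= 2 * N / del by apply: divr_ge0; [exact: mulr_ge0|exact: ltW].
  by rewrite -ler_pdivrMr//; exact/ltW/archi_boundP.
(* Makes the [M] replacement errors add up to at most [e / 2]. *)
pose e' := e / (2 * (del * M%:R + 1)).
have dM0 : 0 <= del * M%:R by rewrite mulr_ge0// ltW.
have e'0 : 0 < e' by rewrite divr_gt0// mulr_gt0// ltr_wpDl.
pose A (l : nat) := [set x : E | (l.+1)%:R * del <= g x + N].
have mA l : measurable (A l).
  rewrite -[X in measurable X]setTI (_ : A l =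
    (fun x => g x + N) @^-1` `[(l.+1)%:R * del, +oo[%classic).
    have mf : measurable_fun setT (fun x => g x + N) by exact: measurable_funD.
    by apply: mf => //; exact: measurable_itv.
  by apply/seteqP; split => x /=; rewrite in_itv /= andbT.
have hA l := (dyadic_approx_measurable (mA l)).2 L e' e'0.
have [Jf /choice[U hU]] := choice hA.
pose J := \max_(l < M) Jf l.
pose q x : R := - N + del * \sum_(l < M) \1_(U l) x.
exists J, (fun x => if x \in bigbox L then clip N (q x) else 0); split.
- move=> x y xy; have -> : (x \in bigbox L) = (y \in bigbox L).
    apply/idP/idP; rewrite !inE; first exact: bigbox_inv xy.
    by apply: (@bigbox_inv J) => j; exact/esym.
  case: ifP => // _; congr clip; rewrite /q; congr (_ + _ * _).
  apply: eq_bigr => l _; rewrite !indicE; congr (nat_of_bool _)%:R.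
  have [_ iU _] := hU l; have lJ : (Jf l <= J)%N by exact: leq_bigmax.
  have {}iU := cell_inv_le lJ iU.
  by apply/idP/idP; rewrite !inE; [exact: iU xy | apply: iU => j; exact/esym].
- by move=> x nx; rewrite memNset.
- by move=> x; case: ifP => _; [exact: clip_le | rewrite normr0].
pose D l := symdiff (A l) (U l) `&` bigbox L.
have mD l : measurable (D l).
  by have [mU _ _] := hU l; apply: measurableI => //; exact: measurable_symdiff.
apply: (@le_trans _ _ (\int[mu]_x ((del)%:E * (\1_(bigbox L) x)%:E +
    \sum_(l < M) del%:E * (\1_(D l) x)%:E))%E).
  apply: nonmeasurable_ge0_integral_le.
  - by move=> x; rewrite lee_fin.
  - move=> x; apply: adde_ge0.
      by apply: mule_ge0; rewrite lee_fin ?indicE// ltW.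
    by apply: sume_ge0 => l _; apply: mule_ge0; rewrite lee_fin ?indicE// ltW.
  - apply: emeasurable_funD.
      by apply: measurable_funeM; apply/measurable_EFinP; exact: measurable_indic.
    apply: emeasurable_sum => l; apply: measurable_funeM.
    by apply/measurable_EFinP; exact: measurable_indic.
  apply: aeW => x.
  case: (boolP (x \in bigbox L)) => [|]; last first.
    rewrite notin_setE => nx; rewrite g0// subrr normr0 adde_ge0//.
      by apply: mule_ge0; rewrite lee_fin ?indicE// ltW.
    by apply: sume_ge0 => l _; apply: mule_ge0; rewrite lee_fin ?indicE// ltW.
  rewrite inE => bx; rewrite indicE mem_set// mule1.
  rewrite (eq_bigr (fun l : 'I_M => (del * \1_(D l) x)%:E)) => [|l _]; last by [].
  rewrite sumEFin -EFinD lee_fin; apply: (le_trans (clip_dist _ (gN x))).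
  have -> : g x - q x = (g x + N - del * \sum_(l < M) \1_(A l) x) +
      del * \sum_(l < M) (\1_(A l) x - \1_(U l) x).
    by rewrite /q sumrB; ring.
  apply: (le_trans (ler_normD _ _)); apply: lerD.
    rewrite (eq_bigr (fun l : 'I_M => ((l.+1)%:R * del <= g x + N)%R%:R)) => [|l _].
      apply: quantize => //; have := gN x; rewrite ler_norml => /andP[h1 h2].
      by apply/andP; split; lra.
    by rewrite indicE; congr (nat_of_bool _)%:R; apply/idP/idP; rewrite inE.
  rewrite normrM gtr0_norm// -mulr_sumr ler_pM2l//.
  apply: (le_trans (ler_norm_sum _ _ _)); apply: ler_sum => l _.
  rewrite symdiff_indic !indicE /D.
  case: (boolP (x \in symdiff _ _)) => // xs.
  by rewrite mem_set//; split => //; move: xs; rewrite inE.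
have mi (X : set E) : measurable X -> measurable_fun setT (fun x => del%:E * (\1_X x)%:E)%E.
  by move=> mX; apply: measurable_funeM; apply/measurable_EFinP; exact: measurable_indic.
have pi (X : set E) x : (0 <= del%:E * (\1_X x)%:E)%E.
  by apply: mule_ge0; rewrite lee_fin ?indicE// ltW.
have ei (X : set E) : measurable X ->
    (\int[mu]_x (del%:E * (\1_X x)%:E) = del%:E * mu X)%E.
  move=> mX; rewrite ge0_integralZl_EFin//; last 2 first.
  - by apply/measurable_EFinP; exact: measurable_indic.
  - exact: ltW.
  by rewrite integral_indic// setIT.
rewrite ge0_integralD//; first last.
- by apply: emeasurable_sum => l; exact: mi.
- by move=> x _; exact: sume_ge0.
- exact: mi.
rewrite ge0_integral_sum//; last by move=> l; exact: mi.
rewrite ei// [mu _]bE.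
apply: (@le_trans _ _ ((del * b)%:E + \sum_(l < M) (del * e')%:E)%E).
  apply: leeD => //; apply: lee_sum => l _; rewrite ei// [leRHS]EFinM.
  apply: lee_wpmul2l; first by rewrite lee_fin ltW.
  by have [_ _ /ltW] := hU l.
rewrite sumEFin sumr_const card_ord -EFinD lee_fin -mulr_natr.
have h1 : del * b <= e / 2.
  rewrite /del; have -> : e / (2 * (b + 1)) * b = e / 2 * (b / (b + 1)).
    by field; rewrite gt_eqF// ltr_wpDl.
  by rewrite ler_piMr ?divr_ge0 ?(ltW e0)// ler_pdivrMr ?mul1r ?lerDl// ltr_wpDl.
have h2 : del * e' * M%:R <= e / 2.
  rewrite mulrAC /e'; set u := del * M%:R in dM0 *.
  have -> : u * (e / (2 * (u + 1))) = e / 2 * (u / (u + 1)).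
    by field; rewrite gt_eqF// ltr_wpDl.
  by rewrite ler_piMr ?divr_ge0 ?(ltW e0)// ler_pdivrMr ?mul1r ?lerDl// ltr_wpDl.
lra.
Qed.

Lemma cmeasurable_dstep J L (s : E -> C) : dstep J L (s : E -> C^o) -> cmeasurable s.
Proof.
move=> /dstepE ->; apply: cmeasurable_sum => i.
under eq_fun do rewrite /GRing.scale /= mulrC.
by apply: cmeasurableZ; apply: cmeasurable_cind; exact: measurable_cube.
Qed.

Lemma bounded_density (h : E -> C) (N e : R) L : cmeasurable h -> 0 <= N ->
  (forall x, cabs (h x) <= N) -> (forall x, ~ bigbox L x -> h x = 0) -> 0 < e ->
  exists J, exists s : E -> C, [/\ dstep J L (s : E -> C^o),
    (forall x, cabs (h x - s x) <= 4 * N) &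
    (\int[mu]_x (cabs (h x - s x))%:E <= e%:E)%E].
Proof.
move=> [mr mi] N0 hN h0 e0.
have hr x : `|complex.Re (h x)| <= N by apply: le_trans (hN x); exact: cabs_Re.
have hi x : `|complex.Im (h x)| <= N by apply: le_trans (hN x); exact: cabs_Im.
have e20 : 0 < e / 2 by rewrite divr_gt0.
have [J [r [r1 r2 r3 r4]]] := real_density mr N0 hr (fun x nx => congr1 _ (h0 x nx)) e20.
have [J' [t [t1 t2 t3 t4]]] := real_density mi N0 hi (fun x nx => congr1 _ (h0 x nx)) e20.
pose s x : C := Complex (r x) (t x).
have hs x : cabs (h x - s x) <= `|complex.Re (h x) - r x| + `|complex.Im (h x) - t x|.
  by apply: (le_trans (cabs_leReIm _)); rewrite cReB cImB.
have sd : dstep (maxn J J') L (s : E -> C^o).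
  split => [x y xy|x nx]; last by rewrite /s r2// t2.
  rewrite /s (r1 x y); last by apply: same_cell_le xy; exact: leq_maxl.
  by rewrite (t1 x y)//; apply: same_cell_le xy; exact: leq_maxr.
exists (maxn J J'), s; split => //.
  move=> x; apply: (le_trans (hs x)).
  have := hr x; have := hi x; have := r3 x; have := t3 x.
  have := ler_normB (complex.Re (h x)) (r x); have := ler_normB (complex.Im (h x)) (t x).
  lra.
have [msr msi] := cmeasurable_dstep sd.
have m1 : measurable_fun setT (fun x => (`|complex.Re (h x) - r x|)%:E).
  by apply/measurable_EFinP; apply: measurableT_comp => //; exact: measurable_funB.
have m2 : measurable_fun setT (fun x => (`|complex.Im (h x) - t x|)%:E).
  by apply/measurable_EFinP; apply: measurableT_comp => //; exact: measurable_funB.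
apply: (@le_trans _ _ (\int[mu]_x ((`|complex.Re (h x) - r x|)%:E +
    (`|complex.Im (h x) - t x|)%:E))%E).
  apply: nonmeasurable_ge0_integral_le.
  - by move=> x; rewrite lee_fin cabs_ge0.
  - by move=> x; rewrite -EFinD lee_fin addr_ge0.
  - exact: emeasurable_funD.
  by apply: aeW => x; rewrite -EFinD lee_fin.
rewrite ge0_integralD//.
by apply: (le_trans (leeD r4 t4)); rewrite -EFinD -splitr.
Qed.

Lemma integral_tail_cvg0 (phi : E -> R) (A : (set E)^nat) :
  measurable_fun setT phi -> (forall x, 0 <= phi x) ->
  (\int[mu]_x (phi x)%:E < +oo)%E -> (forall n, measurable (A n)) ->
  (forall x, exists N, forall n, (N <= n)%N -> A n x) ->
  (\int[mu]_x (phi x * \1_(~` A n) x)%:E)%E @[n --> \oo] --> 0%E.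
Proof.
move=> mphi phi0 ioo mA hA.
have mf n : measurable_fun setT (fun x => (phi x * \1_(~` A n) x)%:E).
  apply/measurable_EFinP; apply: measurable_funM => //; apply: measurable_indic.
  exact: measurableC.
have ip : mu.-integrable setT (EFin \o phi).
  apply/integrableP; split; first exact/measurable_EFinP.
  by under eq_integral do rewrite /= ger0_norm//.
have := @dominated_convergence _ _ _ mu setT measurableT
  (fun n x => (phi x * \1_(~` A n) x)%:E) (fun=> 0%E) (EFin \o phi) mf
  (measurable_cst _).
move=> /(_ _ ip _)[||_ _].
- apply: aeW => x _; have [N hN] := hA x.
  apply: cvg_near_cst; exists N => // n /= Nn.
  rewrite indicE memNset ?mulr0// => nA; apply: nA; exact: hN.
- apply: aeW => x n _ /=; rewrite lee_fin ger0_norm ?mulr_ge0 ?indicE//.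
  by rewrite ler_piMr//; case: (_ \in _).
by rewrite integral0.
Qed.

(** A single step function has to serve for both norms. [f] is cut down to a bounded [h] supported
    in a box; the square error of [h] is then at most a sup bound times its L1 error. *)
Lemma density (f : E -> C) (e : R) : Lp 1%:E f -> 0 < e ->
  exists J, exists L, exists s : E -> C, [/\ dstep J L (s : E -> C^o),
    (\int[mu]_x (cabs (f x - s x))%:E <= e%:E)%E &
    Lp 2%:E f -> (\int[mu]_x (cabs (f x - s x) ^+ 2)%:E <= e%:E)%E].
Proof.
move=> /Lp1P[mf f1] e0.
pose A n := bigbox n `&` [set x | cabs (f x) <= n%:R].
have mA n : measurable (A n).
  apply: measurableI; first exact: measurable_bigbox.
  rewrite -[X in measurable X]setTI (_ : [set x | _] =
    (fun x => cabs (f x)) @^-1` `]-oo, n%:R]%classic).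
    by apply: measurable_cabs => //; exact: measurable_itv.
  by apply/seteqP; split => x /=; rewrite in_itv.
have hA x : exists N, forall n, (N <= n)%N -> A n x.
  pose N1 := Num.bound (cabs (f x)); pose N2 := Num.bound (enorm x).
  have h1 := archi_boundP (cabs_ge0 (f x)).
  have h2 := archi_boundP (sqrtr_ge0 (\sum_(i < d) x ord0 i ^+ 2)).
  exists (maxn N1 N2) => n; rewrite geq_max => /andP[n1 n2]; split; last first.
    by rewrite /= (le_trans (ltW h1))// ler_nat.
  move=> j; have : `|x ord0 j| < 2 ^+ n.
    apply: (le_lt_trans (coord_le_enorm x j)); apply: (lt_le_trans h2).
    rewrite -natrX ler_nat (leq_trans n2)// ltnW// ltn_expl//.
  by rewrite ltr_norml => /andP[/ltW -> ->].
have mc := measurable_cabs mf.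
have mc2 : measurable_fun setT (fun x => cabs (f x) ^+ 2) by exact: measurable_funX.
have e20 : 0 < e / 2 by rewrite divr_gt0.
have e40 : 0 < e / 4 by rewrite divr_gt0.
have i0 n : (0 <= \int[mu]_x (cabs (f x) * \1_(~` A n) x)%:E)%E.
  by apply: integral_ge0 => x _; rewrite lee_fin mulr_ge0 ?cabs_ge0 ?indicE.
have [N1 hN1] := ge0_cvg0_lt i0
  (integral_tail_cvg0 mc (fun x => cabs_ge0 (f x)) f1 mA hA) e20.
have [N2 hN2] : exists N, Lp 2%:E f -> forall n, (N <= n)%N ->
    (\int[mu]_x (cabs (f x) ^+ 2 * \1_(~` A n) x)%:E < (e / 4)%:E)%E.
  have [/Lp2P[_ f2]|nf] := pselect (Lp 2%:E f); last by exists 0%N.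
  have j0 n : (0 <= \int[mu]_x (cabs (f x) ^+ 2 * \1_(~` A n) x)%:E)%E.
    by apply: integral_ge0 => x _; rewrite lee_fin mulr_ge0 ?sqr_ge0 ?indicE.
  have [N hN] := ge0_cvg0_lt j0
    (integral_tail_cvg0 mc2 (fun x => sqr_ge0 (cabs (f x))) f2 mA hA) e40.
  by exists N.
pose n := maxn N1 N2.
pose h x := cind (A n) x * f x.
have hE x : h x = if x \in A n then f x else 0.
  by rewrite /h /cind indicE; case: ifP; rewrite ?mul1r ?mul0r.
have mh : cmeasurable h by apply: cmeasurableM => //; exact: cmeasurable_cind.
have hn x : cabs (h x) <= n%:R.
  by rewrite hE; case: ifPn => [|_]; rewrite ?cabs0// inE => -[].
have h0 x : ~ bigbox n x -> h x = 0.
  by move=> nx; rewrite hE memNset// => -[/nx].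
(* The L2 estimate multiplies this error by [2 * (4 * n)]. *)
pose e' := e / (2 * (8 * n%:R + 1)).
have n80 : 0 < 8 * n%:R + 1 :> R by rewrite ltr_wpDl// mulr_ge0.
have e'0 : 0 < e' by rewrite divr_gt0// mulr_gt0.
have [J [s [sd s4 se]]] := bounded_density mh (ler0n _ n) hn h0 e'0.
have ms := cmeasurable_dstep sd.
have fh x : cabs (f x - h x) = cabs (f x) * \1_(~` A n) x.
  rewrite hE indicE; case: (boolP (x \in A n)) => [|]; rewrite ?inE ?notin_setE => xA.
    by rewrite subrr cabs0 memNset ?mulr0// => /(_ xA).
  by rewrite subr0 mem_set// mulr1.
have m1 := measurable_cabsE (cmeasurableB mf mh).
have m2 := measurable_cabsE (cmeasurableB mh ms).
have m3 := measurable_cabs2E (cmeasurableB mf mh).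
exists J, n, s; split => //.
- apply: (@le_trans _ _ (\int[mu]_x ((cabs (f x - h x))%:E + (cabs (h x - s x))%:E))%E).
    apply: nonmeasurable_ge0_integral_le.
    - by move=> x; rewrite lee_fin cabs_ge0.
    - by move=> x; rewrite -EFinD lee_fin addr_ge0 ?cabs_ge0.
    - exact: emeasurable_funD.
    apply: aeW => x; rewrite -EFinD lee_fin; apply: le_trans (cabsD _ _).
    by rewrite subrKA.
  rewrite ge0_integralD//; last 2 first.
  - by move=> x _; rewrite lee_fin cabs_ge0.
  - by move=> x _; rewrite lee_fin cabs_ge0.
  apply: (@le_trans _ _ ((e / 2)%:E + e'%:E)%E).
    apply: leeD => //; under eq_integral do rewrite fh.
    by apply/ltW/hN1; exact: leq_maxl.
  rewrite -EFinD lee_fin; suff : e' <= e / 2 by lra.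
  by rewrite /e' ler_pM2l// lef_pV2 ?posrE ?mulr_gt0// ler_peMr// lerDr mulr_ge0.
move=> f2.
apply: (@le_trans _ _ (\int[mu]_x (2%:E * (cabs (f x - h x) ^+ 2)%:E +
    (8 * n%:R)%:E * (cabs (h x - s x))%:E))%E).
  apply: nonmeasurable_ge0_integral_le.
  - by move=> x; exact: cabs2_ge0.
  - move=> x; rewrite -!EFinM -EFinD lee_fin addr_ge0//.
      by rewrite mulr_ge0// sqr_ge0.
    by rewrite !mulr_ge0// cabs_ge0.
  - by apply: emeasurable_funD; exact: measurable_funeM.
  apply: aeW => x; rewrite -!EFinM -EFinD lee_fin.
  have := cabs2D_le (f x - h x) (h x - s x); rewrite subrKA => hh.
  apply: (le_trans hh); rewrite lerD2l.
  have := s4 x; have := cabs_ge0 (h x - s x); rewrite expr2; nra.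
rewrite ge0_integralD//; last 4 first.
- by move=> x _; rewrite -EFinM lee_fin mulr_ge0 ?sqr_ge0.
- exact: measurable_funeM.
- by move=> x _; rewrite -EFinM lee_fin !mulr_ge0 ?cabs_ge0.
- exact: measurable_funeM.
rewrite !ge0_integralZl_EFin//; last 2 first.
- by move=> x _; rewrite lee_fin cabs_ge0.
- by move=> x _; exact: cabs2_ge0.
apply: (@le_trans _ _ (2%:E * (e / 4)%:E + (8 * n%:R)%:E * e'%:E)%E).
  apply: leeD; apply: lee_wpmul2l => //; rewrite ?lee_fin ?mulr_ge0//.
  rewrite (_ : (fun x => (cabs (f x - h x) ^+ 2)%:E) =
    (fun x => (cabs (f x) ^+ 2 * \1_(~` A n) x)%:E)).
    by apply/ltW/hN2 => //; exact: leq_maxr.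
  apply/funext => x; rewrite fh exprMn indicE.
  by case: (_ \in _); rewrite ?expr1n ?expr0n.
rewrite -!EFinM -EFinD lee_fin; suff : 8 * n%:R * e' <= e / 2 by lra.
rewrite /e'; set u := 8 * n%:R in n80 *.
have -> : u * (e / (2 * (u + 1))) = e / 2 * (u / (u + 1)) by field; rewrite gt_eqF.
by rewrite ler_piMr ?divr_ge0 ?(ltW e0)// ler_pdivrMr ?mul1r ?lerDl.
Qed.

End density.

(** * Extension to L1 *)

Section level_sets.
Context (R : realType) (d : nat).
Local Notation E := 'rV[R]_d.
Local Notation C := R[i].
Local Notation mu := (lebesgue_rV R d).
Implicit Types (f g : E -> C).

Definition lset (lam : R) f : set E := [set x | (lam < cabs (f x))%R].

Lemma measurable_lset lam f : cmeasurable f -> measurable (lset lam f).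
Proof.
move=> mf; rewrite -[X in measurable X]setTI (_ : lset lam f =
  (fun x => cabs (f x)) @^-1` `]lam, +oo[%classic).
  by apply: measurable_cabs => //; exact: measurable_itv.
by apply/seteqP; split => x /=; rewrite in_itv /= andbT.
Qed.

Lemma mu_lset_split lam f g : cmeasurable f -> cmeasurable g ->
  (mu (lset lam f) <= mu (lset (lam / 2) g) + mu (lset (lam / 2) (fun x => f x - g x)%R))%E.
Proof.
move=> mf mg; have m1 := measurable_lset (lam / 2) mg.
have m2 := measurable_lset (lam / 2) (cmeasurableB mf mg).
apply: le_trans (mu_setU_le m1 m2); apply: le_measure; rewrite ?inE//.
- exact: measurable_lset.
- exact: measurableU.
move=> x /= h; have [h1|h1] := ltP (lam / 2) (cabs (g x)); first by left.
right; rewrite /lset /= in h *; have := cabsD (f x - g x) (g x); rewrite subrK; lra.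
Qed.

Lemma mu_lset_ae lam f g : cmeasurable f -> cmeasurable g ->
  {ae mu, forall x, f x = g x} -> mu (lset lam f) = mu (lset lam g).
Proof.
have h f' g' : cmeasurable f' -> cmeasurable g' ->
    {ae mu, forall x, f' x = g' x} -> (mu (lset lam f') <= mu (lset lam g'))%E.
  move=> mf mg fg.
  have e f'' : cmeasurable f'' -> mu (lset lam f'') = (\int[mu]_x (\1_(lset lam f'') x)%:E)%E.
    by move=> mf''; rewrite integral_indic ?setIT//; exact: measurable_lset.
  rewrite !e//; apply: nonmeasurable_ge0_integral_le => [x|x||].
  - by rewrite lee_fin indicE.
  - by rewrite lee_fin indicE.
  - by apply/measurable_EFinP; apply: measurable_indic; exact: measurable_lset.
  apply: filterS fg => x fgx; rewrite lee_fin !indicE.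
  have -> // : (x \in lset lam f') = (x \in lset lam g').
  by apply/idP/idP; rewrite !inE /lset /= fgx.
move=> mf mg fg; apply/eqP; rewrite eq_le !h//.
by apply: filterS fg.
Qed.

Lemma chebyshev2 lam f : cmeasurable f -> 0 < lam ->
  ((lam ^+ 2)%:E * mu (lset lam f) <= \int[mu]_x (cabs (f x) ^+ 2)%:E)%E.
Proof.
move=> mf l0; have mA := measurable_lset lam mf.
apply: (@le_trans _ _ (\int[mu]_x ((lam ^+ 2)%:E * (\1_(lset lam f) x)%:E))%E).
  rewrite ge0_integralZl_EFin ?sqr_ge0//; last first.
    by apply/measurable_EFinP; exact: measurable_indic.
  by rewrite integral_indic// setIT.
apply: ge0_le_integral => //.
- by move=> x _; rewrite -EFinM lee_fin mulr_ge0 ?sqr_ge0// indicE.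
- by apply: measurable_funeM; apply/measurable_EFinP; exact: measurable_indic.
- exact: measurable_cabs2E.
move=> x _; rewrite -EFinM lee_fin indicE; case: (boolP (x \in _)) => [|_].
  by rewrite inE /lset /= mulr1 => /ltW h; rewrite ler_pXn2r// ?nnegrE ?cabs_ge0 ?(ltW l0).
by rewrite mulr0 sqr_ge0.
Qed.

Lemma integral_cabsD_le f g : cmeasurable f -> cmeasurable g ->
  (\int[mu]_x (cabs (f x + g x)%R)%:E <=
   \int[mu]_x (cabs (f x))%:E + \int[mu]_x (cabs (g x))%:E)%E.
Proof.
move=> mf mg; rewrite -ge0_integralD//; first last.
- exact: measurable_cabsE.
- by move=> x _; rewrite lee_fin cabs_ge0.
- exact: measurable_cabsE.
- by move=> x _; rewrite lee_fin cabs_ge0.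
apply: ge0_le_integral => //.
- by move=> x _; rewrite lee_fin cabs_ge0.
- by apply: measurable_cabsE; exact: cmeasurableD.
- by apply: emeasurable_funD; exact: measurable_cabsE.
by move=> x _; rewrite -EFinD lee_fin cabsD.
Qed.

Lemma Lp1B f g : Lp 1%:E f -> Lp 1%:E g -> Lp 1%:E (fun x => f x - g x).
Proof.
move=> /Lp1P[mf f1] /Lp1P[mg g1]; apply/Lp1P; split; first exact: cmeasurableB.
have mg' : cmeasurable (fun x => -1 * g x) by exact: cmeasurableZ.
have := integral_cabsD_le mf mg'.
rewrite (_ : (fun x => (cabs (f x + -1 * g x))%:E) = (fun x => (cabs (f x - g x))%:E)).
  rewrite (_ : (fun x => (cabs (-1 * g x))%:E) = (fun x => (cabs (g x))%:E)).
    by move=> /le_lt_trans; apply; rewrite lte_add_pinfty.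
  by apply/funext => x; rewrite mulN1r cabsN.
by apply/funext => x; rewrite mulN1r.
Qed.

Lemma Lp2B f g : Lp 2%:E f -> Lp 2%:E g -> Lp 2%:E (fun x => f x - g x).
Proof.
move=> f2 g2; have := Lp2_lin (-1) g2 f2.
by under eq_fun do rewrite mulN1r addrC.
Qed.

Lemma dstep_compact_L1L2 J L (s : E -> C) : dstep J L (s : E -> C^o) -> compact_L1L2 s.
Proof.
move=> sd; have ms := cmeasurable_dstep sd; split.
- apply/Lp1P; split => //.
  by rewrite (integral_dstep (h := @cabs R) sd (@cabs0 R) (@cabs_ge0 R)) ltry.
- apply/Lp2P; split => //.
  rewrite (integral_dstep (h := fun a : C^o => cabs a ^+ 2) sd) ?ltry//.
    by rewrite cabs0 expr0n.
  by move=> v; exact: sqr_ge0.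
apply: (subclosed_compact (@closed_closure _ _) (@compact_closed_box R d
  (fun=> - 2 ^+ L) (fun=> 2 ^+ L))).
rewrite /supp closureE => x; apply; split; first exact: closed_closed_box.
move=> y /= sy j; have : bigbox L y.
  by apply: contrapT => /(sd.2) e; move: sy; rewrite e eqxx.
by move=> /(_ j) /andP[h1 /ltW h2]; rewrite /= in_itv /= h1.
Qed.

End level_sets.

Section weak_type.
Context (R : realType) (d : nat).
Local Notation E := 'rV[R]_d.
Local Notation C := R[i].
Local Notation mu := (lebesgue_rV R d).
Variables (k : E -> E -> C) (S : (E -> C) -> (E -> C)).
Hypothesis CZ : CZ_operator k S.
Hypothesis d0 : (0 < d)%N.
Hypothesis hk : (hormander k < +oo)%E.
Local Notation K := (weak_const d (opnorm S) (fine (hormander k))).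
Implicit Types (f g h : E -> C).

Let K0 : 0 <= K. Proof. by rewrite weak_const_ge0// fine_hormander_ge0. Qed.

Lemma cmeasurable_S f : Lp 2%:E f -> cmeasurable (S f).
Proof. by move=> /(CZ_L2 CZ)[]. Qed.

(** A step function [s] close to [h] in both norms: [S s] falls under the step estimate, and
    [S (h - s)] under Chebyshev's inequality and L2 boundedness, with an error as small as desired.
    Halving the level turns 16 into 32. *)
Lemma weak_L1L2 h (lam : R) : Lp 1%:E h -> Lp 2%:E h -> 0 < lam ->
  (lam%:E * mu (lset lam (S h)) <= (32 * K)%:E * \int[mu]_x (cabs (h x))%:E)%E.
Proof.
move=> h1 h2 l0; have [mh hI] := (Lp1P h).1 h1.
set I1 := (\int[mu]_x _)%E in hI *.
have I10 : (0 <= I1)%E by apply: integral_ge0 => x _; rewrite lee_fin cabs_ge0.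
apply/lee_addgt0Pr => eta eta0.
pose c := 32 * K + 4 * (opnorm S + 1) ^+ 2 / lam.
have c0 : 0 <= c.
  apply: addr_ge0; first exact: mulr_ge0.
  by apply: divr_ge0; [apply: mulr_ge0 => //; exact: sqr_ge0|exact: ltW].
have c10 : 0 < c + 1 by rewrite ltr_wpDl.
have e0 : 0 < eta / (c + 1) by rewrite divr_gt0.
have [J [L [s [sd s1 s2]]]] := density h1 e0; have {}s2 := s2 h2.
have [sL1 sL2 _] := dstep_compact_L1L2 sd; have [ms _] := (Lp1P s).1 sL1.
set e := eta / (c + 1) in e0 s1 s2.
have mSh := cmeasurable_S h2; have mSs := cmeasurable_S sL2.
have hs2 := Lp2B h2 sL2; have mShs := cmeasurable_S hs2.
have l20 : 0 < lam / 2 by rewrite divr_gt0.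
have A1 := scalar_step_weak CZ d0 hk sd l20 (measurable_cabs mSs).
have A2 : (\int[mu]_x (cabs (s x))%:E <= I1 + e%:E)%E.
  have := integral_cabsD_le mh (cmeasurableB ms mh).
  rewrite (_ : (fun x => (cabs (h x + (s x - h x)))%:E) = (fun x => (cabs (s x))%:E)); last first.
    by apply/funext => x; rewrite addrC subrK.
  move=> /le_trans; apply; apply: leeD => //.
  rewrite (_ : (fun x => (cabs (s x - h x))%:E) = (fun x => (cabs (h x - s x))%:E))//.
  by apply/funext => x; rewrite cabsBC.
have A3 : (((lam / 2) ^+ 2)%:E * mu (lset (lam / 2) (fun x => S h x - S s x)%R) <=
    ((opnorm S + 1) ^+ 2 * e)%:E)%E.
  rewrite -(mu_lset_ae _ mShs (cmeasurableB mSh mSs) (S_sub CZ h2 sL2)).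
  apply: (le_trans (chebyshev2 mShs l20)); apply: (le_trans (S_bounded CZ hs2)).
  by rewrite [leRHS]EFinM; apply: lee_wpmul2l => //; rewrite lee_fin sqr_ge0.
apply: (le_trans (lee_wpmul2l _ (mu_lset_split lam mSh mSs))).
  by rewrite lee_fin ltW.
rewrite ge0_muleDr//.
apply: (@le_trans _ _ ((32 * K)%:E * (I1 + e%:E) +
    (4 * (opnorm S + 1) ^+ 2 / lam * e)%:E)%E).
  apply: leeD.
    set X := mu _; have -> : (lam%:E * X = 2%:E * ((lam / 2)%:E * X))%E.
      by rewrite muleA -EFinM; congr (_%:E * _)%E; field.
    apply: (@le_trans _ _ (2%:E * ((16 * K)%:E * (I1 + e%:E)))%E).
      apply: lee_wpmul2l => //; apply: (le_trans A1).
      by apply: lee_wpmul2l => //; rewrite lee_fin mulr_ge0.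
    by rewrite muleA -EFinM mulrA -[2 * 16]natrM.
  set X := mu _; have -> : (lam%:E * X = (4 / lam)%:E * (((lam / 2) ^+ 2)%:E * X))%E.
    by rewrite muleA -EFinM; congr (_%:E * _)%E; field; rewrite gt_eqF.
  apply: (@le_trans _ _ ((4 / lam)%:E * ((opnorm S + 1) ^+ 2 * e)%:E)%E).
    by apply: lee_wpmul2l => //; rewrite lee_fin divr_ge0// ltW.
  by rewrite -EFinM lee_fin le_eqVlt; apply/orP; left; apply/eqP; field; rewrite gt_eqF.
rewrite ge0_muleDr//; last by rewrite lee_fin ltW.
rewrite -addeA; apply: leeD => //; rewrite -EFinM -EFinD lee_fin -mulrDl -/c /e.
by rewrite mulrCA ler_piMr ?ltW// ltr_pdivrMr// mul1r ltrDl.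
Qed.

Lemma weak_sub g h (lam : R) : compact_L1L2 g -> compact_L1L2 h -> 0 < lam ->
  (lam%:E * mu (lset lam (fun x => S g x - S h x)%R) <=
   (32 * K)%:E * \int[mu]_x (cabs (g x - h x)%R)%:E)%E.
Proof.
move=> [g1 g2 _] [h1 h2 _] l0.
have mg := cmeasurable_S g2; have mh := cmeasurable_S h2.
have gh2 := Lp2B g2 h2.
rewrite -(mu_lset_ae lam (cmeasurable_S gh2) (cmeasurableB mg mh) (S_sub CZ g2 h2)).
by apply: weak_L1L2 => //; exact: Lp1B.
Qed.

End weak_type.

Section limits.
Context (R : realType) (d : nat).
Local Notation E := 'rV[R]_d.
Local Notation C := R[i].
Variables (B : (set E)^nat).
Hypothesis mB : forall n, measurable (B n).
Hypothesis Bdecr : forall n n' x, (n <= n')%N -> B n' x -> B n x.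

(** The sequence is uniformly Cauchy off each [B n]. Multiplying by the indicator of the union of
    the complements makes it converge everywhere, so that the limit is measurable. *)
Lemma real_limit (u : nat -> E -> R) : (forall n, measurable_fun setT (u n)) ->
  (forall n n' x, (n <= n')%N -> ~ B n x -> `|u n' x - u n x| <= 2 / 2 ^+ n) ->
  exists2 v : E -> R, measurable_fun setT v &
    forall n x, ~ B n x -> `|v x - u n x| <= 2 / 2 ^+ n.
Proof.
move=> mu_ hu; pose G := \bigcup_n ~` B n.
have mG : measurable G by apply: bigcup_measurable => n _; exact: measurableC.
pose a n x := u n x * \1_G x.
have cva x : cvg (a n x @[n --> \oo]).
  have [[n0 _ nB]|nG] := pselect (G x); last first.
    rewrite (_ : (fun n => a n x) = cst 0); first exact: is_cvg_cst.
    by apply/funext => n; rewrite /a indicE memNset// mulr0.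
  apply/cauchy_cvgP/cauchy_exP => e e0.
  have [n1 hn1] : exists n1, 2 / 2 ^+ n1 < e.
    exists (Num.bound (2 / e)); rewrite ltr_pdivrMr ?exprn_gt0//.
    rewrite mulrC -ltr_pdivrMr//.
    apply: (lt_le_trans (archi_boundP _)); first by rewrite divr_ge0 ?ltW.
    by rewrite -natrX ler_nat ltnW// ltn_expl.
  exists (a (maxn n0 n1) x); exists (maxn n0 n1) => // n /= hn.
  rewrite /ball /= /a indicE mem_set; last by exists n0.
  rewrite !mulr1 distrC; apply: le_lt_trans hn1.
  apply: (le_trans (hu _ _ x hn _)).
    by move=> hB; apply: nB; exact: Bdecr (leq_maxl n0 n1) hB.
  by rewrite ler_pM2l// lef_pV2 ?posrE ?exprn_gt0// ler_eXn2l ?ltr1n// leq_maxr.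
exists (fun x => lim (a n x @[n --> \oo])).
  apply: (measurable_fun_cvg (h := a)); last by move=> x _; exact: cva.
  by move=> n; apply: measurable_funM => //; exact: measurable_indic.
move=> n x nB; apply/ler_addgt0Pr => e e0.
have /cvgrPdist_le /(_ e e0) [n1 _ h] := cva x.
have := h _ (leq_maxr n n1); have := hu n _ x (leq_maxl n n1) nB.
rewrite /a indicE mem_set; last by exists n.
rewrite mulr1; set l := lim _; set b := u (maxn _ _) x.
move=> h1 h2; have := ler_normD (l - b) (b - u n x); rewrite subrKA.
lra.
Qed.

Lemma complex_limit (v : nat -> E -> C) : (forall n, cmeasurable (v n)) ->
  (forall n n' x, (n <= n')%N -> ~ B n x -> cabs (v n' x - v n x) <= 2 / 2 ^+ n) ->
  exists2 w : E -> C, cmeasurable w &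
    forall n x, ~ B n x -> cabs (w x - v n x) <= 4 / 2 ^+ n.
Proof.
move=> mv hv.
have [|r mr hr] := @real_limit (fun n x => complex.Re (v n x)) (fun n => (mv n).1).
  by move=> n n' x h1 h2; rewrite -cReB; apply: (le_trans (cabs_Re _)); exact: hv.
have [|i mi hi] := @real_limit (fun n x => complex.Im (v n x)) (fun n => (mv n).2).
  by move=> n n' x h1 h2; rewrite -cImB; apply: (le_trans (cabs_Im _)); exact: hv.
exists (fun x => Complex (r x) (i x)); first by split.
move=> n x nB; apply: (le_trans (cabs_leReIm _)); rewrite cReB cImB /=.
have := hr n x nB; have := hi n x nB; set q := 2 ^+ n; lra.
Qed.

End limits.

Section extension.
Context (R : realType) (d : nat).
Local Notation E := 'rV[R]_d.
Local Notation C := R[i].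
Local Notation mu := (lebesgue_rV R d).
Variables (k : E -> E -> C) (S : (E -> C) -> (E -> C)).
Hypothesis CZ : CZ_operator k S.
Hypothesis d0 : (0 < d)%N.
Hypothesis hk : (hormander k < +oo)%E.
Local Notation K := (weak_const d (opnorm S) (fine (hormander k))).
Implicit Types (f g h : E -> C).

Let K0 : 0 <= K. Proof. by rewrite weak_const_ge0// fine_hormander_ge0. Qed.

Lemma mu_tail_le (D : (set E)^nat) (c : R) n : 0 <= c ->
  (forall i, measurable (D i)) -> (forall i, mu (D i) <= (c / 2 ^+ i)%:E)%E ->
  (mu (\bigcup_i D (i + n)%N) <= (2 * c / 2 ^+ n)%:E)%E.
Proof.
move=> c0 mD hD.
apply: (@le_trans _ _ (\sum_(i <oo) mu (D (i + n)%N))%E).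
  apply: measure_sigma_subadditive => //; first exact: bigcup_measurable.
have cn0 : 0 <= 2 * c / 2 ^+ n by rewrite divr_ge0 ?mulr_ge0 ?exprn_ge0.
apply: le_trans (epsilon_trick0 xpredT cn0); apply: lee_nneseries => // i _.
apply: (le_trans (hD _)); rewrite lee_fin natrX le_eqVlt; apply/orP; left.
apply/eqP; rewrite exprD exprS.
have := exprn_gt0 i (@ltr0n R 2); have := exprn_gt0 n (@ltr0n R 2).
set a := 2 ^+ n; set b := 2 ^+ i => a0 b0; field.
by rewrite !gt_eqF.
Qed.

(* Along steps [s n] at distance 4^-n from f, the images [S (s n)] form a Cauchy
   sequence off [B n], a set of measure O(2^-n), by the weak type estimate. *)
Lemma L1_limit_exists f : Lp 1%:E f -> exists2 v : E -> C, cmeasurable v &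
  forall g lam, compact_L1L2 g -> 0 < lam ->
  (lam%:E * mu (lset lam (fun x => v x - S g x)%R) <=
   (64 * K)%:E * \int[mu]_x (cabs (f x - g x)%R)%:E)%E.
Proof.
move=> f1; have [mf _] := (Lp1P f).1 f1.
have e0 n : 0 < (4 ^+ n)^-1 :> R by rewrite invr_gt0 exprn_gt0.
have hs n : exists s : E -> C, compact_L1L2 s /\
    (\int[mu]_x (cabs (f x - s x)%R)%:E <= ((4 ^+ n)^-1)%:E)%E.
  have [J [L [s [sd s1 _]]]] := density f1 (e0 n).
  by exists s; split => //; exact: dstep_compact_L1L2 sd.
have [s hs'] := choice hs.
have sc n : compact_L1L2 (s n) by have [] := hs' n.
have s1 n : (\int[mu]_x (cabs (f x - s n x)%R)%:E <= ((4 ^+ n)^-1)%:E)%E by have [] := hs' n.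
have ms n : cmeasurable (s n) by have [/Lp1P[]] := sc n.
have mSs n : cmeasurable (S (s n)) by apply: (cmeasurable_S CZ); have [] := sc n.
have dist g n : compact_L1L2 g -> (\int[mu]_x (cabs (s n x - g x)%R)%:E <=
    \int[mu]_x (cabs (f x - g x)%R)%:E + ((4 ^+ n)^-1)%:E)%E.
  move=> [/Lp1P[mg _] _ _].
  have := integral_cabsD_le (cmeasurableB mf mg) (cmeasurableB (ms n) mf).
  rewrite (_ : (fun x => (cabs (f x - g x + (s n x - f x)))%:E) =
      (fun x => (cabs (s n x - g x))%:E)); last first.
    by apply/funext => x; rewrite addrC subrKA.
  move=> /le_trans; apply; apply: leeD => //.
  rewrite (_ : (fun x => (cabs (s n x - f x))%:E) = (fun x => (cabs (f x - s n x))%:E))//.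
  by apply/funext => x; rewrite cabsBC.
(* The threshold [2^-n] against an L1 distance of at most [2 / 4^n] leaves a measure of order
   [2^-n]. *)
pose D n := lset ((2 ^+ n)^-1) (fun x => S (s n.+1) x - S (s n) x).
have mD n : measurable (D n) by apply: measurable_lset; exact: cmeasurableB.
have muD n : (mu (D n) <= ((64 * K) / 2 ^+ n)%:E)%E.
  have p0 : 0 < (2 ^+ n)^-1 :> R by rewrite invr_gt0 exprn_gt0.
  have := weak_sub CZ d0 hk (sc n.+1) (sc n) p0.
  have K20 : (0 <= (32 * K)%:E)%E by rewrite lee_fin mulr_ge0.
  have hd : (\int[mu]_x (cabs (s n.+1 x - s n x))%:E <= (2 / 4 ^+ n)%:E)%E.
    apply: (le_trans (dist _ _ (sc n))); apply: (le_trans (leeD (s1 n) (lexx _))).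
    rewrite -EFinD lee_fin exprS invfM; have := e0 n; set q := (4 ^+ n)^-1; lra.
  move=> /le_trans/(_ (lee_wpmul2l K20 hd)) h.
  have q0 : (0 <= (2 ^+ n)%:E :> \bar R)%E by rewrite lee_fin exprn_ge0.
  have := lee_wpmul2l q0 h.
  rewrite [leLHS]muleA -[((2 ^+ n)%:E * _)%E]EFinM mulfV ?mul1e ?gt_eqF ?exprn_gt0//.
  move=> /le_trans; apply; rewrite -!EFinM.
  rewrite lee_fin le_eqVlt; apply/orP; left; apply/eqP.
  have -> : 4 ^+ n = 2 ^+ n * 2 ^+ n :> R by rewrite -exprMn -natrM.
  have := exprn_gt0 n (@ltr0n R 2); set a := 2 ^+ n => a0.
  by field; rewrite gt_eqF.
pose B n := \bigcup_i D (i + n)%N.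
have mB n : measurable (B n) by exact: bigcup_measurable.
have muB n : (mu (B n) <= (2 * (64 * K) / 2 ^+ n)%:E)%E.
  by apply: mu_tail_le => //; rewrite mulr_ge0.
have Bdecr n n' x : (n <= n')%N -> B n' x -> B n x.
  move=> nn' [i _ Dx]; exists (i + (n' - n))%N => //.
  by rewrite -addnA subnK.
have hv n n' x : (n <= n')%N -> ~ B n x ->
    cabs (S (s n') x - S (s n) x) <= 2 / 2 ^+ n.
  move=> nn' nB.
  have step m : (n <= m)%N -> cabs (S (s m.+1) x - S (s m) x) <= (2 ^+ m)^-1.
    move=> nm; rewrite leNgt; apply/negP => h; apply: nB; exists (m - n)%N => //.
    by rewrite subnK.
  (* The sharper bound, with [2 / 2 ^+ n'] subtracted, is the one that passes through the
     induction. *)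
  suff : cabs (S (s n') x - S (s n) x) <= 2 / 2 ^+ n - 2 / 2 ^+ n'.
    by move=> /le_trans; apply; rewrite lerBlDr lerDl divr_ge0 ?exprn_ge0.
  move: nn' => /subnK <-; elim: (n' - n)%N => [|i IH].
    by rewrite add0n !subrr cabs0.
  rewrite addSn; apply: (@le_trans _ _ (cabs (S (s (i + n).+1) x - S (s (i + n)%N) x) +
      cabs (S (s (i + n)%N) x - S (s n) x))).
    by apply: le_trans (cabsD _ _); rewrite subrKA.
  have := step _ (leq_addl i n); rewrite [2 ^+ (i + n).+1]exprS invfM.
  by move: IH; set q := (2 ^+ (i + n))^-1; lra.
have [v mv hvn] := complex_limit mB Bdecr mSs hv.
exists v => // g lam gc l0.
have [g1 g2 _] := gc; have mSg := cmeasurable_S CZ g2.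
set I1 := (\int[mu]_x _)%E.
have I10 : (0 <= I1)%E by apply: integral_ge0 => x _; rewrite lee_fin cabs_ge0.
apply/lee_addgt0Pr => eta eta0.
pose c := 64 * K + lam * (2 * (64 * K)).
have c0 : 0 <= c by rewrite addr_ge0 ?mulr_ge0// ltW.
(* [n] must bring [v] within [lam / 2] of [S (s n)] off [B n], and make the L1 error and the measure
   of [B n] cost at most [eta] together. *)
have [n hn1 hn2] : exists2 n, 4 / 2 ^+ n <= lam / 2 & c / 2 ^+ n <= eta.
  have p1 : 0 <= 8 / lam by rewrite divr_ge0// ltW.
  have p2 : 0 <= c / eta by rewrite divr_ge0// ltW.
  pose y := 8 / lam + c / eta; have y0 : 0 <= y by exact: addr_ge0.
  have yb : y <= 2 ^+ Num.bound y.
    by apply: (le_trans (ltW (archi_boundP y0))); rewrite -natrX ler_nat ltnW// ltn_expl.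
  exists (Num.bound y).
    rewrite ler_pdivrMr ?exprn_gt0// mulrC -ler_pdivrMr ?divr_gt0//.
    by apply: le_trans yb; rewrite /y invf_div mulrA -natrM lerDl.
  rewrite ler_pdivrMr ?exprn_gt0// mulrC -ler_pdivrMr//.
  by apply: le_trans yb; rewrite /y lerDr.
have l20 : 0 < lam / 2 by rewrite divr_gt0.
have mdiff := cmeasurableB mv mSg.
have mdn := cmeasurableB (mSs n) mSg.
have A1 := weak_sub CZ d0 hk (sc n) gc l20.
have A2 : (mu (lset lam (fun x => v x - S g x)%R) <=
    mu (lset (lam / 2) (fun x => S (s n) x - S g x)%R) + mu (B n))%E.
  apply: le_trans (mu_setU_le (measurable_lset _ mdn) (mB n)).
  apply: le_measure; rewrite ?inE//; first exact: measurable_lset.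
    by apply: measurableU => //; exact: measurable_lset.
  move=> x; rewrite /lset /= => hx; have [Bx|nB] := pselect (B n x); first by right.
  left; have := le_trans (hvn n x nB) hn1 => h.
  have := cabsD (v x - S (s n) x) (S (s n) x - S g x); rewrite subrKA; lra.
apply: (le_trans (lee_wpmul2l _ A2)); first by rewrite lee_fin ltW.
rewrite ge0_muleDr//.
apply: (@le_trans _ _ ((64 * K)%:E * (I1 + ((4 ^+ n)^-1)%:E) +
    lam%:E * (2 * (64 * K) / 2 ^+ n)%:E)%E).
  apply: leeD; last by apply: lee_wpmul2l => //; rewrite lee_fin ltW.
  set X := mu _; have -> : (lam%:E * X = 2%:E * ((lam / 2)%:E * X))%E.
    by rewrite muleA -EFinM; congr (_%:E * _)%E; field.
  apply: (@le_trans _ _ (2%:E * ((32 * K)%:E * (I1 + ((4 ^+ n)^-1)%:E)))%E).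
    apply: lee_wpmul2l => //; apply: (le_trans A1).
    by apply: lee_wpmul2l; [rewrite lee_fin mulr_ge0|exact: dist].
  by rewrite muleA -EFinM mulrA -[2 * 32]natrM.
rewrite ge0_muleDr//.
rewrite -addeA; apply: leeD => //; rewrite -!EFinM -EFinD lee_fin.
have e : c / 2 ^+ n = 64 * K / 2 ^+ n + lam * (2 * (64 * K) / 2 ^+ n).
  by rewrite /c mulrDl -[lam * _ / _]mulrA.
apply: le_trans hn2; rewrite e; apply: lerD => //; apply: ler_wpM2l; first exact: mulr_ge0.
by rewrite lef_pV2 ?posrE ?exprn_gt0// lerXn2r ?nnegrE// ler_nat.
Qed.

(** [T1] is [S] itself on the initial domain and the limit of images of step functions elsewhere.
    The quantitative comparison with [S] yields the convergence in weak L1, and it later carries the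
    matrix estimate over to [T1]. *)
Lemma T1_exists : exists T1 : (E -> C) -> (E -> C), L1_extension S T1 /\
  forall f g lam, Lp 1%:E f -> compact_L1L2 g -> 0 < lam ->
  (lam%:E * mu (lset lam (fun x => T1 f x - S g x)%R) <=
   (64 * K)%:E * \int[mu]_x (cabs (f x - g x)%R)%:E)%E.
Proof.
have h f : exists v : E -> C, Lp 1%:E f -> [/\ cmeasurable v,
    (compact_L1L2 f -> v = S f) &
    forall g lam, compact_L1L2 g -> 0 < lam ->
    (lam%:E * mu (lset lam (fun x => v x - S g x)%R) <=
     (64 * K)%:E * \int[mu]_x (cabs (f x - g x)%R)%:E)%E].
  have [f1|nf] := pselect (Lp 1%:E f); last by exists (fun=> 0) => /nf.
  have [fc|nfc] := pselect (compact_L1L2 f).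
    exists (S f) => _; have [_ f2 _] := fc; split => //; first exact: (cmeasurable_S CZ).
    move=> g lam gc l0; apply: (le_trans (weak_sub CZ d0 hk fc gc l0)).
    apply: lee_wpmul2r; first by apply: integral_ge0 => x _; rewrite lee_fin cabs_ge0.
    by rewrite lee_fin ler_wpM2r// ler_nat.
  by have [v mv hv] := L1_limit_exists f1; exists v => _; split.
have [T1 hT1] := choice h.
have bnd f g lam : Lp 1%:E f -> compact_L1L2 g -> 0 < lam ->
    (lam%:E * mu (lset lam (fun x => T1 f x - S g x)%R) <=
     (64 * K)%:E * \int[mu]_x (cabs (f x - g x)%R)%:E)%E.
  by move=> f1; have [_ _] := hT1 f f1; exact.
exists T1; split => //; split.
- by move=> f f1; have [] := hT1 f f1.
- move=> f fc; have [f1 _ _] := fc; have [_ e _] := hT1 f f1.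
  by rewrite e//; exact: aeW.
move=> f u f1 uc hu.
apply: (@squeeze_cvge _ _ _ _ (cst 0%E) _
    (fun n => ((64 * K)%:E * cLnorm 1%:E (fun x => u n x - f x)%R)%E)).
- apply: nearW => n; apply/andP; split.
    apply: le_trans (ereal_sup_ubound _); last first.
      by exists 1 => /=; [exact: ltr01 | reflexivity].
    by rewrite mule_ge0// lee_fin.
  apply: ge_ereal_sup => _ /= [lam l0 <-].
  have := bnd f (u n) lam f1 (uc n) l0; rewrite cLnorm1E.
  rewrite (_ : lset lam _ = [set x | (lam < cabs (S (u n) x - T1 f x))%R]); last first.
    by apply/seteqP; split => x; rewrite /lset /= cabsBC.
  rewrite (_ : (fun x => (cabs (f x - u n x))%:E) = (fun x => (cabs (u n x - f x))%:E))//.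
  by apply/funext => x; rewrite cabsBC.
- exact: cvg_cst.
rewrite -[X in _ --> X](mule0 (64 * K)%:E).
exact: cvgeZl.
Qed.

End extension.

(* No measurability is needed, the integral being a supremum over simple
   functions. *)
Lemma ge0_le_integralT d (T : measurableType d) (R : realType)
  (mu : {measure set T -> \bar R}) (f g : T -> \bar R) :
  (forall x, 0 <= f x)%E -> (forall x, f x <= g x)%E ->
  (\int[mu]_x f x <= \int[mu]_x g x)%E.
Proof.
move=> f0 fg; have g0 x : (0 <= g x)%E by exact: le_trans (f0 x) (fg x).
rewrite !ge0_integralTE//; apply: ereal_sup_le => _ /= [h hf <-].
by exists h => // x; exact: le_trans (hf x) (fg x).
Qed.

(** * The weak type inequality for integrable matrix functions *)

Section matrix_weak_type.
Context (R : realType) (d : nat).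
Local Notation E := 'rV[R]_d.
Local Notation C := R[i].
Local Notation mu := (lebesgue_rV R d).
Variables (k : E -> E -> C) (S : (E -> C) -> (E -> C)).
Hypothesis CZ : CZ_operator k S.
Hypothesis d0 : (0 < d)%N.
Hypothesis hk : (hormander k < +oo)%E.
Local Notation K := (weak_const d (opnorm S) (fine (hormander k))).
Variable T1 : (E -> C) -> (E -> C).
Hypothesis T1S : L1_extension S T1.
Hypothesis T1_bound : forall f g lam, Lp 1%:E f -> compact_L1L2 g -> 0 < lam ->
  (lam%:E * mu (lset lam (fun x => T1 f x - S g x)%R) <=
   (64 * K)%:E * \int[mu]_x (cabs (f x - g x)%R)%:E)%E.
Variables (m : nat) (f : E -> 'M[C]_m).
Hypothesis m0 : (0 < m)%N.
Hypothesis f1 : forall i j, Lp 1%:E (fun x => f x i j).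

Let K0 : 0 <= K. Proof. by rewrite weak_const_ge0// fine_hormander_ge0. Qed.

Lemma matrix_density (e : R) : 0 < e -> exists J, exists L, exists s : E -> 'M[C]_m,
  dstep J L s /\ forall i j, (\int[mu]_x (cabs (f x i j - s x i j)%R)%:E <= e%:E)%E.
Proof.
move=> e0; have hs (ij : 'I_m * 'I_m) : exists JLs : nat * nat * (E -> C),
    dstep JLs.1.1 JLs.1.2 (JLs.2 : E -> C^o) /\
    (\int[mu]_x (cabs (f x ij.1 ij.2 - JLs.2 x)%R)%:E <= e%:E)%E.
  have [J [L [s [sd s1 _]]]] := density (f1 ij.1 ij.2) e0.
  by exists (J, L, s).
have [JLs hJLs] := choice hs.
pose J := (\max_ij (JLs ij).1.1)%N; pose L := (\max_ij (JLs ij).1.2)%N.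
have sd ij : dstep J L ((JLs ij).2 : E -> C^o).
  by have [h _] := hJLs ij; apply: dstep_le h; exact: leq_bigmax.
exists J, L, (fun x => \matrix_(i, j) (JLs (i, j)).2 x); split.
  split => [x y xy|x nx]; apply/matrixP => i j; rewrite !mxE.
    exact: (sd (i, j)).1.
  exact: (sd (i, j)).2.
move=> i j; have [_ h] := hJLs (i, j).
by rewrite (_ : (fun x => _) = (fun x => (cabs (f x i j - (JLs (i, j)).2 x))%:E)) //;
  apply/funext => x; rewrite mxE.
Qed.

(** [trn \o s] is itself a dyadic step function once it is viewed as complex valued. *)
Lemma measurable_trn_dstep J L (s : E -> 'M[C]_m) : dstep J L s ->
  measurable_fun setT (fun x => trn (s x)).
Proof.
move=> sd; have h : dstep J L ((fun x => ((trn (s x))%:C)%C) : E -> C^o).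
  by apply: (dstep_comp (h := fun A : 'M[C]_m => ((trn A)%:C)%C : C^o) _ sd); rewrite trn0.
by have [] := cmeasurable_dstep h.
Qed.

(* [trn \o f] is not known to be measurable, so [trn (s x)] is compared with it
   through the measurable function [u]. *)
Lemma integral_trn_le J L (s : E -> 'M[C]_m) (e : R) : dstep J L s ->
  (forall i j, (\int[mu]_x (cabs (f x i j - s x i j)%R)%:E <= e%:E)%E) ->
  (\int[mu]_x (trn (s x))%:E <=
   \int[mu]_x (trn (f x))%:E + ((m * m)%:R * e)%:E)%E.
Proof.
move=> sd se; have mt := measurable_trn_dstep sd.
have ms i j : cmeasurable (fun x => s x i j).
  apply: (@cmeasurable_dstep R d J L); split => [x y xy|x nx].
    by rewrite (sd.1 x y).
  by rewrite (sd.2 x nx) mxE.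
have mfs i j : cmeasurable (fun x => f x i j - s x i j).
  by apply: cmeasurableB => //; exact: (f1 i j).1.
pose D x := \sum_i \sum_j cabs (f x i j - s x i j).
have D0 x : 0 <= D x.
  by apply: sumr_ge0 => i _; apply: sumr_ge0 => j _; exact: cabs_ge0.
have mD : measurable_fun setT D.
  by apply: measurable_sum => i; apply: measurable_sum => j; exact: measurable_cabs.
have tD x : trn (s x) - D x <= trn (f x).
  rewrite lerBlDr; have -> : s x = f x + (s x - f x) by rewrite addrC subrK.
  apply: (le_trans (trnD _ _)); rewrite lerD2l; apply: (le_trans (trn_entries _)).
  apply: ler_sum => i _; apply: ler_sum => j _.
  by rewrite !mxE cabsBC.
pose u x := Num.max (trn (s x) - D x) 0.
have u0 x : 0 <= u x by rewrite le_max lexx orbT.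
have mu_ : measurable_fun setT u.
  by apply: measurable_maxr => //; exact: measurable_funB.
apply: (@le_trans _ _ (\int[mu]_x ((u x)%:E + (D x)%:E))%E).
  apply: ge0_le_integralT => x; first by rewrite lee_fin trn_ge0.
  by rewrite -EFinD lee_fin -lerBlDr le_max lexx.
rewrite ge0_integralD//; last 4 first.
- by move=> x _; rewrite lee_fin.
- exact/measurable_EFinP.
- by move=> x _; rewrite lee_fin.
- exact/measurable_EFinP.
apply: leeD.
  apply: ge0_le_integralT => x; rewrite lee_fin// ge_max tD trn_ge0//.
rewrite (_ : (fun x => (D x)%:E) =
    (fun x => \sum_i \sum_j (cabs (f x i j - s x i j))%:E)%E); last first.
  by apply/funext => x; rewrite /D -sumEFin; apply: eq_bigr => i _; rewrite sumEFin.
have mc i j := measurable_cabsE (mfs i j).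
have pc i j x : (0 <= (cabs (f x i j - s x i j))%:E)%E by rewrite lee_fin cabs_ge0.
rewrite ge0_integral_sum//; last 2 first.
- by move=> i; exact: emeasurable_sum.
- by move=> i x _; exact: sume_ge0.
apply: (@le_trans _ _ (\sum_(i < m) \sum_(j < m) e%:E)%E).
  apply: lee_sum => i _; rewrite ge0_integral_sum//.
  by apply: lee_sum => j _; exact: se.
rewrite !sumEFin lee_fin !sumr_const !card_ord -mulrnA -[leLHS]mulr_natl.
exact: lexx.
Qed.

(** The entries are approximated with error [e] and the level is halved. Off the sets where some
    entry of [T1 f - S s] is large, the error has no singular value above [lam / 2]; on them the
    count is at most [m]. The losses grow with [m] but are proportional to [e], so they leave no
    trace in the constant. *)
Lemma matrix_weak (lam : R) : 0 < lam ->
  (lam%:E * \int[mu]_x ((nsv lam (entrywise T1 f x))%:R)%:E <=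
   (32 * K)%:E * \int[mu]_x (trn (f x))%:E)%E.
Proof.
move=> l0; have m00 : 0 < m%:R :> R by rewrite ltr0n.
have If0 : (0 <= \int[mu]_x (trn (f x))%:E)%E.
  by apply: integral_ge0 => x _; rewrite lee_fin trn_ge0.
apply/lee_addgt0Pr => eta eta0.
(* The losses add up to [c * e]: the first term comes from the trace norm of [s], the second from
   the sets [A i j]. *)
pose c := 32 * K * (m * m)%:R + 256 * m%:R ^+ 5 * K.
have c0 : 0 <= c.
  apply: addr_ge0 (mulr_ge0 (mulr_ge0 _ K0) _) (mulr_ge0 (mulr_ge0 _ _) K0);
    exact: ler0n || exact: exprn_ge0 (ltW m00).
have c10 : 0 < c + 1 by rewrite ltr_wpDl.
have e0 : 0 < eta / (c + 1) by rewrite divr_gt0.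
have [J [L [s [sd se]]]] := matrix_density e0.
have ts := integral_trn_le sd se.
set e := eta / (c + 1) in e0 se ts.
have sc i j : compact_L1L2 (fun x => s x i j).
  apply: (@dstep_compact_L1L2 R d J L); split => [x y xy|x nx].
    by rewrite (sd.1 x y).
  by rewrite (sd.2 x nx) mxE.
have l20 : 0 < lam / 2 by rewrite divr_gt0.
have [g [mg g0 hg ig]] := step_weak CZ d0 hk sd l20.
(* [m ^ 2] entries of this size have trace norm at most [lam / 4], strictly below [lam / 2]. *)
pose del := lam / (4 * m%:R ^+ 2).
have del0 : 0 < del by rewrite divr_gt0// mulr_gt0// exprn_gt0.
pose A i j := lset del (fun x => T1 (fun y => f y i j) x - S (fun y => s y i j) x).
have mA i j : measurable (A i j).
  apply: measurable_lset; apply: cmeasurableB.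
    exact: (L1_extension_measurable T1S).
  by apply: (cmeasurable_S CZ); have [] := sc i j.
have muA i j : (mu (A i j) <= (64 * K * e / del)%:E)%E.
  have h : (del%:E * mu (A i j) <= (64 * K * e)%:E)%E.
    apply: (le_trans (T1_bound (f1 i j) (sc i j) del0)); rewrite [leRHS]EFinM.
    by apply: lee_wpmul2l => //; rewrite lee_fin mulr_ge0.
  have i0 : (0 <= (del^-1)%:E :> \bar R)%E by rewrite lee_fin invr_ge0 ltW.
  have := lee_wpmul2l i0 h.
  by rewrite [leLHS]muleA -[((del^-1)%:E * _)%E]EFinM mulVf ?gt_eqF// mul1e -EFinM [del^-1 * _]mulrC.
have m1 i j : measurable_fun setT (fun x => (\1_(A i j) x : R)%:E).
  by apply/measurable_EFinP; exact: measurable_indic.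
have p1 i j x : (0 <= (\1_(A i j) x : R)%:E)%E by rewrite lee_fin indicE.
have point : {ae mu, forall x, ((nsv lam (entrywise T1 f x))%:R%:E <=
    g x + \sum_i \sum_j m%:R%:E * (\1_(A i j) x)%:E)%E}.
  apply: filterS hg => x hx.
  pose Z := entrywise T1 f x - entrywise S s x.
  apply: (@le_trans _ _ ((nsv (lam / 2) (entrywise S s x))%:R%:E +
      (nsv (lam / 2) Z)%:R%:E)%E).
    rewrite -EFinD lee_fin -natrD ler_nat.
    have -> : entrywise T1 f x = entrywise S s x + Z by rewrite addrC subrK.
    by rewrite {1}[lam]splitr; apply: nsv_add; exact: ltW.
  apply: leeD => //.
  have [[[i j] Aij]|nA] := pselect (exists ij : 'I_m * 'I_m, A ij.1 ij.2 x).
    rewrite (bigD1 i)//= (bigD1 j)//= {1}indicE mem_set// mule1.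
    apply: (@le_trans _ _ m%:R%:E).
      by rewrite lee_fin ler_nat (leq_trans (max_card _))// card_ord.
    rewrite -addeA leeDl// adde_ge0//.
      by apply: sume_ge0 => j' _; rewrite mule_ge0 ?lee_fin.
    by apply: sume_ge0 => i' _; apply: sume_ge0 => j' _; rewrite mule_ge0 ?lee_fin.
  have Zle i j : cabs (Z i j) <= del.
    rewrite leNgt; apply/negP => h; apply: nA; exists (i, j).
    by rewrite /A /lset /=; move: h; rewrite /Z !mxE.
  have tZ : trn Z <= lam / 4.
    apply: (le_trans (trn_entries _)).
    apply: (@le_trans _ _ (\sum_(i < m) \sum_(j < m) del)).
      by apply: ler_sum => i _; apply: ler_sum => j _.
    rewrite !sumr_const !card_ord -mulrnA -[leLHS]mulr_natl natrM /del.
    by rewrite le_eqVlt; apply/orP; left; apply/eqP; field; rewrite gt_eqF.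
  have : nsv (lam / 2) Z = 0%N.
    apply/eqP; rewrite -leqn0 -ltnS -(ltr_nat R) -(ltr_pM2l l20).
    by apply: le_lt_trans (nsv_trn _ l20) _; apply: (le_lt_trans tZ); lra.
  move=> ->; apply: sume_ge0 => i _; apply: sume_ge0 => j _.
  by rewrite mule_ge0 ?lee_fin.
pose G x : \bar R := (\sum_i \sum_j m%:R%:E * (\1_(A i j) x)%:E)%E.
have mG : measurable_fun setT G.
  by apply: emeasurable_sum => i; apply: emeasurable_sum => j; exact: measurable_funeM.
have G0 x : (0 <= G x)%E.
  by apply: sume_ge0 => i _; apply: sume_ge0 => j _; rewrite mule_ge0 ?lee_fin.
have IG : (\int[mu]_x G x <= (m%:R ^+ 3 * (64 * K * e / del))%:E)%E.
  rewrite ge0_integral_sum//; last 2 first.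
  - by move=> i; apply: emeasurable_sum => j; exact: measurable_funeM.
  - by move=> i x _; apply: sume_ge0 => j _; rewrite mule_ge0 ?lee_fin.
  apply: (@le_trans _ _ (\sum_(i < m) \sum_(j < m) (m%:R * (64 * K * e / del))%:E)%E).
    apply: lee_sum => i _; rewrite ge0_integral_sum//; last first.
      by move=> j; exact: measurable_funeM.
    apply: lee_sum => j _; rewrite ge0_integralZl_EFin//.
    rewrite integral_indic// setIT [leRHS]EFinM.
    by apply: lee_wpmul2l; [rewrite lee_fin|exact: muA].
  rewrite !sumEFin lee_fin !sumr_const !card_ord -mulrnA -[leLHS]mulr_natl natrM.
  by rewrite le_eqVlt; apply/orP; left; apply/eqP; ring.
apply: (@le_trans _ _ (lam%:E * (\int[mu]_x g x + \int[mu]_x G x))%E).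
  apply: lee_wpmul2l; first by rewrite lee_fin ltW.
  rewrite -ge0_integralD//; apply: nonmeasurable_ge0_integral_le => //.
  - by move=> x; apply: adde_ge0.
  - exact: emeasurable_funD.
rewrite ge0_muleDr//; last 2 first.
- by apply: integral_ge0.
- by apply: integral_ge0.
apply: (@le_trans _ _ ((32 * K)%:E * (\int[mu]_x (trn (f x))%:E + ((m * m)%:R * e)%:E) +
    lam%:E * (m%:R ^+ 3 * (64 * K * e / del))%:E)%E).
  apply: leeD; last by apply: lee_wpmul2l => //; rewrite lee_fin ltW.
  apply: (le_trans (lee_wpmul2l _ ig)); first by rewrite lee_fin ltW.
  have eK : lam * (16 * K / (lam / 2)) = 32 * K.
    by move: (K) => K'; field; rewrite gt_eqF.
  rewrite [leLHS]muleA -[(lam%:E * _)%E]EFinM eK.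
  by apply: lee_wpmul2l => //; rewrite lee_fin mulr_ge0.
rewrite ge0_muleDr//; last by rewrite lee_fin mulr_ge0// ltW.
have key : 32 * K * ((m * m)%:R * e) + lam * (m%:R ^+ 3 * (64 * K * e / del)) <= eta.
  have -> : 32 * K * ((m * m)%:R * e) + lam * (m%:R ^+ 3 * (64 * K * e / del)) = c * e.
    rewrite /c /del natrM; move: (K) (e) => K' e'; field.
    by rewrite !gt_eqF.
  by rewrite /e mulrCA ler_piMr ?ltW// ltr_pdivrMr// mul1r ltrDl.
move: key; move: (\int[mu]_x _)%E (32 * K) ((m * m)%:R * e).
move: (m%:R ^+ 3 * _) => x1 I1 x2 x3 key.
by rewrite -addeA leeD2l// -!EFinM -EFinD lee_fin.
Qed.

End matrix_weak_type.

Theorem theoremA (R : realType) :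
  exists C : nat -> R -> R -> R,
  forall (d : nat) (k : 'rV[R]_d -> 'rV[R]_d -> R[i])
    (T : ('rV[R]_d -> R[i]) -> ('rV[R]_d -> R[i])),
  (0 < d)%N ->
  CZ_operator k T ->
  (hormander k < +oo)%E ->
  exists T1 : ('rV[R]_d -> R[i]) -> ('rV[R]_d -> R[i]),
  L1_extension T T1 /\
  forall (m : nat) (f : 'rV[R]_d -> 'M[R[i]]_m),
  (0 < m)%N ->
  (forall i j, Lp 1%:E (fun x => f x i j)) ->
  (ereal_sup [set lam%:E * \int[lebesgue_rV R d]_x
                (Retr (spectral_proj lam (mxabs (entrywise T1 f x))))%:E
             | lam in [set lam : R | (0 < lam)%R]]
   <= (C d (opnorm T) (fine (hormander k)))%:E *
      \int[lebesgue_rV R d]_x (Retr (mxabs (f x)))%:E)%E.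
Proof.
(* The 16 of the step estimate, doubled by halving the level in [matrix_weak]. *)
exists (fun d M H => 32 * weak_const d M H) => d k T d0 CZ hk.
have [T1 [T1S bnd]] := T1_exists CZ d0 hk; exists T1; split => // m f m0 f1.
apply: ge_ereal_sup => _ /= [lam l0 <-].
have e x : Retr (spectral_proj lam (mxabs (entrywise T1 f x))) =
    (nsv lam (entrywise T1 f x))%:R by exact: Retr_spectral_proj.
have := matrix_weak CZ d0 hk T1S bnd m0 f1 l0.
by rewrite (eq_integral (fun x => (Retr (spectral_proj lam (mxabs (entrywise T1 f x))))%:E)) // => x _; rewrite e.
Qed.
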